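(* In dimension $2$, the norms $\|h\partial_\nu u\|^2_{L^2(F_j)}$, $j=0,1,2$, of the semiclassical Neumann data of an eigenfunction $u$ of $P=-\sum_{i,j}\Gamma_{ij}\,h\partial_{x_i}h\partial_{x_j}$ on the standard simplex $T_0$ uniquely determine $\Gamma=BB^T$. The corresponding result is false in higher dimensions (dimension $n\geq 3$), even for small perturbations of $I$: the norms of the Neumann data on the faces of $T_0$ do not determine $\Gamma$. An example in dimension $3$ is the following. For $0<\epsilon<1$, define the $3\times 3$ matrix $B$ by $$B^T=\begin{pmatrix} a & 0 & 0\\ d & (1-\epsilon^2)^{1/2} & \epsilon\\ \epsilon & \epsilon & (1-\epsilon^2)^{1/2}\end{pmatrix},$$ where $$d=\frac{-3\epsilon(1-\epsilon^2)^{1/2}-\epsilon^2}{(1-\epsilon^2)^{1/2}+\epsilon},\qquad a=(1-d^2-\epsilon^2)^{1/2}.$$ Then $B=I+O(\epsilon)$ and $$|B^Te_1|^2=|B^Te_2|^2=|B^Te_3|^2=1,\qquad |B^T(1,1,1)^T|^2=3.$$ These are the same values one gets from $B=I=\Gamma$; however $BB^T\neq I$, so these four numbers do not determine $\Gamma$.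
   Context: The standard simplex $T_0\subset\mathbb{R}^n$ is the convex hull of $0,e_1,\dots,e_n$, where $e_1,\dots,e_n$ are the standard basis vectors. Its faces are $F_j=T_0\cap\{x_j=0\}$ for $1\leq j\leq n$, with outward unit normal $\nu_j=-e_j$, and $F_0=T_0\cap\{x_1+\cdots+x_n=1\}$, with outward unit normal $\nu_0=n^{-1/2}(1,\dots,1)$. $B$ is a non-degenerate $n\times n$ matrix, $\Gamma=BB^T$, and $u$ solves the eigenfunction problem $Pu=u$ in $T_0$, $u|_{\partial T_0}=0$, $\|u\|_{L^2(T_0)}=1$, where $h>0$ is the semiclassical parameter. $h\partial_\nu$ is the semiclassical (outward unit) normal derivative on $\partial T_0$. The quantities $|B^T\nu_j|^2$ enter through the identity, valid in every dimension, for each $0\leq j\leq n$, $$\int_{F_j}(h\partial_{\nu_j}u)(\nu_j^TBB^Th\partial_x\bar u)\,dS_j=|B^T\nu_j|^2\int_{F_j}|h\partial_{\nu_j}u|^2\,dS_j,$$ where $dS_j$ is the induced surface measure on $F_j$ and $\partial_x$ is the gradient. In dimension $3$ the four normals are $\nu_j=-e_j$ ($1\leq j\leq 3$) and $\nu_0=3^{-1/2}(1,1,1)$.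
   Formalization: The example is stated for those 0<ε<1 with 1-d²-ε²≥0, since otherwise a is not real (e.g. ε=1/2); for small perturbations of I, the norms are shown to agree for all eigenfunctions, whose existence is taken as given. *)

(* Defs.v *)
From mathcomp Require Import all_boot all_order all_algebra.
From mathcomp Require Import all_classical all_reals all_analysis.
From mathcomp.real_closed Require Import complex.

Set Implicit Arguments.
Unset Strict Implicit.
Unset Printing Implicit Defensive.

Import Order.TTheory GRing.Theory Num.Theory.
Import numFieldNormedType.Exports.

Local Open Scope classical_set_scope.
Local Open Scope ring_scope.

(* Points of R^n are column vectors.  Vertices, faces and normals are indexed
   by [option 'I_n]: [None] is the index 0 and [Some k] is the index k+1 of
   the usual 0..n numbering, so that [Some k] refers to the k-th basis vector
   and to the k-th coordinate. *)

Definition basis_vec {R : realType} {n : nat} (i : 'I_n) : 'cV[R]_n :=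
  delta_mx i 0.

Definition vertex {R : realType} {n : nat} (j : option 'I_n) : 'cV[R]_n :=
  if j is Some i then basis_vec i else 0.

Definition simplex (R : realType) (n : nat) : set 'cV[R]_n :=
  [set x | exists w : option 'I_n -> R,
     [/\ forall j, 0 <= w j, \sum_j w j = 1 & x = \sum_j w j *: vertex j]].

Definition face {R : realType} {n : nat} (j : option 'I_n) : set 'cV[R]_n :=
  if j is Some k then @simplex R n `&` [set x | x k 0 = 0]
  else @simplex R n `&` [set x | \sum_i x i 0 = 1].

Definition normal {R : realType} {n : nat} (j : option 'I_n) : 'cV[R]_n :=
  if j is Some k then - basis_vec k
  else (Num.sqrt (n%:R : R))^-1 *: const_mx 1.

Definition sqnorm {R : realType} {n : nat} (v : 'cV[R]_n) : R :=
  \sum_i v i 0 ^+ 2.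

Definition sqmod {R : realType} (z : R[i]) : R :=
  complex.Re z ^+ 2 + complex.Im z ^+ 2.

(* Lebesgue integral over R^n as an iterated integral; it is only applied to
   functions that are nonnegative, vanish off a compact set and are continuous
   on it, for which Tonelli's theorem identifies the two. *)
Fixpoint integral_cV {R : realType} (n : nat) : ('cV[R]_n -> \bar R) -> \bar R :=
  match n return ('cV[R]_n -> \bar R) -> \bar R with
  | 0 => fun f => f 0
  | m.+1 => fun f =>
      (\int[@lebesgue_measure R]_t
         integral_cV (fun y : 'cV[R]_m => f (col_mx (t%:M : 'cV[R]_1) y)))%E
  end.

Definition set_integral {R : realType} {n : nat} (A : set 'cV[R]_n)
    (f : 'cV[R]_n -> R) : \bar R :=
  integral_cV (fun x => (\1_A x * f x)%:E).

(* The point of R^(n+1) with k-th coordinate t and other coordinates y. *)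
Definition insert_coord {R : realType} {n : nat} (k : 'I_n.+1) (t : R)
    (y : 'cV[R]_n) : 'cV[R]_n.+1 :=
  \col_i (if unlift k i is Some i' then y i' 0 else t).

(* The hyperplane carrying a face, as a graph over a coordinate hyperplane:
   {x_k = 0}, or {x_0 = 1 - (sum of the other coordinates)}. *)
Definition face_chart {R : realType} {n : nat} (j : option 'I_n.+1)
    (y : 'cV[R]_n) : 'cV[R]_n.+1 :=
  if j is Some k then insert_coord k 0 y
  else insert_coord ord0 (1 - \sum_i y i 0) y.

(* The surface element (1 + |grad g|^2)^(1/2) of the graph g of [face_chart];
   for the slanted face |grad g|^2 = n in dimension n+1. *)
Definition face_density {R : realType} {n : nat} (j : option 'I_n.+1) : R :=
  if j is Some _ then 1 else Num.sqrt (n.+1)%:R.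

Definition face_integral {R : realType} {n : nat} (j : option 'I_n.+1)
    (f : 'cV[R]_n.+1 -> R) : \bar R :=
  integral_cV (fun y : 'cV[R]_n =>
    (\1_(face j) (face_chart j y) * f (face_chart j y) * face_density j)%:E).

(* Semiclassical directional derivative, componentwise on Re and Im. *)
Definition hderiv {R : realType} {n : nat} (h : R) (v : 'cV[R]_n)
    (u : 'cV[R]_n -> R[i]) : 'cV[R]_n -> R[i] :=
  fun x => Complex (h * 'D_v (fun y => complex.Re (u y)) x)
                   (h * 'D_v (fun y => complex.Im (u y)) x).

Definition hpartial {R : realType} {n : nat} (h : R) (i : 'I_n) :=
  @hderiv R n h (basis_vec i).

Definition semiclassical_op {R : realType} {n : nat} (h : R) (Gam : 'M[R]_n)
    (u : 'cV[R]_n -> R[i]) (x : 'cV[R]_n) : R[i] :=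
  - \sum_i \sum_j Complex (Gam i j) 0 * hpartial h i (hpartial h j u) x.

(* C^2 in the open simplex, with first derivatives that extend continuously to
   the closed simplex.  Since every tangent cone of the simplex at a point of a
   face of codimension at least 2 is strictly contained in a half-space, all
   Dirichlet eigenfunctions of constant-coefficient elliptic operators on the
   simplex have this regularity. *)
Definition regular {R : realType} {n : nat} (f : 'cV[R]_n -> R) : Prop :=
  let T := @simplex R n in
  let d (i : 'I_n) (g : 'cV[R]_n -> R) := 'D_(basis_vec i) g in
  [/\ {within T, continuous f},
      forall i x, T° x ->
        derivable f x (basis_vec i) /\ {for x, continuous (d i f)},
      forall i k x, T° x ->
        derivable (d i f) x (basis_vec k) /\ {for x, continuous (d k (d i f))} &
      forall i x, T x -> cvg ((d i f) @ within T° (nbhs x))].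

(* Pu = u in T_0, u = 0 on the boundary, |u|_{L^2(T_0)} = 1. *)
Record eigenfunction {R : realType} {n : nat} (h : R) (Gam : 'M[R]_n)
    (u : 'cV[R]_n -> R[i]) : Prop := Eigenfunction {
  eigen_regular_Re : regular (fun x => complex.Re (u x));
  eigen_regular_Im : regular (fun x => complex.Im (u x));
  eigen_eq : forall x, (@simplex R n)° x -> semiclassical_op h Gam u x = u x;
  eigen_bdry : forall x, (@simplex R n `\` (@simplex R n)°) x -> u x = 0;
  eigen_norm : set_integral (@simplex R n) (fun x => sqmod (u x)) = 1%E
}.

(* Boundary values of a function from inside the simplex. *)
Definition interior_trace {R : realType} {n : nat} (g : 'cV[R]_n -> R[i])
    (x : 'cV[R]_n) : R[i] :=
  let F := within (@simplex R n)° (nbhs x) in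
  Complex (lim ((fun y => complex.Re (g y)) @ F))
          (lim ((fun y => complex.Im (g y)) @ F)).

Definition neumann_data {R : realType} {n : nat} (h : R)
    (u : 'cV[R]_n -> R[i]) (j : option 'I_n) : 'cV[R]_n -> R[i] :=
  interior_trace (hderiv h (normal j) u).

Definition neumann_sqnorm {R : realType} {n : nat} (h : R)
    (u : 'cV[R]_n.+1 -> R[i]) (j : option 'I_n.+1) : \bar R :=
  face_integral j (fun x => sqmod (neumann_data h u j x)).

(* In dimension n+1: from the norms of the Neumann data, on all faces, of one
   eigenfunction at the semiclassical parameter h (resp. h') one recovers
   Gamma = B B^T. *)
Definition neumann_norms_determine {R : realType} (n : nat) (h h' : R) : Prop :=
  forall (B B' : 'M[R]_n.+1) (u u' : 'cV[R]_n.+1 -> R[i]),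
    B \in unitmx -> B' \in unitmx ->
    eigenfunction h (B *m B^T) u -> eigenfunction h' (B' *m B'^T) u' ->
    (forall j, neumann_sqnorm h u j = neumann_sqnorm h' u' j) ->
    B *m B^T = B' *m B'^T.

(* Any two eigenfunctions, for B B^T and for B' B'^T, have the same norms of
   the Neumann data on every face. *)
Definition neumann_norms_agree {R : realType} {n : nat} (B B' : 'M[R]_n.+1) :
    Prop :=
  forall (h h' : R) (u u' : 'cV[R]_n.+1 -> R[i]), 0 < h -> 0 < h' ->
    eigenfunction h (B *m B^T) u -> eigenfunction h' (B' *m B'^T) u' ->
    forall j, neumann_sqnorm h u j = neumann_sqnorm h' u' j.

Definition ex_d {R : realType} (e : R) : R :=
  (- 3 * e * Num.sqrt (1 - e ^+ 2) - e ^+ 2) / (Num.sqrt (1 - e ^+ 2) + e).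

(* [Num.sqrt] is 0 on negative reals, so [ex_a] is the intended square root
   only where [ex_a_sq] is nonnegative.  This holds for small e > 0 but not on
   all of ]0, 1[ : at e = 1/2, [ex_d] is less than -1. *)
Definition ex_a_sq {R : realType} (e : R) : R := 1 - ex_d e ^+ 2 - e ^+ 2.
Definition ex_a {R : realType} (e : R) : R := Num.sqrt (ex_a_sq e).

Definition ex_BT {R : realType} (e : R) : 'M[R]_3 :=
  \matrix_(i < 3, j < 3)
    (nth [::] [:: [:: ex_a e; 0; 0];
                  [:: ex_d e; Num.sqrt (1 - e ^+ 2); e];
                  [:: e; e; Num.sqrt (1 - e ^+ 2)]] i)`_j.

Definition ex_B {R : realType} (e : R) : 'M[R]_3 := (ex_BT e)^T.

(* Main.v *)
(** Multiplying P u = u by the dilation field about the vertex opposite to F_j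
    and integrating by parts (a Rellich identity) gives, since u vanishes on the
    boundary,
      |B^T nu_j|^2 * ||h d_nu u||^2_{L^2(F_j)} = 2 / dist (F_j, opposite vertex),
    so the norms of the Neumann data know Gamma only through the n + 1 numbers
    <Gamma nu_j, nu_j>, that is, the diagonal of Gamma and the sum of its
    entries.  For n = 2 these three numbers determine the three entries of
    Gamma; for n >= 3 there are fewer equations than entries.

    No derivative of u beyond the first is controlled up to the boundary, so the
    identity is not obtained from the field directly: Green's second identity is
    applied to u and to its dilate u(s .), with a cutoff away from the faces,
    and then s -> 1.

    For genuine eigenfunctions that defeat the determination in dimension
    n >= 3, one needs matrices Gamma for which the Dirichlet problem is
    solvable in closed form.  Take as new coordinates the partial sums y_k of
    the x_i in some order: the simplex becomes the alcove
    0 <= y_1 <= ... <= y_n <= 1, on which det (sin (pi j y_k)) is an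
    eigenfunction of the Laplacian.  Reordering the x_i permutes the entries of
    Gamma. *)

(* [fingroup] also defines [normal]; the later import of [Defs] shadows it. *)
From mathcomp Require Import fingroup perm.
Require Import Defs.
From mathcomp Require Import all_boot all_order all_algebra.
From mathcomp Require Import all_classical all_reals all_analysis.
From mathcomp.real_closed Require Import complex.
From mathcomp Require Import ring lra zify.

Set Implicit Arguments.
Unset Strict Implicit.
Unset Printing Implicit Defensive.

Import Order.TTheory GRing.Theory Num.Theory.
Import numFieldNormedType.Exports.

Local Open Scope classical_set_scope.
Local Open Scope ring_scope.

(** Where the constant 2 comes from: with [d = 1 - s] the bulk factor of Green's identity is
    [s ^+ 2 - 1 = - d * (2 - d)], and on face [j], where [F] vanishes, the dilate of [F] is [- d]
    times the radial derivative up to [o(d)]. Dividing by [d] leaves twice the mass of [F ^+ 2]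
    against a boundary term that is quadratic, because the gradient is normal on the face. A
    dilation maps each hyperplane through its centre to itself, which is why a single face
    contributes. The divergence theorem is therefore shaped for fields whose partial derivatives
    exist only inside, while their sum extends continuously: for the Green field that sum is
    [s ^+ 2 - 1] times the product of [F] and its dilate. Integrals are iterated and taken of
    continuous compactly supported functions, so that induction on the dimension and uniform
    continuity replace Fubini and dominated convergence. Existence of eigenfunctions is proved for
    the alcove matrices only. Close to the identity another family is used, and
    [neumann_norms_agree] speaks of whatever eigenfunctions there are. *)

Definition consv {R : realType} {n} (t : R) (y : 'cV[R]_n) : 'cV[R]_n.+1 :=
  col_mx (t%:M : 'cV[R]_1) y.

Lemma consv0 (R : realType) n (t : R) (y : 'cV[R]_n) : consv t y ord0 0 = t.
Proof.
rewrite (_ : ord0 = lshift n (ord0 : 'I_1)); last exact: val_inj.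
by apply: (etrans (@col_mxEu R 1 n 1 _ y ord0 0)); rewrite mxE eqxx mulr1n.
Qed.

Lemma consvS (R : realType) n (t : R) (y : 'cV[R]_n) (i : 'I_n) :
  consv t y (lift ord0 i) 0 = y i 0.
Proof.
rewrite (_ : lift ord0 i = rshift 1 i); last exact: val_inj.
exact: (@col_mxEd R 1 n 1 _ y i 0).
Qed.

Lemma cV_ext (R : realType) n (x y : 'cV[R]_n) :
  (forall i, x i 0 = y i 0) -> x = y.
Proof. by move=> h; apply/colP. Qed.

Lemma consv_eta (R : realType) n (x : 'cV[R]_n.+1) :
  x = consv (x ord0 0) (row' ord0 x).
Proof.
apply: cV_ext => i; case: (unliftP ord0 i) => [j ->|->].
  by rewrite consvS mxE.
by rewrite consv0.
Qed.

(** * Neighbourhoods, compactness and uniform continuity in coordinates *)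

Definition vclose {R : realType} {n} (e : R) (x y : 'cV[R]_n) :=
  forall i, `|x i 0 - y i 0| < e.

Lemma ball_vclose (R : realType) n (e : R) (x y : 'cV[R]_n) : 0 < e ->
  ball x e y <-> vclose e x y.
Proof.
move=> e0; split => [[_ h]|h].
  by move=> i; have := h i 0; rewrite /ball /= /ball_.
by split => // i j; rewrite (ord1 j); apply: h.
Qed.

Lemma cvg_vclose (R : realType) n (f : 'cV[R]_n -> R) (x : 'cV[R]_n) :
  {for x, continuous f} <->
  forall e : R, 0 < e -> exists2 d : R, 0 < d &
     forall y, vclose d x y -> `|f x - f y| < e.
Proof.
split.
  move=> /cvgrPdist_lt fx e e0.
  have /nbhs_ballP[d /= d0 hd] := fx e e0.
  by exists d => // y /(ball_vclose _ _ d0) /hd.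
move=> h; apply: (proj2 (@cvgrPdist_lt R R _ (nbhs x) _ f (f x))) => e e0.
have [d d0 hd] := h e e0.
apply/nbhs_ballP; exists d => //= y /(ball_vclose _ _ d0); exact: hd.
Qed.

Lemma nbhs_vclose (R : realType) n (x : 'cV[R]_n) (A : set 'cV[R]_n) :
  nbhs x A <-> exists2 d : R, 0 < d & forall y, vclose d x y -> A y.
Proof.
split.
  move=> /nbhs_ballP[d /= d0 hd]; exists d => // y /(ball_vclose _ _ d0); exact: hd.
move=> [d d0 hd]; apply/nbhs_ballP; exists d => //= y /(ball_vclose _ _ d0); exact: hd.
Qed.

Definition box {R : realType} {n} (M : R) : set 'cV[R]_n :=
  [set x | forall i, `|x i 0| <= M].

Lemma continuous_trmx_rV (R : realType) n :
  continuous (fun x : 'rV[R]_n => x^T : 'cV[R]_n).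
Proof.
move=> x A /= /nbhs_ballP[e /= e0 h].
apply/nbhs_ballP; exists e => //= y [_ xy]; apply: h; split => // i j.
by rewrite !mxE; exact: xy.
Qed.

(** [rV_compact] concerns row vectors; the box is the image of such a product under transposition,
    which is continuous. *)
Lemma box_compact (R : realType) n (M : R) : compact (@box R n M).
Proof.
have c1 : compact [set v : 'rV[R]_n | forall i, v ord0 i \in `[- M, M]].
  have := @rV_compact R n (fun=> [set` `[- M, M]]); apply => _.
  exact: segment_compact.
rewrite (_ : box M = (fun x : 'rV[R]_n => x^T : 'cV[R]_n) @`
   [set v : 'rV[R]_n | forall i, v ord0 i \in `[- M, M]]).
  apply: continuous_compact => //.
  by apply: continuous_subspaceT; exact: continuous_trmx_rV.
apply/seteqP; split => [x h|_ [x h <-]].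
  exists x^T; last by rewrite trmxK.
  move=> i /=; rewrite mxE in_itv /=.
  by rewrite -ler_norml; exact: h.
by move=> i; rewrite mxE ler_norml; have := h i; rewrite in_itv.
Qed.

Definition supp {R : realType} {n} (M : R) (f : 'cV[R]_n -> R) :=
  forall (x : 'cV[R]_n) i, M < `|x i 0| -> f x = 0.

Definition Cc {R : realType} {n} (f : 'cV[R]_n -> R) :=
  continuous f /\ exists M, supp M f.

Lemma supp_box (R : realType) n (M : R) (f : 'cV[R]_n -> R) x :
  supp M f -> f x <> 0 -> box M x.
Proof. by move=> sf fx i; rewrite leNgt; apply/negP => /sf. Qed.

Lemma supp_le (R : realType) n (M M' : R) (f : 'cV[R]_n -> R) :
  M <= M' -> supp M f -> supp M' f.
Proof. by move=> MM sf x i h; apply: (sf x i); apply: le_lt_trans h. Qed.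

Lemma vdist_continuous (R : realType) n (i : 'I_n) :
  continuous (fun x : 'cV[R]_n => x i 0).
Proof. exact: coord_continuous. Qed.

(* The minimum of [l] over the compact set where [|phi| >= e] is positive. *)
Lemma vanishing_small (R : realType) n (phi l : 'cV[R]_n -> R) (e : R) :
  Cc phi -> continuous l -> (forall x, l x <= 0 -> phi x = 0) -> 0 < e ->
  exists2 d : R, 0 < d & forall x, l x <= d -> `|phi x| < e.
Proof.
move=> [cphi [M sphi]] cl h e0.
pose A := box M `&` [set x | e <= `|phi x|].
have cA : compact A.
  apply: compact_closedI; first exact: box_compact.
  have -> : [set x | e <= `|phi x|] = (fun x => `|phi x|) @^-1` [set t | e <= t].
    by [].
  apply: preimage_closed; last exact: closed_ge.
  move=> x _; apply: (@continuous_comp _ _ _ phi (@Num.norm _ _)); first exact: cphi.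
  exact: norm_continuous.
have [[x0 Ax0]|An] := pselect (A !=set0); last first.
  exists 1 => // x _; rewrite ltNge; apply/negP => hx; apply: An; exists x.
  split => //; apply: (supp_box sphi) => p0; move: hx; rewrite p0 normr0.
  by rewrite leNgt e0.
have [c /set_mem [_ /= cA'] hc] := compact_EVT_min (ex_intro _ x0 Ax0) cA
   (continuous_subspaceT cl).
exists (l c / 2).
  rewrite divr_gt0// ltNge; apply/negP => /h p0; move: cA'; rewrite p0 normr0.
  by rewrite leNgt e0.
have lc : 0 < l c.
  rewrite ltNge; apply/negP => /h p0; move: cA'; rewrite p0 normr0.
  by rewrite leNgt e0.
move=> x lx; rewrite ltNge; apply/negP => hx.
have : l c <= l x.
  apply: hc; apply/mem_set; split => //; apply: (supp_box sphi) => p0.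
  by move: hx; rewrite p0 normr0 leNgt e0.
lra.
Qed.

(** On the compact set of pairs with [|f x - f y| >= e] the distance attains its minimum, which is
    positive because the set avoids the diagonal. That minimum is the modulus. *)
Lemma box_unif_cont (R : realType) n (f : 'cV[R]_n -> R) (M e : R) :
  continuous f -> 0 < e -> exists2 d : R, 0 < d &
    forall x y, box M x -> box M y -> vclose d x y -> `|f x - f y| < e.
Proof.
move=> cf e0.
pose A : set ('cV[R]_n * 'cV[R]_n) :=
  (box M `*` box M) `&` [set p | e <= `|f p.1 - f p.2|].
have cA : compact A.
  apply: compact_closedI; first by apply: compact_setX; exact: box_compact.
  have -> : [set p : 'cV[R]_n * 'cV[R]_n | e <= `|f p.1 - f p.2|] =
     (fun p => `|f p.1 - f p.2|) @^-1` [set t | e <= t] by [].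
  apply: preimage_closed; last exact: closed_ge.
  move=> p _; apply: cvg_norm; apply: cvgB.
    by apply: (@continuous_comp _ _ _ fst f); [exact: cvg_fst|exact: cf].
  by apply: (@continuous_comp _ _ _ snd f); [exact: cvg_snd|exact: cf].
have [[x0 Ax0]|An] := pselect (A !=set0); last first.
  exists 1 => // x y bx by' _; rewrite ltNge; apply/negP => hx; apply: An.
  by exists (x, y).
have cl : continuous (fun p : 'cV[R]_n * 'cV[R]_n => mx_norm (p.1 - p.2)).
  move=> p; apply: (@cvg_norm R 'cV[R]_n); apply: cvgB; [exact: cvg_fst|exact: cvg_snd].
have [c /set_mem [_ /= cA'] hc] := compact_EVT_min (ex_intro _ x0 Ax0) cA
   (continuous_subspaceT cl).
have lc : 0 < mx_norm (c.1 - c.2).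
  rewrite lt_neqAle (@normr_ge0 R 'cV[R]_n) andbT eq_sym; apply/eqP => h0.
  have /eqP : c.1 - c.2 = 0 by apply/eqP; rewrite -(@normr_eq0 R 'cV[R]_n); apply/eqP.
  rewrite subr_eq0 => /eqP h1; move: cA'; rewrite h1 subrr normr0.
  by rewrite leNgt e0.
exists (mx_norm (c.1 - c.2)) => // x y bx by' xy; rewrite ltNge; apply/negP => hx.
have : mx_norm (c.1 - c.2) <= mx_norm (x - y).
  by apply: (hc (x, y)); apply/mem_set.
apply/negP; rewrite -ltNge.
have : ball x (mx_norm (c.1 - c.2)) y by apply/ball_vclose.
by rewrite -ball_normE.
Qed.

Lemma Cc_unif_cont (R : realType) n (f : 'cV[R]_n -> R) (e : R) :
  Cc f -> 0 < e -> exists2 d : R, 0 < d &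
    forall x y, vclose d x y -> `|f x - f y| < e.
Proof.
move=> [cf [M sf]] e0.
(* A margin of 1 around the support: if two points are closer than 1 and one lies outside the larger
   box, then [f] vanishes at both. *)
have [d d0 hd] := @box_unif_cont R n f (M + 1) e cf e0.
exists (Num.min d 1); first by rewrite lt_min d0 ltr01.
move=> x y xy.
have xy1 : vclose d x y by move=> i; have := xy i; rewrite lt_min => /andP[].
have xy2 : vclose 1 x y by move=> i; have := xy i; rewrite lt_min => /andP[].
have [bx|nbx] := pselect (box (M + 1) x); have [by'|nby] := pselect (box (M + 1) y).
- exact: hd.
- suff -> : f x = f y by rewrite subrr normr0.
  have [i hi] : exists i, M + 1 < `|y i 0|.
    apply: contra_notP nby => /forallNP h i; rewrite leNgt; apply/negP; exact: h.
  rewrite (sf y i) ?(sf x i)//; last lra.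
  have := xy2 i; have := ler_distD 0 (x i 0) (y i 0).
  have := ler_normD (y i 0 - x i 0) (x i 0); rewrite subrK distrC; lra.
- suff -> : f x = f y by rewrite subrr normr0.
  have [i hi] : exists i, M + 1 < `|x i 0|.
    apply: contra_notP nbx => /forallNP h i; rewrite leNgt; apply/negP; exact: h.
  rewrite (sf x i) ?(sf y i)//; last lra.
  have := xy2 i.
  have := ler_normD (x i 0 - y i 0) (y i 0); rewrite subrK; lra.
- suff -> : f x = f y by rewrite subrr normr0.
  have [i hi] : exists i, M + 1 < `|y i 0|.
    apply: contra_notP nby => /forallNP h i; rewrite leNgt; apply/negP; exact: h.
  rewrite (sf y i) ?(sf x i)//; last lra.
  have := xy2 i.
  have := ler_normD (y i 0 - x i 0) (x i 0); rewrite subrK distrC; lra.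
Qed.

(** * Iterated integrals of compactly supported functions *)

Definition supp1 {R : realType} (M : R) (g : R -> R) := forall t, M < `|t| -> g t = 0.

Definition Cc1 {R : realType} (g : R -> R) := continuous g /\ exists M, supp1 M g.

Definition I1 {R : realType} (g : R -> R) : R := \int[@lebesgue_measure R]_t g t.

Lemma supp1_patch (R : realType) (M : R) (g : R -> R) : supp1 M g ->
  g \_ `[- M, M] = g.
Proof.
move=> sg; apply/funext => t; rewrite patchE; case: ifPn => // /negP h.
rewrite sg// ltNge; apply/negP; rewrite ler_norml => h'; apply: h.
by rewrite inE /= in_itv.
Qed.

Lemma continuous_itv_integrable (R : realType) (g : R -> R) (a b : R) :
  continuous g -> (@lebesgue_measure R).-integrable `[a, b] (EFin \o g).
Proof.
move=> cg; apply: continuous_compact_integrable; first exact: segment_compact.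
exact: continuous_subspaceT.
Qed.

Lemma Cc1_integrable (R : realType) (g : R -> R) : Cc1 g ->
  (@lebesgue_measure R).-integrable setT (EFin \o g).
Proof.
move=> [cg [M sg]].
suff : (@lebesgue_measure R).-integrable setT (EFin \o g \_ `[- M, M]).
  by rewrite (supp1_patch sg).
rewrite -restrict_EFin; apply: (proj1 (integrable_mkcond _ _)) => //.
exact: continuous_itv_integrable.
Qed.

Lemma I1_EFin (R : realType) (g : R -> R) : Cc1 g ->
  (\int[@lebesgue_measure R]_t (g t)%:E = (I1 g)%:E)%E.
Proof.
move=> /Cc1_integrable ig; rewrite /I1 /Rintegral fineK//.
exact: (@integrable_fin_num _ _ _ (@lebesgue_measure R) _ _ _ ig).
Qed.

Lemma I1_itv (R : realType) (M : R) (g : R -> R) : supp1 M g ->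
  I1 g = \int[@lebesgue_measure R]_(t in `[- M, M]) g t.
Proof. by move=> sg; rewrite /I1 [RHS]Rintegral_mkcond supp1_patch. Qed.

Lemma I1_lin (R : realType) (a b : R) (f g : R -> R) : Cc1 f -> Cc1 g ->
  I1 (fun t => a * f t + b * g t) = a * I1 f + b * I1 g.
Proof.
move=> /Cc1_integrable cf /Cc1_integrable cg.
rewrite /I1 RintegralD//.
- by rewrite !RintegralZl.
- exact: (integrableZl measurableT a cf).
- exact: (integrableZl measurableT b cg).
Qed.

Lemma I1_le (R : realType) (f g : R -> R) : Cc1 f -> Cc1 g ->
  (forall t, f t <= g t) -> I1 f <= I1 g.
Proof.
by move=> /Cc1_integrable cf /Cc1_integrable cg fg; apply: le_Rintegral.
Qed.

Lemma I1_bound (R : realType) (M e : R) (g : R -> R) : 0 <= M -> Cc1 g -> supp1 M g ->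
  (forall t, `|g t| <= e) -> `|I1 g| <= e * (2 * M).
Proof.
move=> M0 [cg _] sg he; rewrite (I1_itv sg).
have key : \int[@lebesgue_measure R]_(t in `[- M, M]) e = e * (2 * M).
  rewrite Rintegral_cst//= lebesgue_measure_itv/=; congr (_ * _).
  case: ltP => /=; first by rewrite opprK mulr_natl mulr2n.
  by rewrite lee_fin; lra.
apply: le_trans (le_normr_Rintegral _ _) _ => //.
  exact: (continuous_itv_integrable).
rewrite -key; apply: le_Rintegral => //.
- apply: (@continuous_itv_integrable R (fun t => `|g t|)).
  by move=> t; apply: cvg_norm; exact: cg.
- by apply: (@continuous_itv_integrable R (fun t => e)); exact: cst_continuous.
Qed.

Lemma I1_FTC (R : realType) (F g : R -> R) (M a b : R) : continuous g -> supp1 M g ->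
  (forall t, is_derive t (1 : R) F (g t)) -> 0 <= M ->
  (forall t, t < - M -> F t = a) -> (forall t, M < t -> F t = b) ->
  I1 g = b - a.
Proof.
move=> cg sg dF M0 Fa Fb.
(* One unit of margin puts both endpoints strictly beyond [M], where the values of [F] are known,
   and keeps the segment nondegenerate when [M = 0]. *)
have sg1 : supp1 (M + 1) g by move=> t ht; apply: sg; lra.
rewrite (I1_itv sg1) /Rintegral.
have h1 : - (M + 1) < M + 1 by lra.
have h2 : - (M + 1) < - M by lra.
have h3 : M < M + 1 by lra.
rewrite (@continuous_FTC2 R g F) /=.
- by rewrite (Fa _ h2) (Fb _ h3).
- exact: h1.
- exact: (continuous_subspaceT cg).
- have cF : continuous F.
    move=> t; apply: differentiable_continuous; apply/derivable1_diffP.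
    exact: (@ex_derive _ _ _ _ _ _ _ (dF t)).
  split.
  + by move=> t _; exact: (@ex_derive _ _ _ _ _ _ _ (dF t)).
  + by apply: cvg_at_right_filter; exact: cF.
  + by apply: cvg_at_left_filter; exact: cF.
- by move=> t _; rewrite derive1E; exact: (@derive_val _ _ _ _ _ _ _ (dF t)).
Qed.

Lemma I1_gt0 (R : realType) (g : R -> R) (t0 : R) : Cc1 g -> (forall t, 0 <= g t) ->
  0 < g t0 -> 0 < I1 g.
Proof.
move=> cg g0 gt0; case: (cg) => cg' [M sg].
have : \forall t \near t0, g t0 / 2 < g t.
  have := @cvgr_gt R _ (nbhs t0) _ (g : R -> R) (g t0); apply; first exact: cg'.
  lra.
move=> /nbhs_ballP[d /= d0 hd].
have tM : `|t0| <= M by rewrite leNgt; apply/negP => /sg h; move: gt0; rewrite h ltxx.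
have key : \int[@lebesgue_measure R]_(t in `[t0 - d / 2, t0 + d / 2]) (g t0 / 2)
    = g t0 / 2 * d.
  rewrite Rintegral_cst//= lebesgue_measure_itv/=; congr (_ * _).
  rewrite lte_fin ifT /=; lra.
apply: (@lt_le_trans _ _ (g t0 / 2 * d)); first by rewrite mulr_gt0// divr_gt0.
rewrite -key Rintegral_mkcond; apply: le_Rintegral => //.
- rewrite -restrict_EFin; apply: (proj1 (integrable_mkcond _ _)) => //.
  apply: (@continuous_itv_integrable R (fun t => g t0 / 2)); exact: cst_continuous.
- exact: Cc1_integrable.
- move=> t _; rewrite patchE; case: ifPn => // ; rewrite inE /= in_itv /= => /andP[h1 h2].
  by apply/ltW/hd; rewrite /ball /=; rewrite ltr_distl; apply/andP; split; lra.
Qed.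

(** * Continuity at a point and local agreement for functions of column vectors *)

Lemma cont_atD (R : realType) n (f g : 'cV[R]_n -> R) x :
  {for x, continuous f} -> {for x, continuous g} -> {for x, continuous (fun y => f y + g y)}.
Proof. move=> cf cg; exact: (@cvgD R R _ (nbhs x) _ f g (f x) (g x) cf cg). Qed.

Lemma cont_atM (R : realType) n (f g : 'cV[R]_n -> R) x :
  {for x, continuous f} -> {for x, continuous g} -> {for x, continuous (fun y => f y * g y)}.
Proof. move=> cf cg; exact: (@cvgM R _ (nbhs x) _ f g (f x) (g x) cf cg). Qed.

Lemma cont_atN (R : realType) n (f : 'cV[R]_n -> R) x :
  {for x, continuous f} -> {for x, continuous (fun y => - f y)}.
Proof. move=> cf; exact: (@cvgN R R _ (nbhs x) _ f (f x) cf). Qed.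

Lemma cont_atB (R : realType) n (f g : 'cV[R]_n -> R) x :
  {for x, continuous f} -> {for x, continuous g} -> {for x, continuous (fun y => f y - g y)}.
Proof. by move=> cf cg; apply: cont_atD => //; apply: cont_atN. Qed.

Lemma cont_at_cst (R : realType) n (a : R) (x : 'cV[R]_n) :
  {for x, continuous (fun _ : 'cV[R]_n => a)}.
Proof. exact: cst_continuous. Qed.

Lemma cont_at_norm (R : realType) n (f : 'cV[R]_n -> R) x :
  {for x, continuous f} -> {for x, continuous (fun y => `|f y|)}.
Proof. move=> cf; exact: (@cvg_norm R R _ (nbhs x) _ f (f x) cf). Qed.

Lemma cont_at_sum (R : realType) n (I : Type) (r : seq I) (P : pred I)
    (f : I -> 'cV[R]_n -> R) x :
  (forall i, P i -> {for x, continuous (f i)}) ->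
  {for x, continuous (fun y => \sum_(i <- r | P i) f i y)}.
Proof.
move=> cf; elim: r => [|i r IH].
  rewrite (_ : (fun y => _) = fun=> 0); first exact: cont_at_cst.
  by apply/funext => y; rewrite big_nil.
have [Pi|nPi] := boolP (P i).
  rewrite (_ : (fun y => _) = fun y => f i y + \sum_(i <- r | P i) f i y).
    by apply: cont_atD => //; exact: cf.
  by apply/funext => y; rewrite big_cons Pi.
rewrite (_ : (fun y => _) = fun y => \sum_(i <- r | P i) f i y)//.
by apply/funext => y; rewrite big_cons (negbTE nPi).
Qed.

Lemma cont_at_prod (R : realType) n (I : Type) (r : seq I) (P : pred I)
    (f : I -> 'cV[R]_n -> R) x :
  (forall i, P i -> {for x, continuous (f i)}) ->
  {for x, continuous (fun y => \prod_(i <- r | P i) f i y)}.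
Proof.
move=> cf; elim: r => [|i r IH].
  rewrite (_ : (fun y => _) = fun=> 1); first exact: cont_at_cst.
  by apply/funext => y; rewrite big_nil.
have [Pi|nPi] := boolP (P i).
  rewrite (_ : (fun y => _) = fun y => f i y * \prod_(i <- r | P i) f i y).
    by apply: cont_atM => //; exact: cf.
  by apply/funext => y; rewrite big_cons Pi.
rewrite (_ : (fun y => _) = fun y => \prod_(i <- r | P i) f i y)//.
by apply/funext => y; rewrite big_cons (negbTE nPi).
Qed.

Lemma cont_at_comp1 (R : realType) n (f : 'cV[R]_n -> R) (g : R -> R) x :
  {for x, continuous f} -> {for f x, continuous g} -> {for x, continuous (fun y => g (f y))}.
Proof. by move=> cf cg; exact: (@continuous_comp _ _ _ f g x cf cg). Qed.

Definition nearv {R : realType} {n} (x : 'cV[R]_n) (P : 'cV[R]_n -> Prop) :=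
  exists2 d : R, 0 < d & forall y, vclose d x y -> P y.

Lemma vclose_le (R : realType) n (d d' : R) (x y : 'cV[R]_n) : d <= d' -> vclose d x y -> vclose d' x y.
Proof. by move=> h h' i; apply: lt_le_trans h. Qed.

Lemma nearv_and (R : realType) n (x : 'cV[R]_n) (P Q : 'cV[R]_n -> Prop) :
  nearv x P -> nearv x Q -> nearv x (fun y => P y /\ Q y).
Proof.
move=> [d d0 hd] [e e0 he]; exists (Num.min d e); first by rewrite lt_min d0.
by move=> y h; split; [apply: hd|apply: he]; apply: vclose_le h; rewrite ge_min lexx ?orbT.
Qed.

Lemma nearv_forall (R : realType) n (x : 'cV[R]_n) (I : finType) (P : I -> 'cV[R]_n -> Prop) :
  (forall i, nearv x (P i)) -> nearv x (fun y => forall i, P i y).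
Proof.
move=> h.
suff : nearv x (fun y => forall i, i \in enum I -> P i y).
  by move=> [d d0 hd]; exists d => // y hy i; apply: hd; rewrite ?mem_enum.
elim: (enum I) => [|i r IH]; first by exists 1.
have [d d0 hd] := nearv_and (h i) IH; exists d => // y /hd [h1 h2] j.
by rewrite inE => /orP[/eqP->//|]; exact: h2.
Qed.

Lemma nearvS (R : realType) n (x : 'cV[R]_n) (P Q : 'cV[R]_n -> Prop) :
  (forall y, P y -> Q y) -> nearv x P -> nearv x Q.
Proof. by move=> h [d d0 hd]; exists d => // y /hd /h. Qed.

Lemma nearv_self (R : realType) n (x : 'cV[R]_n) (P : 'cV[R]_n -> Prop) : nearv x P -> P x.
Proof. by move=> [d d0]; apply => i; rewrite subrr normr0. Qed.

Lemma cont_at_comp (R : realType) n m (f : 'cV[R]_n -> R) (g : 'cV[R]_m -> 'cV[R]_n) x :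
  (forall i, {for x, continuous (fun y => g y i 0)}) -> {for g x, continuous f} ->
  {for x, continuous (fun y => f (g y))}.
Proof.
move=> cg cf; apply/cvg_vclose => e e0.
have /cvg_vclose/(_ e e0) [d d0 hd] := cf.
have [d' d'0 hd'] : nearv x (fun y => forall i, `|g x i 0 - g y i 0| < d).
  by apply: nearv_forall => i; have /cvg_vclose/(_ d d0) := cg i.
by exists d' => // y /hd'; exact: hd.
Qed.

Lemma cont_at_near (R : realType) n (f g : 'cV[R]_n -> R) x :
  nearv x (fun y => f y = g y) -> {for x, continuous f} -> {for x, continuous g}.
Proof.
move=> h /cvg_vclose cf; have hx := nearv_self h.
apply/cvg_vclose => e e0; rewrite -hx.
have [d d0 hd] := nearv_and h (cf e e0).
by exists d => // y /hd [<-].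
Qed.

(** * The iterated integral as a real number, on continuous functions with compact support *)

Fixpoint J {R : realType} (n : nat) : ('cV[R]_n -> R) -> R :=
  match n return ('cV[R]_n -> R) -> R with
  | 0 => fun f => f 0
  | m.+1 => fun f => I1 (fun t => J (fun y : 'cV[R]_m => f (consv t y)))
  end.

Lemma vclose_consv (R : realType) n (d t t' : R) (y y' : 'cV[R]_n) :
  `|t - t'| < d -> vclose d y y' -> vclose d (consv t y) (consv t' y').
Proof.
move=> h h' i; case: (unliftP ord0 i) => [j ->|->].
  by rewrite !consvS.
by rewrite !consv0.
Qed.

Lemma vclose_refl (R : realType) n (d : R) (y : 'cV[R]_n) : 0 < d -> vclose d y y.
Proof. by move=> d0 i; rewrite subrr normr0. Qed.

Lemma supp_slice (R : realType) n (M t : R) (f : 'cV[R]_n.+1 -> R) :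
  supp M f -> supp M (fun y => f (consv t y)).
Proof. by move=> sf x i h; apply: (sf _ (lift ord0 i)); rewrite consvS. Qed.

Lemma supp_slice0 (R : realType) n (M t : R) (f : 'cV[R]_n.+1 -> R) y :
  supp M f -> M < `|t| -> f (consv t y) = 0.
Proof. by move=> sf h; apply: (sf _ ord0); rewrite consv0. Qed.

Lemma continuous_slice (R : realType) n (t : R) (f : 'cV[R]_n.+1 -> R) :
  continuous f -> continuous (fun y => f (consv t y)).
Proof.
move=> cf y; apply/cvg_vclose => e e0.
have [d d0 hd] := proj1 (cvg_vclose f (consv t y)) (cf (consv t y)) e e0.
exists d => // y' hy; apply/hd/vclose_consv => //.
by rewrite subrr normr0.
Qed.

Lemma Cc_slice (R : realType) n (t : R) (f : 'cV[R]_n.+1 -> R) :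
  Cc f -> Cc (fun y => f (consv t y)).
Proof.
move=> [cf [M sf]]; split; first exact: continuous_slice.
by exists M; exact: supp_slice.
Qed.

Lemma continuous_lin (R : realType) n (a b : R) (f g : 'cV[R]_n -> R) :
  continuous f -> continuous g -> continuous (fun x => a * f x + b * g x).
Proof.
move=> cf cg x; apply: cont_atD; apply: cont_atM; try exact: cont_at_cst.
  exact: cf.
exact: cg.
Qed.

Lemma Cc_lin (R : realType) n (a b : R) (f g : 'cV[R]_n -> R) : Cc f -> Cc g ->
  Cc (fun x => a * f x + b * g x).
Proof.
move=> [cf [M sf]] [cg [M' sg]]; split; first exact: continuous_lin.
exists (Num.max M M') => x i; rewrite gt_max => /andP[h1 h2].
by rewrite (sf x i)// (sg x i)// !mulr0 addr0.
Qed.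

Lemma supp_ge0 (R : realType) n (M : R) (f : 'cV[R]_n -> R) :
  supp M f -> exists2 M', 0 <= M' & supp M' f.
Proof.
move=> sf; exists (Num.max M 0); first by rewrite le_max lexx orbT.
by apply: supp_le sf; rewrite le_max lexx.
Qed.

Lemma J_ext (R : realType) n (f g : 'cV[R]_n -> R) : (forall x, f x = g x) -> J f = J g.
Proof. by move=> /funext ->. Qed.

(** The three claims are proved together: each inductive step needs the inner integral to depend
    continuously on the outer variable ([key]), and that continuity uses linearity and the bound one
    dimension lower. *)
Lemma J_basic (R : realType) n :
  [/\ forall (a b : R) (f g : 'cV[R]_n -> R), Cc f -> Cc g ->
        J (fun x => a * f x + b * g x) = a * J f + b * J g,
      forall (M e : R) (f : 'cV[R]_n -> R), 0 <= M -> Cc f -> supp M f ->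
        (forall x, `|f x| <= e) -> `|J f| <= e * (2 * M) ^+ n &
      forall f : 'cV[R]_n -> R, Cc f ->
        integral_cV (fun x => (f x)%:E) = (J f)%:E].
Proof.
elim: n => [|n [IH1 IH2 IH3]].
  split => // M e f M0 cf sf hf.
  by rewrite expr0 mulr1; exact: hf.
have key (f : 'cV[R]_n.+1 -> R) : Cc f -> Cc1 (fun t => J (fun y => f (consv t y))).
  move=> cf; split; last first.
    case: (cf) => _ [M sf]; exists M => t ht.
    rewrite (@J_ext _ _ _ (fun y => 0 * f (consv t y) + 0 * f (consv t y))); last first.
      by move=> y; rewrite !mul0r addr0; apply: (supp_slice0 _ sf).
    by rewrite IH1 ?mul0r ?addr0//; exact: Cc_slice.
  move=> t.
  apply: (proj2 (@cvgrPdist_lt R R _ (nbhs t) _ (fun t => J (fun y => f (consv t y))) _)) => e e0.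
  case: (cf) => _ [M0 /supp_ge0[M M0' sf]].
  (* The added 1 keeps [C] positive when [M = 0] and makes the last inequality strict. *)
  pose C := (2 * M) ^+ n + 1.
  have C0 : 0 < C by rewrite ltr_wpDl// exprn_ge0// mulr_ge0.
  have [d d0 hd] := Cc_unif_cont cf (divr_gt0 e0 C0).
  apply/nbhs_ballP; exists d => //= t' ht'.
  have -> : J (fun y => f (consv t y)) - J (fun y => f (consv t' y)) =
    J (fun y => 1 * f (consv t y) + (-1) * f (consv t' y)).
    by rewrite IH1 ?mul1r ?mulN1r//; exact: Cc_slice.
  apply: (@le_lt_trans _ _ (e / C * (2 * M) ^+ n)).
    apply: IH2 => //.
    - by apply: Cc_lin; exact: Cc_slice.
    - by move=> y i h; rewrite !(supp_slice _ sf h) !mulr0 addr0.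
    - move=> y; rewrite mul1r mulN1r; apply/ltW/hd/vclose_consv => //.
      exact: vclose_refl.
  rewrite mulrAC -mulrA gtr_pMr// ltr_pdivrMr// mul1r /C ltrDl; exact: ltr01.
split.
- move=> a b f g cf cg /=.
  rewrite -I1_lin; [|exact: key|exact: key].
  by congr I1; apply/funext => t; rewrite IH1//; exact: Cc_slice.
- move=> M e f M0 cf sf hf /=.
  rewrite exprSr mulrA; apply: I1_bound => //; first exact: key.
    move=> t ht.
    have := IH2 M 0 (fun y => f (consv t y)) M0 (Cc_slice _ cf) (supp_slice _ sf).
    rewrite mul0r normr_le0 => h; apply/eqP/h => y.
    by rewrite (supp_slice0 _ sf)// normr0.
  by move=> t; apply: IH2 => //; [exact: Cc_slice|exact: supp_slice].
- move=> f cf /=; rewrite -I1_EFin; last exact: key.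
  apply: eq_integral => t _; rewrite -IH3//; exact: Cc_slice.
Qed.

Lemma J_lin (R : realType) n (a b : R) (f g : 'cV[R]_n -> R) : Cc f -> Cc g ->
  J (fun x => a * f x + b * g x) = a * J f + b * J g.
Proof. by have [h _ _] := @J_basic R n; exact: h. Qed.

Lemma J_bound (R : realType) n (M e : R) (f : 'cV[R]_n -> R) :
  0 <= M -> Cc f -> supp M f ->
  (forall x, `|f x| <= e) -> `|J f| <= e * (2 * M) ^+ n.
Proof. by have [_ h _] := @J_basic R n; exact: h. Qed.

Lemma J_EFin (R : realType) n (f : 'cV[R]_n -> R) : Cc f ->
  integral_cV (fun x => (f x)%:E) = (J f)%:E.
Proof. by have [_ _ h] := @J_basic R n; exact: h. Qed.

Lemma Cc0 (R : realType) n : Cc (fun _ : 'cV[R]_n => (0 : R)).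
Proof. by split; [exact: cst_continuous|exists 0]. Qed.

Lemma J0 (R : realType) n : J (fun _ : 'cV[R]_n => 0) = 0.
Proof.
have := @J_lin R n 0 0 _ _ (@Cc0 R n) (@Cc0 R n).
by rewrite (_ : (fun x => _) = fun=> 0) ?mul0r ?addr0//; apply/funext => x; rewrite mul0r addr0.
Qed.

Lemma Cc_ext (R : realType) n (f g : 'cV[R]_n -> R) : (forall x, f x = g x) -> Cc f -> Cc g.
Proof. by move=> /funext ->. Qed.

Lemma CcD (R : realType) n (f g : 'cV[R]_n -> R) : Cc f -> Cc g -> Cc (fun x => f x + g x).
Proof.
move=> cf cg; apply: Cc_ext (Cc_lin 1 1 cf cg) => x; by rewrite !mul1r.
Qed.

Lemma JD (R : realType) n (f g : 'cV[R]_n -> R) : Cc f -> Cc g ->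
  J (fun x => f x + g x) = J f + J g.
Proof.
move=> cf cg; rewrite -[J f]mul1r -[J g]mul1r -J_lin//.
by apply: J_ext => x; rewrite !mul1r.
Qed.

Lemma CcB (R : realType) n (f g : 'cV[R]_n -> R) : Cc f -> Cc g -> Cc (fun x => f x - g x).
Proof.
by move=> cf cg; apply: Cc_ext (Cc_lin 1 (-1) cf cg) => x; rewrite mul1r mulN1r.
Qed.

Lemma JB (R : realType) n (f g : 'cV[R]_n -> R) : Cc f -> Cc g ->
  J (fun x => f x - g x) = J f - J g.
Proof.
move=> cf cg; rewrite -[J f]mul1r -[- J g]mulN1r -J_lin//.
by apply: J_ext => x; rewrite mul1r mulN1r.
Qed.

Lemma CcZ (R : realType) n a (f : 'cV[R]_n -> R) : Cc f -> Cc (fun x => a * f x).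
Proof.
by move=> cf; apply: Cc_ext (Cc_lin a 0 cf cf) => x; rewrite mul0r addr0.
Qed.

Lemma JZ (R : realType) n a (f : 'cV[R]_n -> R) : Cc f -> J (fun x => a * f x) = a * J f.
Proof.
move=> cf; rewrite -[RHS]addr0 -[X in _ + X](mul0r (J f)) -J_lin//.
by apply: J_ext => x; rewrite mul0r addr0.
Qed.

Lemma CcJ_sum (R : realType) n (I : Type) (r : seq I) (P : pred I) (f : I -> 'cV[R]_n -> R) :
  (forall i, P i -> Cc (f i)) -> Cc (fun x => \sum_(i <- r | P i) f i x) /\
  J (fun x => \sum_(i <- r | P i) f i x) = \sum_(i <- r | P i) J (f i).
Proof.
move=> cf; elim: r => [|i r [IH1 IH2]].
  split; first by apply: Cc_ext (@Cc0 R n) => x; rewrite big_nil.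
  by rewrite big_nil -[RHS](@J0 R n); apply: J_ext => x; rewrite big_nil.
have [Pi|nPi] := boolP (P i); last first.
  split; first by apply: Cc_ext IH1 => x; rewrite big_cons (negbTE nPi).
  by rewrite big_cons (negbTE nPi) -IH2; apply: J_ext => x; rewrite big_cons (negbTE nPi).
split; first by apply: Cc_ext (CcD (cf i Pi) IH1) => x; rewrite big_cons Pi.
rewrite big_cons Pi -IH2 -JD//; last exact: cf.
by apply: J_ext => x; rewrite big_cons Pi.
Qed.

Lemma CcM (R : realType) n (f g : 'cV[R]_n -> R) : continuous f -> Cc g ->
  Cc (fun x => f x * g x).
Proof.
move=> cf [cg [M sg]]; split.
  by move=> x; apply: cont_atM; [exact: cf|exact: cg].
by exists M => x i h; rewrite (sg x i)// mulr0.
Qed.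

Lemma J_slice_Cc1 (R : realType) n (f : 'cV[R]_n.+1 -> R) : Cc f ->
  Cc1 (fun t => J (fun y => f (consv t y))).
Proof.
move=> cf; split; last first.
  case: (cf) => _ [M sf]; exists M => t ht.
  rewrite -[RHS](@J0 R n); apply: J_ext => y.
  by apply: (supp_slice0 _ sf).
move=> t.
apply: (proj2 (@cvgrPdist_lt R R _ (nbhs t) _ (fun t => J (fun y => f (consv t y))) _)) => e e0.
case: (cf) => _ [M0 /supp_ge0[M M0' sf]].
pose C := (2 * M) ^+ n + 1.
have C0 : 0 < C by rewrite ltr_wpDl// exprn_ge0// mulr_ge0.
have [d d0 hd] := Cc_unif_cont cf (divr_gt0 e0 C0).
apply/nbhs_ballP; exists d => //= t' ht'.
rewrite -JB; [|exact: Cc_slice|exact: Cc_slice].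
apply: (@le_lt_trans _ _ (e / C * (2 * M) ^+ n)).
  apply: J_bound => //.
  - by apply: CcB; exact: Cc_slice.
  - by move=> y i h; rewrite !(supp_slice _ sf h) subrr.
  - move=> y; apply/ltW/hd/vclose_consv => //.
    exact: vclose_refl.
rewrite mulrAC -mulrA gtr_pMr// ltr_pdivrMr// mul1r /C ltrDl; exact: ltr01.
Qed.

Lemma J_le (R : realType) n (f g : 'cV[R]_n -> R) : Cc f -> Cc g ->
  (forall x, f x <= g x) -> J f <= J g.
Proof.
elim: n f g => [|n IH] f g cf cg h; first exact: h.
apply: I1_le; [exact: J_slice_Cc1|exact: J_slice_Cc1|].
by move=> t; apply: IH => //; exact: Cc_slice.
Qed.

Lemma J_ge0 (R : realType) n (f : 'cV[R]_n -> R) : Cc f -> (forall x, 0 <= f x) -> 0 <= J f.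
Proof. by move=> cf h; rewrite -(@J0 R n); apply: J_le => //; exact: Cc0. Qed.

Lemma Cc_norm (R : realType) n (f : 'cV[R]_n -> R) : Cc f -> Cc (fun x => `|f x|).
Proof.
move=> [cf [M sf]]; split; first by move=> x; apply: cont_at_norm; exact: cf.
by exists M => x i h; rewrite (sf x i)// normr0.
Qed.

Lemma J_norm_le (R : realType) n (f g : 'cV[R]_n -> R) : Cc f -> Cc g ->
  (forall x, `|f x| <= g x) -> `|J f| <= J g.
Proof.
move=> cf cg h; rewrite ler_norml; apply/andP; split.
  rewrite -mulN1r -JZ//; apply: J_le => //; first exact: CcZ.
  by move=> x; rewrite mulN1r; have := h x; rewrite ler_norml => /andP[].
by apply: J_le => // x; apply: le_trans (h x); exact: ler_norm.
Qed.

Lemma J_gt0 (R : realType) n (f : 'cV[R]_n -> R) (x : 'cV[R]_n) : Cc f ->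
  (forall x, 0 <= f x) -> 0 < f x -> 0 < J f.
Proof.
elim: n f x => [|n IH] f x cf f0 fx.
  by rewrite /= (_ : 0 = x)//; apply: cV_ext => -[].
apply: (@I1_gt0 R _ (x ord0 0)); first exact: J_slice_Cc1.
- by move=> t; apply: J_ge0 => //; exact: Cc_slice.
- by apply: (IH _ (row' ord0 x)) => //; [exact: Cc_slice|rewrite -consv_eta].
Qed.

(** * Directional derivatives, the mean value theorem and differentiation under the integral *)

Lemma is_deriveP (R : realType) (V : normedModType R) (f : V -> R) (x v : V) (l : R) :
  is_derive x v f l <-> forall e : R, 0 < e -> exists2 d : R, 0 < d &
    forall t : R, t != 0 -> `|t| < d -> `|t^-1 * (f (t *: v + x) - f x) - l| < e.
Proof.
have key : (h^-1 *: ((f \o shift x) (h *: v) - f x) @[h --> 0^'] --> l) <->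
   forall e : R, 0 < e -> exists2 d : R, 0 < d &
    forall t : R, t != 0 -> `|t| < d -> `|t^-1 * (f (t *: v + x) - f x) - l| < e.
  split.
    move=> /cvgrPdist_lt h e e0; have := h e e0.
    move=> /nbhs_ballP[d /= d0 hd]; exists d => // t t0 td.
    rewrite distrC; apply: (hd t) => //.
    by rewrite /ball /= sub0r normrN.
  move=> h; apply/cvgrPdist_lt => e e0; have [d d0 hd] := h e e0.
  apply/nbhs_ballP; exists d => //= t; rewrite /ball /= sub0r normrN => td t0.
  by rewrite distrC; exact: hd.
split.
  by move=> [df dl]; apply: (iffLR key); rewrite -dl; exact: df.
move=> h'; have h := proj2 key h'; apply: DeriveDef; first by apply/cvg_ex; exists l.
exact: (cvg_lim _ h).
Qed.

(** Meant for [chi], which is piecewise quadratic: a remainder bound of order [t ^+ 2] yields the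
    derivative with no separate treatment of the knots. *)
Lemma is_derive_quadratic (R : realType) (V : normedModType R) (f : V -> R) (x v : V) (l C : R) :
  0 <= C -> (forall t, `|f (t *: v + x) - f x - t * l| <= C * t ^+ 2) -> is_derive x v f l.
Proof.
move=> C0 h; apply/is_deriveP => e e0; exists (e / (C + 1)).
  by rewrite divr_gt0// ltr_wpDl.
move=> t t0 td.
have -> : t^-1 * (f (t *: v + x) - f x) - l = t^-1 * (f (t *: v + x) - f x - t * l).
  by rewrite [RHS]mulrBr mulKf.
rewrite normrM normfV ltr_pdivrMl ?normr_gt0//.
apply: le_lt_trans (h t) _.
rewrite -real_normK ?num_real// expr2 mulrCA ltr_pM2l ?normr_gt0//.
move: td; rewrite ltr_pdivlMr ?ltr_wpDl// mulrDr mulr1 mulrC => td; apply: le_lt_trans td.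
by rewrite lerDl.
Qed.

Lemma is_derive_line (R : realType) (V : normedModType R) (f : V -> R) (x v : V) (s l : R) :
  is_derive (s *: v + x) v f l -> is_derive s (1 : R) (fun r => f (r *: v + x)) l.
Proof.
move=> /is_deriveP h; apply/is_deriveP => e e0; have [d d0 hd] := h e e0.
exists d => // t t0 td; rewrite [t *: 1]mulr1 scalerDl -addrA; exact: hd.
Qed.

Lemma MVT_line (R : realType) (V : normedModType R) (f : V -> R) (x v : V) (g : R -> R) :
  (forall s : R, 0 <= s <= 1 -> is_derive (s *: v + x) v f (g s)) ->
  exists2 s : R, 0 <= s <= 1 & f (v + x) - f x = g s.
Proof.
move=> h; pose phi (r : R) := f (r *: v + x).
have d (s : R) : 0 <= s <= 1 -> is_derive s (1 : R) phi (g s).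
  by move=> hs; apply: is_derive_line; exact: h.
have [c] : exists2 c : R, c \in `[(0 : R), 1] & phi 1 - phi 0 = g c * (1 - 0).
  apply: MVT_segment => //.
    by move=> s; rewrite in_itv /= => /andP[h1 h2]; apply: d; rewrite !ltW.
  apply: derivable_within_continuous => s; rewrite in_itv /= => hs.
  exact: (@ex_derive _ _ _ _ _ _ _ (d s hs)).
rewrite in_itv /= => hc; rewrite /phi scale1r scale0r add0r subr0 mulr1 => hh.
by exists c.
Qed.

(** By the mean value theorem every difference quotient is a value of [dPhi] at a nearby parameter.
    Uniform continuity of [dPhi] then makes the quotients converge uniformly in [y], and [J_bound]
    passes this to the integral. *)
Lemma is_derive_under_J (R : realType) n (Phi : R -> 'cV[R]_n -> R)
    (dPhi : 'cV[R]_n.+1 -> R) (t : R) : Cc dPhi -> (forall t, Cc (Phi t)) ->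
  (forall t y, is_derive t (1 : R) (fun t => Phi t y) (dPhi (consv t y))) ->
  is_derive t (1 : R) (fun t => J (Phi t)) (J (fun y => dPhi (consv t y))).
Proof.
move=> cd cP hd; apply/is_deriveP => e e0.
case: (cd) => _ [M0 /supp_ge0[M M0' sd]].
pose C := (2 * M) ^+ n + 1.
have C0 : 0 < C by rewrite ltr_wpDl// exprn_ge0// mulr_ge0.
have [d d0 uc] := Cc_unif_cont cd (divr_gt0 e0 C0).
exists d => // u u0 ud; rewrite [u *: 1]mulr1.
rewrite -JB// -JZ; last exact: CcB.
rewrite -JB; [|by apply: CcZ; exact: CcB|exact: Cc_slice].
have nu0 : 0 < `|u| by rewrite normr_gt0.
have mvt y : exists2 s : R, 0 <= s <= 1 &
    u^-1 * (Phi (u + t) y - Phi t y) = dPhi (consv (s * u + t) y).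
  have [|s hs h] := @MVT_line R R (fun r => Phi r y) t u
       (fun s => u * dPhi (consv (s * u + t) y)).
    (* An increment [q] of the segment parameter is an increment [q * u] of [t]; hence the rescaled
       tolerances. *)
    move=> s hs; have /is_deriveP h := hd (s * u + t) y; apply/is_deriveP => r r0.
    have [d' d'0 hd'] := h (r / `|u|) (divr_gt0 r0 nu0).
    exists (d' / `|u|); first by rewrite divr_gt0 ?normr_gt0.
    move=> q q0 qd; have := hd' (q * u); rewrite mulf_neq0//.
    rewrite normrM -ltr_pdivlMr ?normr_gt0// => /(_ isT qd).
    rewrite ltr_pdivlMr ?normr_gt0// -normrM; congr (_ < _); congr `| _ |.
    by rewrite [q * u *: 1]mulr1 /GRing.scale /=; field; rewrite q0.
  by exists s => //; rewrite h mulKf.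
apply: (@le_lt_trans _ _ (e / C * (2 * M) ^+ n)).
  apply: J_bound => //.
  - by apply: CcB; [apply: CcZ; exact: CcB|exact: Cc_slice].
  - move=> y i h; have [s _ ->] := mvt y.
    by rewrite !(supp_slice _ sd h) subrr.
  - move=> y; have [s /andP[s0 s1] ->] := mvt y; apply/ltW/uc/vclose_consv; last exact: vclose_refl.
    rewrite addrK normrM ger0_norm//; apply: le_lt_trans ud.
    by rewrite ler_piMl.
rewrite mulrAC -mulrA gtr_pMr// ltr_pdivrMr// mul1r /C ltrDl; exact: ltr01.
Qed.

Lemma basis_lift (R : realType) n (j : 'I_n) :
  basis_vec (lift ord0 j) = consv 0 (basis_vec j) :> 'cV[R]_n.+1.
Proof.
apply: cV_ext => i; case: (unliftP ord0 i) => [k ->|->].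
  by rewrite consvS !mxE (inj_eq lift_inj).
by rewrite consv0 !mxE (negbTE (neq_lift _ _)).
Qed.

Lemma basis_ord0 (R : realType) n : basis_vec ord0 = consv 1 0 :> 'cV[R]_n.+1.
Proof.
apply: cV_ext => i; case: (unliftP ord0 i) => [k ->|->].
  by rewrite consvS !mxE eq_sym (negbTE (neq_lift _ _)).
by rewrite consv0 !mxE.
Qed.

Lemma consv_lin (R : realType) n (a t t' : R) (y y' : 'cV[R]_n) :
  a *: consv t y + consv t' y' = consv (a * t + t') (a *: y + y').
Proof.
apply: cV_ext => i; rewrite [LHS]mxE [X in X + _]mxE; case: (unliftP ord0 i) => [k ->|->].
  by rewrite !consvS !mxE.
by rewrite !consv0.
Qed.

(* Fundamental theorem of calculus in one variable, under the other integrals. *)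
Lemma J_partial (R : realType) n (i : 'I_n) (g dg : 'cV[R]_n -> R) : Cc g -> Cc dg ->
  (forall x, is_derive x (basis_vec i) g (dg x)) -> J dg = 0.
Proof.
elim: n i g dg => [[]//|n IH] i g dg cg cdg h.
(* An inner coordinate is treated slice by slice. For the outermost one the derivative is pulled out
   of the inner integrals, so the order of integration is never exchanged. *)
case: (unliftP ord0 i) => [j ji|i0] /=.
  have key t : J (fun y => dg (consv t y)) = 0.
    apply: (IH j (fun y => g (consv t y))); [exact: Cc_slice|exact: Cc_slice|].
    move=> y; have /is_deriveP hh := h (consv t y); apply/is_deriveP => e e0.
    have [d d0 hd] := hh e e0; exists d => // u u0 ud; have := hd u u0 ud.
    by rewrite ji basis_lift consv_lin mulr0 add0r.
  rewrite (_ : (fun t => _) = fun=> 0); last by apply/funext => t; exact: key.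
  exact: (@J0 R 1).
case: (cg) => _ [M /supp_ge0[M1 M10 sg]].
case: (cdg) => _ [M' /supp_ge0[M1' M10' sdg]].
pose M2 := Num.max M1 M1'.
have sg2 : supp M2 g by apply: supp_le sg; rewrite le_max lexx.
have sdg2 : supp M2 dg by apply: supp_le sdg; rewrite le_max lexx orbT.
have F0 t : M2 < `|t| -> J (fun y => g (consv t y)) = 0.
  move=> ht; rewrite -(@J0 R n); apply: J_ext => y; exact: (supp_slice0 _ sg2).
rewrite -(subrr (0 : R)).
apply: (@I1_FTC R (fun t => J (fun y => g (consv t y))) _ M2 0 0).
- by have [] := J_slice_Cc1 cdg.
- move=> t ht; rewrite -(@J0 R n); apply: J_ext => y; exact: (supp_slice0 _ sdg2).
- move=> t; apply: is_derive_under_J => //; first by move=> t'; exact: Cc_slice.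
  move=> t' y; have /is_deriveP hh := h (consv t' y); apply/is_deriveP => e e0.
  have [d d0 hd] := hh e e0; exists d => // u u0 ud; have := hd u u0 ud.
  by rewrite i0 basis_ord0 consv_lin scaler0 add0r.
- by rewrite le_max M10.
- move=> t ht; apply: F0; rewrite ltr0_norm; first by rewrite ltrNr.
  by apply: lt_le_trans ht _; rewrite oppr_le0 le_max M10.
- by move=> t ht; apply: F0; rewrite gtr0_norm//; apply: le_lt_trans ht; rewrite le_max M10.
Qed.

(** * Cutoffs and thin slabs near a face *)

Definition pos2 {R : realType} (t : R) : R := Num.max t 0 ^+ 2.

Lemma pos2_quad (R : realType) (t u : R) :
  `|pos2 (t + u) - pos2 t - 2 * u * Num.max t 0| <= u ^+ 2.
Proof.
rewrite /pos2 ler_norml; apply/andP.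
case: (leP t 0) => t0; case: (leP (t + u) 0) => tu; split; nra.
Qed.

(* [chi d] rises from 0 to 1 on [d, 3d]; it is the C^1 second difference of
   [pos2], and [rho d] is its derivative. *)
Definition chi {R : realType} (d t : R) : R :=
  (pos2 (t / d - 1) - 2 * pos2 (t / d - 2) + pos2 (t / d - 3)) / 2.

Definition rho {R : realType} (d t : R) : R :=
  (Num.max (t / d - 1) 0 - 2 * Num.max (t / d - 2) 0 + Num.max (t / d - 3) 0) / d.

(** The three knots each contribute the error [(u / d) ^+ 2] of [pos2_quad], with weights 1/2, 1 and
    1/2; their sum is the constant 2. *)
Lemma chi_quad (R : realType) (d t u : R) : 0 < d ->
  `|chi d (t + u) - chi d t - u * rho d t| <= 2 * d^-1 ^+ 2 * u ^+ 2.
Proof.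
move=> d0.
have h c : `|pos2 ((t + u) / d - c) - pos2 (t / d - c) - 2 * (u / d) * Num.max (t / d - c) 0| <= (u / d) ^+ 2.
  have := pos2_quad (t / d - c) (u / d); congr (`| pos2 _ - _ - _ | <= _); ring.
have := h 1; have := h 2; have := h 3; rewrite !ler_norml /chi /rho.
rewrite (_ : 2 * d^-1 ^+ 2 * u ^+ 2 = 2 * (u / d) ^+ 2); last by field; rewrite gt_eqF.
rewrite (_ : u * (_ / d) = (u / d) * (Num.max (t / d - 1) 0 - 2 * Num.max (t / d - 2) 0 + Num.max (t / d - 3) 0)); last by ring.
by move=> /andP[h1 h2] /andP[h3 h4] /andP[h5 h6]; apply/andP; split; lra.
Qed.

Lemma rho_continuous (R : realType) (d : R) : continuous (@rho R d).
Proof.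
have cm c : continuous (fun t : R => Num.max (t / d - c) 0).
  move=> t; apply: (@continuous_max _ _ (fun t : R => t / d - c) (fun=> 0)).
    by apply: cvgB; [apply: cvgM; [exact: cvg_id|exact: cvg_cst]|exact: cvg_cst].
  exact: cvg_cst.
move=> t; apply: cvgM; last exact: cvg_cst.
apply: cvgD; last exact: cm.
apply: cvgB; first exact: cm.
by apply: cvgM; [exact: cvg_cst|exact: cm].
Qed.

Lemma rho_ge0 (R : realType) (d t : R) : 0 < d -> 0 <= rho d t.
Proof.
move=> d0; rewrite divr_ge0//; last exact: ltW.
by case: (leP (t / d - 1) 0); case: (leP (t / d - 2) 0); case: (leP (t / d - 3) 0); lra.
Qed.

Lemma rho_le (R : realType) (d t : R) : 0 < d -> t <= d -> rho d t = 0.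
Proof.
move=> d0; rewrite -[X in _ <= X]mul1r -ler_pdivrMr// => h.
by rewrite /rho !max_r; [rewrite mulr0 subr0 addr0 mul0r|lra|lra|lra].
Qed.

Lemma rho_ge (R : realType) (d t : R) : 0 < d -> 3 * d <= t -> rho d t = 0.
Proof.
move=> d0; rewrite -ler_pdivlMr// => h.
rewrite /rho !max_l; [|lra|lra|lra].
by rewrite (_ : _ + _ = 0) ?mul0r//; ring.
Qed.

Lemma chi_le (R : realType) (d t : R) : 0 < d -> t <= d -> chi d t = 0.
Proof.
move=> d0; rewrite -[X in _ <= X]mul1r -ler_pdivrMr// => h.
by rewrite /chi /pos2 !max_r; [rewrite expr0n mulr0 subr0 addr0 mul0r|lra|lra|lra].
Qed.

Lemma chi_ge (R : realType) (d t : R) : 0 < d -> 3 * d <= t -> chi d t = 1.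
Proof.
move=> d0; rewrite -ler_pdivlMr// => h.
rewrite /chi /pos2 !max_l; [|lra|lra|lra].
by rewrite (_ : _ + _ = 2) ?divff//; ring.
Qed.

Lemma chi_itv (R : realType) (d t : R) : 0 <= chi d t <= 1.
Proof.
rewrite /chi /pos2; set s := t / d.
by case: (leP (s - 1) 0); case: (leP (s - 2) 0); case: (leP (s - 3) 0) => *; apply/andP; split; nra.
Qed.

Lemma chi_continuous (R : realType) (d : R) : 0 < d -> continuous (@chi R d).
Proof.
move=> d0 t; apply: differentiable_continuous; apply/derivable1_diffP.
have : is_derive t (1 : R) (@chi R d) (rho d t).
  apply: (@is_derive_quadratic R R _ _ _ _ (2 * d^-1 ^+ 2)).
    by rewrite mulr_ge0// exprn_ge0// invr_ge0 ltW.
  by move=> u; rewrite [u *: 1]mulr1 addrC [u + t]addrC addrC; exact: chi_quad.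
by move=> [].
Qed.

Definition clampm {R : realType} (M t : R) : R := Num.max 0 (Num.min 1 (M + 1 - `|t|)).

(** Equal to 1 on [box M] and to 0 off [box (M + 1)]. Piecewise linear factors suffice because
    [bump] is never differentiated; it only gives other functions compact support. *)
Definition bump {R : realType} {n} (M : R) (x : 'cV[R]_n) : R :=
  \prod_(i < n) clampm M (x i 0).

Lemma clampm_continuous (R : realType) (M : R) : continuous (@clampm R M).
Proof.
move=> t; apply: (@continuous_max R R (fun=> 0) (fun t => Num.min 1 (M + 1 - `|t|)) t).
  exact: cvg_cst.
apply: (@continuous_min R R (fun=> 1) (fun t => (M + 1 - `|t|)) t); first exact: cvg_cst.
apply: cvgB; first exact: cvg_cst.
exact: (@norm_continuous R R t).
Qed.

Lemma bump_Cc (R : realType) n (M : R) : Cc (@bump R n M).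
Proof.
split.
  move=> x; apply: cont_at_prod => i _; apply: cont_at_comp1; last exact: clampm_continuous.
  exact: vdist_continuous.
exists (M + 1) => x i h; rewrite /bump (bigD1 i)//= [clampm _ _](_ : _ = 0) ?mul0r//.
rewrite /clampm max_l// ge_min; apply/orP; right; lra.
Qed.

Lemma bump1 (R : realType) n (M : R) (x : 'cV[R]_n) : box M x -> bump M x = 1.
Proof.
move=> h; rewrite /bump big1// => i _; rewrite /clampm.
have := h i => hi; rewrite min_l; last lra.
by rewrite max_r.
Qed.

Lemma bump_itv (R : realType) n (M : R) (x : 'cV[R]_n) : 0 <= bump M x <= 1.
Proof.
have h t : 0 <= clampm M t <= 1.
  by rewrite /clampm le_max lexx /= ge_max ler01 /= ge_min lexx.
apply/andP; split; first by apply: prodr_ge0 => i _; have /andP[] := h (x i 0).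
by apply: prodr_ile1 => i _; exact: h.
Qed.

(** Barycentric coordinates with respect to [vertex]: the simplex is where all of them are
    nonnegative, and face [j] is its part with [lam j = 0]. *)
Definition lam {R : realType} {n} (j : option 'I_n) (x : 'cV[R]_n) : R :=
  if j is Some k then x k 0 else 1 - \sum_i x i 0.

(* The coordinate dropped by [face_chart j]. *)
Definition chart_axis {n} (j : option 'I_n.+1) : 'I_n.+1 := odflt ord0 j.

Lemma lam_continuous (R : realType) n (j : option 'I_n) : continuous (@lam R n j).
Proof.
case: j => [k|] x; first exact: vdist_continuous.
apply: cont_atB; first exact: cont_at_cst.
by apply: cont_at_sum => i _; exact: vdist_continuous.
Qed.

Lemma lam_consv (R : realType) n (t : R) (y : 'cV[R]_n) :
  lam None (consv t y) = 1 - t - \sum_i y i 0.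
Proof.
rewrite /lam big_ord_recl consv0 opprD addrA; congr (_ - _).
by apply: eq_bigr => i _; rewrite consvS.
Qed.

Lemma insert_coord_id (R : realType) n (k : 'I_n.+1) (t : R) (y : 'cV[R]_n) :
  insert_coord k t y k 0 = t.
Proof. by rewrite mxE unlift_none. Qed.

Lemma insert_coord_lift (R : realType) n (k : 'I_n.+1) (t : R) (y : 'cV[R]_n) i :
  insert_coord k t y (lift k i) 0 = y i 0.
Proof. by rewrite mxE liftK. Qed.

Lemma face_chart_lift (R : realType) n (j : option 'I_n.+1) (y : 'cV[R]_n) i :
  face_chart j y (lift (chart_axis j) i) 0 = y i 0.
Proof. by case: j => [k|]; rewrite /= insert_coord_lift. Qed.

Lemma lam_face_chart (R : realType) n (j : option 'I_n.+1) (y : 'cV[R]_n) :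
  lam j (face_chart j y) = 0.
Proof.
case: j => [k|] /=; first by rewrite insert_coord_id.
rewrite big_ord_recl insert_coord_id.
have -> : \sum_(i < n) insert_coord ord0 (1 - \sum_(i0 < n) y i0 0) y (lift ord0 i) 0
    = \sum_(i < n) y i 0 by apply: eq_bigr => i _; rewrite insert_coord_lift.
by rewrite subrK subrr.
Qed.

(** Moving along the chart axis alone changes [lam j] at rate 1 or -1, so the hyperplane is reached
    after a displacement of exactly [|lam j x|] in that one coordinate. *)
Lemma face_chart_proj (R : realType) n (j : option 'I_n.+1) (x : 'cV[R]_n.+1) i :
  `|x i 0 - face_chart j (row' (chart_axis j) x) i 0| <= `|lam j x|.
Proof.
case: (unliftP (chart_axis j) i) => [k ->|->].
  by rewrite face_chart_lift mxE subrr normr0.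
case: j => [k|] /=; rewrite insert_coord_id ?subr0// -normrN opprB.
rewrite big_ord_recl opprD addrA.
rewrite (eq_bigr (fun i : 'I_n => x (lift ord0 i) 0)); last by move=> k _; rewrite mxE.
by rewrite addrAC.
Qed.

Lemma face_chart_continuous (R : realType) n (j : option 'I_n.+1) (f : 'cV[R]_n.+1 -> R) :
  continuous f -> continuous (fun y : 'cV[R]_n => f (face_chart j y)).
Proof.
move=> cf y; apply: (@cont_at_comp _ _ _ f (face_chart j)); last exact: cf.
move=> i; case: (unliftP (chart_axis j) i) => [k ->|->].
  have -> : (fun z : 'cV[R]_n => face_chart j z (lift (chart_axis j) k) 0) = (fun z => z k 0).
    by apply/funext => z; rewrite face_chart_lift.
  exact: vdist_continuous.
case: j => [k|].
  have -> : (fun z : 'cV[R]_n => face_chart (Some k) z (chart_axis (Some k)) 0) = (fun z => 0).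
    by apply/funext => z; rewrite insert_coord_id.
  exact: cont_at_cst.
have -> : (fun z : 'cV[R]_n => face_chart None z (chart_axis None) 0) = (fun z => 1 - \sum_i z i 0).
  by apply/funext => z; rewrite insert_coord_id.
apply: cont_atB; first exact: cont_at_cst.
by apply: cont_at_sum => k _; exact: vdist_continuous.
Qed.

Lemma Cc_face_chart (R : realType) n (j : option 'I_n.+1) (f : 'cV[R]_n.+1 -> R) :
  Cc f -> Cc (fun y : 'cV[R]_n => f (face_chart j y)).
Proof.
move=> [cf [M sf]]; split; first exact: face_chart_continuous.
by exists M => y i h; apply: (sf _ (lift (chart_axis j) i)); rewrite face_chart_lift.
Qed.

Lemma row'_continuous (R : realType) n (k : 'I_n.+1) (G : 'cV[R]_n -> R) :
  continuous G -> continuous (fun x : 'cV[R]_n.+1 => G (row' k x)).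
Proof.
move=> cG x; apply: (@cont_at_comp _ _ _ G (row' k)); last exact: cG.
move=> i; have -> : (fun z : 'cV[R]_n.+1 => row' k z i 0) = (fun z => z (lift k i) 0).
  by apply/funext => z; rewrite mxE.
exact: vdist_continuous.
Qed.

Lemma I1Z (R : realType) (a : R) (f : R -> R) : Cc1 f -> I1 (fun t => f t * a) = I1 f * a.
Proof.
move=> cf; rewrite mulrC -[RHS]addr0 -[X in _ + X](mul0r (I1 f)) -I1_lin//.
by congr I1; apply/funext => t; rewrite mul0r addr0 mulrC.
Qed.

(** A fragment of Fubini that follows from the recursion in [J]: the factor depending on coordinate
    [k] passes through the outer integrals until coordinate [k] is the outermost one. *)
Lemma J_prod (R : realType) n (k : 'I_n.+1) (r : R -> R) (G : 'cV[R]_n -> R) :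
  Cc1 r -> Cc G -> J (fun x : 'cV[R]_n.+1 => r (x k 0) * G (row' k x)) = I1 r * J G.
Proof.
elim: n k G => [|n IH] k G cr cG.
  rewrite /= -I1Z//; congr I1; apply/funext => t; congr (_ * _).
    by rewrite (ord1 k) consv0.
  by congr G; apply: cV_ext => -[].
case: (unliftP ord0 k) => [j ->|->].
  rewrite [LHS]/= (_ : (fun t => _) = fun t => I1 r * J (fun y => G (consv t y))).
    rewrite [in RHS]/= mulrC -I1Z; last exact: J_slice_Cc1.
    by congr I1; apply/funext => t; rewrite mulrC.
  apply/funext => t; rewrite -(IH j)//; last exact: Cc_slice.
  transitivity (J (fun y : 'cV[R]_n.+1 => r (consv t y (lift ord0 j) 0) * G (row' (lift ord0 j) (consv t y)))) => //.
  apply: J_ext => y; rewrite consvS; congr (_ * G _).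
  apply: cV_ext => i; rewrite mxE; case: (unliftP ord0 i) => [l ->|->].
    rewrite consvS [RHS]mxE (_ : lift (lift ord0 j) _ = lift ord0 (lift j l)) ?consvS//.
    by apply: val_inj; rewrite /= bumpS.
  by rewrite consv0 (_ : lift (lift ord0 j) ord0 = ord0) ?consv0//; exact: val_inj.
rewrite [LHS]/= (_ : (fun t => _) = fun t => r t * J G); first by rewrite I1Z.
apply/funext => t; rewrite -JZ//.
transitivity (J (fun y : 'cV[R]_n.+1 => r (consv t y ord0 0) * G (row' ord0 (consv t y)))) => //.
apply: J_ext => y; rewrite consv0; congr (_ * G _).
by apply: cV_ext => i; rewrite mxE consvS.
Qed.

Lemma rho_Cc1 (R : realType) (d : R) : 0 < d -> Cc1 (@rho R d).
Proof.
move=> d0; split; first exact: rho_continuous.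
exists (3 * d) => t; rewrite ltr_normr => /orP[h|h].
  by apply: rho_ge => //; exact: ltW.
by apply: rho_le => //; lra.
Qed.

Lemma chi_derive (R : realType) (d t : R) : 0 < d -> is_derive t (1 : R) (@chi R d) (rho d t).
Proof.
move=> d0; apply: (@is_derive_quadratic R R _ _ _ _ (2 * d^-1 ^+ 2)).
  by rewrite mulr_ge0// exprn_ge0// invr_ge0 ltW.
by move=> u; rewrite [u *: 1]mulr1 [u + t]addrC; exact: chi_quad.
Qed.

Lemma I1_rho (R : realType) (d : R) : 0 < d -> I1 (@rho R d) = 1.
Proof.
move=> d0; rewrite -[RHS]subr0.
apply: (@I1_FTC R (@chi R d) _ (3 * d)).
- exact: rho_continuous.
- move=> t; rewrite ltr_normr => /orP[h|h].
    by apply: rho_ge => //; exact: ltW.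
  by apply: rho_le => //; lra.
- by move=> t; exact: chi_derive.
- by lra.
- by move=> t h; apply: chi_le => //; lra.
- by move=> t h; apply: chi_ge => //; lra.
Qed.

Lemma sum_box (R : realType) n (M : R) (x : 'cV[R]_n) : box M x ->
  `|\sum_i x i 0| <= M *+ n.
Proof.
move=> h; apply: le_trans (ler_norm_sum _ _ _) _.
rewrite -[n in _ *+ n]card_ord -sumr_const; apply: ler_sum => i _; exact: h.
Qed.

Lemma rho_lam_continuous (R : realType) n (j : option 'I_n) (d : R) :
  continuous (fun x : 'cV[R]_n => rho d (lam j x)).
Proof.
move=> x; apply: (@cont_at_comp1 _ _ (lam j) (rho d)); first exact: lam_continuous.
exact: rho_continuous.
Qed.

Lemma chi_lam_continuous (R : realType) n (j : option 'I_n) (d : R) : 0 < d ->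
  continuous (fun x : 'cV[R]_n => chi d (lam j x)).
Proof.
move=> d0 x; apply: (@cont_at_comp1 _ _ (lam j) (chi d)); first exact: lam_continuous.
exact: chi_continuous.
Qed.

Lemma rho_lam_Cc (R : realType) n (j : option 'I_n.+1) (d : R) (G : 'cV[R]_n -> R) :
  0 < d -> Cc G -> Cc (fun x : 'cV[R]_n.+1 => rho d (lam j x) * G (row' (chart_axis j) x)).
Proof.
move=> d0 [cG [M1 /supp_ge0[M M0 sG]]]; split.
  move=> x; apply: cont_atM; last exact: row'_continuous.
  exact: rho_lam_continuous.
(* [G] bounds the retained coordinates by [M]. The dropped one is [lam j x], below [3 * d], on a
   coordinate slab; on the slanted slab it is [1 - lam None x] minus a sum of size at most
   [M *+ n]. *)
exists (1 + 3 * d + M *+ n + M) => x i h.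
have [gx|gx] := eqVneq (G (row' (chart_axis j) x)) 0; first by rewrite gx mulr0.
have bx : box M (row' (chart_axis j) x) by apply: (supp_box sG); apply/eqP.
have [ld|ld] := leP (lam j x) d; first by rewrite rho_le ?mul0r.
have [ld3|ld3] := leP (3 * d) (lam j x); first by rewrite rho_ge ?mul0r.
have Mn : 0 <= M *+ n by rewrite mulrn_wge0.
exfalso; move: h; apply/negP; rewrite -leNgt.
case: (unliftP (chart_axis j) i) => [l ->|->].
  have := bx l; rewrite mxE => hl; lra.
case: j ld ld3 bx {gx} => [k|] /= ld ld3 bx.
  by rewrite gtr0_norm; lra.
move: ld ld3; rewrite big_ord_recl.
have := sum_box bx; rewrite (eq_bigr (fun i : 'I_n => x (lift ord0 i) 0)); last by move=> k _; rewrite mxE.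
by rewrite ler_norml => /andP[h1 h2] h3 h4; rewrite ler_norml; apply/andP; split; lra.
Qed.

(** Along the chart axis [rho] has mass 1. On the slanted face this axis is integrated last, whereas
    the mass is counted for fixed [y]; so [- chi * G], a primitive in [t], is integrated over [y]
    first. Its integral goes from [- J G] at large negative [t] to 0 at large positive [t]. *)
Lemma J_rho_lam (R : realType) n (j : option 'I_n.+1) (d : R) (G : 'cV[R]_n -> R) :
  0 < d -> Cc G ->
  J (fun x : 'cV[R]_n.+1 => rho d (lam j x) * G (row' (chart_axis j) x)) = J G.
Proof.
move=> d0 cG; case: j => [k|].
  by rewrite J_prod ?I1_rho ?mul1r//; exact: rho_Cc1.
have cdP := @rho_lam_Cc R n None d G d0 cG.
case: (cG) => _ [M1 /supp_ge0[M M0 sG]].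
pose Phi (t : R) (y : 'cV[R]_n) := - (chi d (1 - t - \sum_i y i 0) * G y).
have rowE (t : R) (y : 'cV[R]_n) : row' (chart_axis None) (consv t y) = y.
  by apply: cV_ext => i; rewrite mxE consvS.
have cPhi t : Cc (Phi t).
  apply: (@Cc_ext _ _ (fun y => - chi d (1 - t - \sum_i y i 0) * G y)).
    by move=> y; rewrite mulNr.
  apply: CcM => // y; apply: cont_atN; apply: cont_at_comp1; last exact: chi_continuous.
  apply: cont_atB; first exact: cont_at_cst.
  by apply: cont_at_sum => i _; exact: vdist_continuous.
have Mn : 0 <= M *+ n by rewrite mulrn_wge0.
rewrite -[RHS]opprK -sub0r.
pose F (t : R) := J (Phi t).
have dF t : is_derive t (1 : R) F (J (fun y => rho d (lam None (consv t y)) * G (row' (chart_axis None) (consv t y)))).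
  apply: (is_derive_under_J t cdP cPhi) => {}t y; rewrite rowE lam_consv.
  apply: (@is_derive_quadratic R R _ _ _ _ (2 * d^-1 ^+ 2 * `|G y|)).
    by rewrite mulr_ge0// mulr_ge0// exprn_ge0// invr_ge0 ltW.
  move=> u; rewrite [u *: 1]mulr1 /Phi.
  have := chi_quad (1 - t - \sum_i y i 0) (- u) d0.
  rewrite (_ : 1 - t - _ + - u = 1 - (u + t) - \sum_i y i 0); last by ring.
  rewrite sqrrN => h.
  rewrite (_ : _ - _ - _ = - ((chi d (1 - (u + t) - \sum_i y i 0) - chi d (1 - t - \sum_i y i 0) -
        - u * rho d (1 - t - \sum_i y i 0)) * G y)); last by ring.
  by rewrite normrN normrM [leRHS]mulrAC; apply: ler_wpM2r.
apply: (@I1_FTC R F _ (1 + 3 * d + M *+ n)).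
- by have [] := J_slice_Cc1 cdP.
- move=> t ht; rewrite -(@J0 R n); apply: J_ext => y; rewrite rowE lam_consv.
  have [gy|gy] := eqVneq (G y) 0; first by rewrite gy mulr0.
  have by' : box M y by apply: (supp_box sG); apply/eqP.
  have := sum_box by'; rewrite ler_norml => /andP[h1 h2].
  move: ht; rewrite ltr_normr => /orP[ht|ht].
    by rewrite rho_le ?mul0r//; lra.
  by rewrite rho_ge ?mul0r//; lra.
- by apply: addr_ge0 => //; lra.
- move=> t ht; rewrite -mulN1r -JZ//; apply: J_ext => y; rewrite /Phi.
  have [gy|gy] := eqVneq (G y) 0; first by rewrite gy !mulr0 oppr0.
  have by' : box M y by apply: (supp_box sG); apply/eqP.
  have := sum_box by'; rewrite ler_norml => /andP[h1 h2].
  by rewrite chi_ge ?mul1r ?mulN1r//; lra.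
- move=> t ht; rewrite -(@J0 R n); apply: J_ext => y; rewrite /Phi.
  have [gy|gy] := eqVneq (G y) 0; first by rewrite gy !mulr0 oppr0.
  have by' : box M y by apply: (supp_box sG); apply/eqP.
  have := sum_box by'; rewrite ler_norml => /andP[h1 h2].
  by rewrite chi_le ?mul0r ?oppr0//; lra.
Qed.

Lemma row'_face_chart (R : realType) n (j : option 'I_n.+1) (y : 'cV[R]_n) :
  row' (chart_axis j) (face_chart j y) = y.
Proof. by apply: cV_ext => i; rewrite mxE face_chart_lift. Qed.

(** [rho d] lives on the slab [d < lam j < 3 * d] and has unit mass along the chart axis, so it
    tends to integration over the face in chart coordinates. No surface density appears, because
    [lam j] varies at unit rate along that axis. *)
Lemma J_slab (R : realType) n (j : option 'I_n.+1) (H : 'cV[R]_n.+1 -> R) (e : R) :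
  Cc H -> 0 < e -> exists2 d0 : R, 0 < d0 & forall d : R, 0 < d -> d < d0 ->
    `|J (fun x => rho d (lam j x) * H x) - J (fun y : 'cV[R]_n => H (face_chart j y))| <= e.
Proof.
move=> cH e0; case: (cH) => _ [M1 /supp_ge0[M M0 sH]].
pose G : 'cV[R]_n -> R := bump (M + 1).
have cG : Cc G by exact: bump_Cc.
have JG : 0 <= J G by apply: J_ge0 => // y; have /andP[] := bump_itv (M + 1) y.
have eG : 0 < e / (J G + 1) by rewrite divr_gt0// ltr_wpDl.
have [d1 d10 uc] := Cc_unif_cont cH eG.
exists (d1 / 3); first by rewrite divr_gt0.
move=> d d0 dd.
have cHc := @Cc_face_chart R n j H cH.
rewrite -(@J_rho_lam R n j d)// -JB.
- apply: le_trans (_ : e / (J G + 1) * J G <= _); last first.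
    by rewrite mulrAC -mulrA ler_piMr ?(ltW e0)// ler_pdivrMr ?ltr_wpDl// mul1r lerDl.
  rewrite -{2}(@J_rho_lam R n j d)// -JZ; last exact: rho_lam_Cc.
  apply: J_norm_le; last 2 first.
  + by apply: CcZ; exact: rho_lam_Cc.
  + move=> x; rewrite -mulrBr normrM (ger0_norm (rho_ge0 _ d0)) mulrCA.
    have [ld|ld] := leP (lam j x) d; first by rewrite rho_le ?mul0r.
    have [ld3|ld3] := leP (3 * d) (lam j x); first by rewrite rho_ge ?mul0r.
    apply: ler_wpM2l; first exact: rho_ge0.
    have [bx|bx] := pselect (box (M + 1) (row' (chart_axis j) x)).
      rewrite /G bump1// mulr1; apply/ltW/uc => i; apply: le_lt_trans (face_chart_proj _ _ _) _.
      rewrite gtr0_norm; first by apply: lt_trans ld3 _; lra.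
      by apply: lt_trans ld.
    have [i hi] : exists i, M + 1 < `|row' (chart_axis j) x i 0|.
      apply: contra_notP bx => /forallNP h i; rewrite leNgt; apply/negP; exact: h.
    rewrite (sH x (lift (chart_axis j) i)); last by move: hi; rewrite mxE => hi; lra.
    rewrite (sH _ (lift (chart_axis j) i)); last by rewrite face_chart_lift; lra.
    rewrite subrr normr0 mulr_ge0 ?(ltW eG)//.
    by have /andP[] := bump_itv (M + 1) (row' (chart_axis j) x).
  + exact: (CcB (CcM (@rho_lam_continuous R n.+1 j d) cH) (@rho_lam_Cc R n j d _ d0 cHc)).
- exact: (CcM (@rho_lam_continuous R n.+1 j d) cH).
- exact: (@rho_lam_Cc R n j d _ d0 cHc).
Qed.

#[global] Arguments J {R} {n} _ : simpl never.
#[global] Arguments rho : simpl never.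
#[global] Arguments chi : simpl never.

(** The constant gradient of the affine function [lam j]. *)
Definition glam {R : realType} {n} (j : option 'I_n) (i : 'I_n) : R :=
  if j is Some k then (i == k)%:R else -1.

(** The open simplex; [interior_simplex] identifies it with the topological interior. *)
Definition inT {R : realType} {n} (x : 'cV[R]_n) := forall j, 0 < lam j x.

Lemma lam_lin (R : realType) n (j : option 'I_n) (t : R) (v x : 'cV[R]_n) :
  lam j (t *: v + x) = lam j x + t * \sum_i glam j i * v i 0.
Proof.
case: j => [k|] /=.
  rewrite !mxE (bigD1 k)//= eqxx mul1r big1 ?addr0 1?addrC// => i ik.
  by rewrite (negbTE ik) mul0r.
rewrite (eq_bigr (fun i => t * v i 0 + x i 0)); last by move=> i _; rewrite !mxE.
rewrite [X in _ = _ + t * X](_ : _ = - \sum_i v i 0).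
  by rewrite big_split/= -mulr_sumr; ring.
by rewrite -sumrN; apply: eq_bigr => i _; rewrite mulN1r.
Qed.

Lemma glam_basis (R : realType) n (j : option 'I_n) (i : 'I_n) :
  \sum_k glam j k * (basis_vec i : 'cV[R]_n) k 0 = glam j i.
Proof.
rewrite (bigD1 i)//= mxE !eqxx mulr1 big1 ?addr0// => k ki.
by rewrite mxE (negbTE ki) mulr0.
Qed.

Lemma inT_box (R : realType) n (x : 'cV[R]_n) : inT x -> box 1 x.
Proof.
move=> h i; have := h (Some i); have := h None; rewrite /= => h1 h2.
rewrite gtr0_norm//; apply: le_trans (ltW (_ : \sum_i x i 0 < 1)); last by lra.
rewrite (bigD1 i)//= lerDl; apply: sumr_ge0 => k _; exact/ltW/(h (Some k)).
Qed.

(** * Derivatives of products and the cutoffs of the simplex *)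

Lemma is_derive_mul (R : realType) (V : normedModType R) (f g : V -> R) (x v : V) (a b : R) :
  is_derive x v f a -> is_derive x v g b ->
  is_derive x v (fun y => f y * g y) (a * g x + f x * b).
Proof.
move=> h1 h2; have := is_deriveM h1 h2.
rewrite (_ : _ + _ = a * g x + f x * b); first by [].
by rewrite addrC /GRing.scale /= [g x * a]mulrC.
Qed.

Lemma is_derive_prod_seq (R : realType) (V : normedModType R) (I : eqType) (r : seq I)
    (f : I -> V -> R) (df : I -> R) (x v : V) : uniq r ->
  (forall i, is_derive x v (f i) (df i)) ->
  is_derive x v (fun y => \prod_(i <- r) f i y)
    (\sum_(i <- r) df i * \prod_(k <- r | k != i) f k x).
Proof.
move=> + h; elim: r => [_|i r IH /= /andP[ir ur]].
  rewrite big_nil (_ : (fun y => _) = cst 1); first exact: is_derive_cst.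
  by apply/funext => y; rewrite big_nil.
have := is_derive_mul (h i) (IH ur).
rewrite (_ : (fun y => _) = (fun y => \prod_(j <- i :: r) f j y)); last first.
  by apply/funext => y; rewrite big_cons.
rewrite (_ : _ + _ = \sum_(i0 <- i :: r) df i0 * \prod_(k <- i :: r | k != i0) f k x)//.
rewrite !big_cons eqxx /=; congr (_ * _ + _).
  rewrite [RHS]big_seq_cond [LHS]big_seq; apply: eq_bigl => k.
  by case kr : (k \in r) => //=; apply/esym/eqP => ki; rewrite -ki kr in ir.
rewrite mulr_sumr [LHS]big_seq [RHS]big_seq; apply: eq_bigr => k kr.
have ik : i != k by apply/eqP => ik; move: ir; rewrite ik kr.
by rewrite big_cons ik; exact: mulrCA.
Qed.

Lemma is_derive_prod (R : realType) (V : normedModType R) (I : finType)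
    (f : I -> V -> R) (df : I -> R) (x v : V) :
  (forall i, is_derive x v (f i) (df i)) ->
  is_derive x v (fun y => \prod_i f i y) (\sum_i df i * \prod_(k | k != i) f k x).
Proof. by apply: is_derive_prod_seq; exact: index_enum_uniq. Qed.

Lemma is_derive_near (R : realType) n (f g : 'cV[R]_n -> R) (x v : 'cV[R]_n) (l : R) :
  nearv x (fun y => f y = g y) -> is_derive x v f l -> is_derive x v g l.
Proof.
move=> h /is_deriveP df; apply/is_deriveP => e e0.
have [d d0 hd] := df e e0; have [d' d'0 hd'] := h.
pose M := 1 + \sum_i `|v i 0|.
have M0 : 0 < M by rewrite ltr_pwDl// sumr_ge0.
exists (Num.min d (d' / M)); first by rewrite lt_min d0 divr_gt0.
move=> t t0; rewrite lt_min => /andP[td td'].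
rewrite -(hd' x); last exact: vclose_refl.
rewrite -(hd' (t *: v + x)); first exact: hd.
  move=> i; rewrite !mxE opprD addrCA subrr addr0 normrN normrM.
  apply: le_lt_trans (_ : `|t| * M < _); last by rewrite -ltr_pdivlMr.
  apply: ler_wpM2l => //; rewrite /M (bigD1 i)//= addrCA lerDl.
  by rewrite addr_ge0// sumr_ge0.
Qed.

Lemma is_derive_chi_lam (R : realType) n (j : option 'I_n) (d : R) (x v : 'cV[R]_n) : 0 < d ->
  is_derive x v (fun y => chi d (lam j y)) (rho d (lam j x) * \sum_i glam j i * v i 0).
Proof.
move=> d0; set a := \sum_i _.
apply: (@is_derive_quadratic R _ _ _ _ _ (2 * d^-1 ^+ 2 * a ^+ 2)).
  by apply: mulr_ge0; [apply: mulr_ge0; [|exact: sqr_ge0]|exact: sqr_ge0].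
move=> t; rewrite lam_lin -/a; have := chi_quad (lam j x) (t * a) d0.
rewrite (_ : t * a * _ = t * (rho d (lam j x) * a)); last by ring.
by rewrite (_ : 2 * d^-1 ^+ 2 * (t * a) ^+ 2 = 2 * d^-1 ^+ 2 * a ^+ 2 * t ^+ 2)//; ring.
Qed.

Definition small {R : realType} (P : R -> Prop) :=
  exists2 d0 : R, 0 < d0 & forall d, 0 < d -> d < d0 -> P d.

Lemma small_and (R : realType) (P Q : R -> Prop) : small P -> small Q ->
  small (fun d => P d /\ Q d).
Proof.
move=> [d d0 hd] [e e0 he]; exists (Num.min d e); first by rewrite lt_min d0.
by move=> y h; rewrite lt_min => /andP[h1 h2]; split; [apply: hd|apply: he].
Qed.

Lemma small_forall (R : realType) (I : finType) (P : I -> R -> Prop) :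
  (forall i, small (P i)) -> small (fun d => forall i, P i d).
Proof.
move=> h.
suff : small (fun d => forall i, i \in enum I -> P i d).
  by move=> [d d0 hd]; exists d => // y y0 hy i; apply: hd; rewrite ?mem_enum.
elim: (enum I) => [|i r IH]; first by exists 1.
have [d d0 hd] := small_and (h i) IH; exists d => // y y0 /(hd _ y0) [h1 h2] j.
by rewrite inE => /orP[/eqP->//|]; exact: h2.
Qed.

Lemma small_ex (R : realType) (P : R -> Prop) : small P -> exists2 d, 0 < d & P d.
Proof.
by move=> [d d0 hd]; exists (d / 2); [rewrite divr_gt0|apply: hd; lra].
Qed.

(** The factor 3 is the upper end [3 * d] of the interval on which [chi d] rises. *)
Lemma small_vanish (R : realType) n (phi l : 'cV[R]_n -> R) (e : R) :
  Cc phi -> continuous l -> (forall x, l x <= 0 -> phi x = 0) -> 0 < e ->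
  small (fun d => forall x, l x <= 3 * d -> `|phi x| < e).
Proof.
move=> cp cl h e0; have [d d0 hd] := vanishing_small cp cl h e0.
by exists (d / 3); [rewrite divr_gt0|move=> y y0 yd x hx; apply: hd; lra].
Qed.

Definition cutoff {R : realType} {n} (d : R) (x : 'cV[R]_n) : R := \prod_j chi d (lam j x).

Definition cutoff' {R : realType} {n} (d : R) (j : option 'I_n) (x : 'cV[R]_n) : R :=
  \prod_(m | m != j) chi d (lam m x).

Definition dcutoff {R : realType} {n} (d : R) (i : 'I_n) (x : 'cV[R]_n) : R :=
  \sum_j rho d (lam j x) * glam j i * cutoff' d j x.

Lemma cutoff_derive (R : realType) n (d : R) (i : 'I_n) (x : 'cV[R]_n) : 0 < d ->
  is_derive x (basis_vec i) (cutoff d) (dcutoff d i x).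
Proof.
move=> d0; apply: is_derive_prod => j.
by have := is_derive_chi_lam j x (basis_vec i) d0; rewrite glam_basis.
Qed.

Lemma cutoff_itv (R : realType) n (d : R) (x : 'cV[R]_n) : 0 <= cutoff d x <= 1.
Proof.
apply/andP; split; first by apply: prodr_ge0 => j _; have /andP[] := chi_itv d (lam j x).
by apply: prodr_ile1 => j _; exact: chi_itv.
Qed.

Lemma cutoff'_itv (R : realType) n (d : R) j (x : 'cV[R]_n) : 0 <= cutoff' d j x <= 1.
Proof.
apply/andP; split; first by apply: prodr_ge0 => k _; have /andP[] := chi_itv d (lam k x).
by apply: prodr_ile1 => k _; exact: chi_itv.
Qed.

Lemma cutoff_continuous (R : realType) n (d : R) : 0 < d -> continuous (@cutoff R n d).
Proof. by move=> d0 x; apply: cont_at_prod => j _; exact: chi_lam_continuous. Qed.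

Lemma cutoff'_continuous (R : realType) n (d : R) j : 0 < d -> continuous (@cutoff' R n d j).
Proof. by move=> d0 x; apply: cont_at_prod => k _; exact: chi_lam_continuous. Qed.

Lemma dcutoff_continuous (R : realType) n (d : R) i : 0 < d -> continuous (@dcutoff R n d i).
Proof.
move=> d0 x; apply: cont_at_sum => j _; apply: cont_atM; last exact: cutoff'_continuous.
apply: cont_atM; [exact: rho_lam_continuous|exact: cont_at_cst].
Qed.

Lemma not_inT (R : realType) n (x : 'cV[R]_n) : ~ inT x -> exists m, lam m x <= 0.
Proof.
by move=> h; apply: contra_notP h => /forallNP h m; rewrite ltNge; apply/negP; exact: h.
Qed.

Lemma cutoff_out (R : realType) n (d : R) m (x : 'cV[R]_n) : 0 < d -> lam m x <= d ->
  cutoff d x = 0 /\ forall j, rho d (lam j x) * cutoff' d j x = 0.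
Proof.
move=> d0 h; split.
  by rewrite /cutoff (bigD1 m)//= chi_le// mul0r.
move=> j; have [mj|mj] := eqVneq m j; first by rewrite -mj rho_le// mul0r.
by rewrite /cutoff' (bigD1 m)//= chi_le// mul0r mulr0.
Qed.

Lemma dcutoff_out (R : realType) n (d : R) m i (x : 'cV[R]_n) : 0 < d -> lam m x <= d ->
  dcutoff d i x = 0.
Proof.
move=> d0 h; rewrite /dcutoff big1// => j _; rewrite mulrAC.
by have [_ ->] := cutoff_out d0 h; rewrite mul0r.
Qed.

Lemma nearv_lam (R : realType) n (x : 'cV[R]_n) m (d : R) : lam m x < d ->
  nearv x (fun y => lam m y <= d).
Proof.
move=> h; have /cvg_vclose/(_ (d - lam m x)) := @lam_continuous R n m x.
rewrite subr_gt0 => /(_ h) [e e0 he]; exists e => // y /he; rewrite ltr_distl => /andP[].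
lra.
Qed.

(** The partial derivatives of the cut-off field integrate to zero by [J_partial], and the product
    rule splits them. The cutoff vanishes wherever some [lam m <= d], so the [dV i] matter only
    inside, where they may be unbounded; their sum [D] is the only combination required to be
    continuous everywhere. *)
Lemma cutoff_identity (R : realType) n (V dV : 'I_n -> 'cV[R]_n -> R) (D : 'cV[R]_n -> R) (d : R) :
  0 < d -> (forall i, continuous (V i)) ->
  (forall i x, inT x -> is_derive x (basis_vec i) (V i) (dV i x)) ->
  (forall i x, inT x -> {for x, continuous (dV i)}) ->
  Cc D -> (forall x, inT x -> \sum_i dV i x = D x) ->
  J (fun x => cutoff d x * D x) +
  \sum_j J (fun x => rho d (lam j x) * cutoff' d j x * \sum_i glam j i * V i x) = 0.
Proof.
move=> d0 cV dVi cdV cD DE.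
have inTbox x : ~ inT x -> exists2 m, lam m x < d & lam m x <= d.
  by move=> /not_inT[m hm]; exists m; [exact: le_lt_trans hm d0|apply: le_trans hm (ltW d0)].
pose g i x := cutoff d x * V i x.
pose dg i x := dcutoff d i x * V i x + cutoff d x * dV i x.
have suppT (f : 'cV[R]_n -> R) : (forall x, ~ inT x -> f x = 0) -> supp 1 f.
  by move=> h x i hx; apply: h => /inT_box/(_ i); rewrite leNgt hx.
have cg i : Cc (g i).
  split; first by move=> x; apply: cont_atM; [exact: cutoff_continuous|exact: cV].
  exists 1; apply: suppT => x /inTbox [m _ hm].
  by rewrite /g; have [-> _] := cutoff_out d0 hm; rewrite mul0r.
have dg0 i m x : lam m x <= d -> dg i x = 0.
  move=> hm; rewrite /dg (dcutoff_out _ d0 hm).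
  by have [-> _] := cutoff_out d0 hm; rewrite !mul0r addr0.
have cdg i : Cc (dg i).
  split; last by exists 1; apply: suppT => x /inTbox [m _]; exact: dg0.
  move=> x; have [Tx|/inTbox[m hm _]] := pselect (inT x).
    apply: cont_atD; apply: cont_atM.
    - exact: dcutoff_continuous.
    - exact: cV.
    - exact: cutoff_continuous.
    - exact: cdV.
  apply: (@cont_at_near _ _ (fun=> 0)); last exact: cont_at_cst.
  by apply: nearvS (nearv_lam hm) => y hy; rewrite (dg0 i m).
have dgi i x : is_derive x (basis_vec i) (g i) (dg i x).
  have [Tx|/inTbox[m hm hm']] := pselect (inT x).
    exact: (is_derive_mul (cutoff_derive i x d0) (dVi i x Tx)).
  apply: (@is_derive_near _ _ (fun=> 0)).
    apply: nearvS (nearv_lam hm) => y hy.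
    by rewrite /g; have [-> _] := cutoff_out d0 hy; rewrite mul0r.
  by rewrite (dg0 i m)//; exact: is_derive_cst.
have J0i i : J (dg i) = 0 by exact: (@J_partial R n i (g i) (dg i)).
pose T j x := rho d (lam j x) * cutoff' d j x * \sum_i glam j i * V i x.
have cT j : Cc (T j).
  split; last first.
    exists 1; apply: suppT => x /inTbox [m _ hm].
    by rewrite /T; have [_ ->] := cutoff_out d0 hm; rewrite mul0r.
  move=> x; apply: cont_atM; first apply: cont_atM.
  - exact: rho_lam_continuous.
  - exact: cutoff'_continuous.
  - apply: cont_at_sum => i _; apply: cont_atM; [exact: cont_at_cst|exact: cV].
have [cS JS] := @CcJ_sum R n _ (index_enum _) predT T (fun j _ => cT j).
have [_ Jdg] := @CcJ_sum R n _ (index_enum _) predT dg (fun i _ => cdg i).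
have cwD : Cc (fun x => cutoff d x * D x) := CcM (@cutoff_continuous R n d d0) cD.
rewrite -JS -JD//.
transitivity (J (fun x => \sum_i dg i x)); last first.
  by rewrite Jdg big1// => i _; exact: J0i.
apply: J_ext => x; rewrite /dg /T.
have [Tx|/inTbox[m _ hm]] := pselect (inT x); last first.
  rewrite [RHS]big1; last by move=> i _; rewrite -/(dg i x) (dg0 i m).
  have [-> h] := cutoff_out d0 hm; rewrite mul0r add0r big1// => j _.
  by rewrite h mul0r.
rewrite big_split/= addrC -DE// mulr_sumr; congr (_ + _).
rewrite /dcutoff (eq_bigr (fun i => \sum_j rho d (lam j x) * cutoff' d j x * (glam j i * V i x))); last first.
  by move=> i _; rewrite mulr_suml; apply: eq_bigr => j _; ring.
by rewrite exchange_big; apply: eq_bigr => j _; rewrite mulr_sumr.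
Qed.

(** * Divergence theorem on the simplex *)

Lemma absr_le_eps (R : realType) (a C : R) : 0 <= C -> (forall e : R, 0 < e -> `|a| <= e * C) -> a = 0.
Proof.
move=> C0 h; apply/eqP; rewrite -normr_le0 leNgt; apply/negP => a0.
have := h (`|a| / (C + 1) / 2); rewrite !divr_gt0 ?ltr_wpDl// => /(_ isT).
have q1 : C / (C + 1) <= 1 by rewrite ler_pdivrMr ?ltr_wpDl// mul1r lerDl.
rewrite (_ : _ * C = `|a| / 2 * (C / (C + 1))); last by ring.
nra.
Qed.

(** Let the cutoff width tend to 0 in [cutoff_identity]. The slab at face [j] converges to the face
    integral, the other slabs disappear because the flux vanishes on their faces, and the product of
    the other cutoffs differs from 1 only where the flux through [j] is small. The sign is plus
    since [glam] points inward. *)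
Lemma divergence (R : realType) n (j : option 'I_n.+1)
    (V dV : 'I_n.+1 -> 'cV[R]_n.+1 -> R) (D : 'cV[R]_n.+1 -> R) :
  (forall i, continuous (V i)) ->
  (forall i x, inT x -> is_derive x (basis_vec i) (V i) (dV i x)) ->
  (forall i x, inT x -> {for x, continuous (dV i)}) ->
  Cc D -> (forall x, inT x -> \sum_i dV i x = D x) -> (forall x, ~ inT x -> D x = 0) ->
  (forall l x, l != j -> lam l x = 0 -> \sum_i glam l i * V i x = 0) ->
  (forall m x, m != j -> lam m x <= 0 -> \sum_i glam j i * V i x = 0) ->
  J D + J (fun y : 'cV[R]_n => \sum_i glam j i * V i (face_chart j y)) = 0.
Proof.
move=> cV dVi cdV cD DE D0 Z0 Zj0.
pose Z l x := \sum_i glam l i * V i x.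
have cZ l : continuous (Z l).
  by move=> x; apply: cont_at_sum => i _; apply: cont_atM; [exact: cont_at_cst|exact: cV].
(* [B] is 1 on the box containing the simplex; it gives the fluxes compact support, which the fields
   [V i] need not have. *)
pose B : 'cV[R]_n.+1 -> R := bump 2.
have cB : Cc B := @bump_Cc R _ 2.
have B0 x : 0 <= B x by have /andP[] := bump_itv 2 x.
have B1 x : box 1 x -> B x = 1.
  by move=> bx; rewrite /B bump1// => i; apply: le_trans (bx i) _; lra.
pose ZB l x := Z l x * B x.
have cZB l : Cc (ZB l) := CcM (@cZ l) cB.
pose NZB l x := `|Z l x| * B x.
have cNZB l : Cc (NZB l).
  by apply: CcM => // x; apply: cont_at_norm; exact: cZ.
have -> : J (fun y : 'cV[R]_n => \sum_i glam j i * V i (face_chart j y)) =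
    J (fun y => ZB j (face_chart j y)).
  apply: J_ext => y; rewrite /ZB.
  have [hy|hy] := pselect (forall m, m != j -> 0 < lam m (face_chart j y)); last first.
    have [m mj lm] : exists2 m, m != j & lam m (face_chart j y) <= 0.
      apply: contra_notP hy => h m mj; rewrite ltNge; apply/negP => hm; apply: h.
      by exists m.
    by rewrite [LHS](Zj0 m)// /Z (Zj0 m)// mul0r.
  rewrite B1 ?mulr1// => i.
  have h0 m : 0 <= lam m (face_chart j y).
    have [->|mj] := eqVneq m j; first by rewrite lam_face_chart.
    exact/ltW/hy.
  rewrite ger0_norm; last exact: (h0 (Some i)).
  have := h0 None; rewrite /= subr_ge0; apply: le_trans.
  rewrite (bigD1 i)//= lerDl; apply: sumr_ge0 => k _; exact: (h0 (Some k)).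
have cBc := Cc_face_chart j cB.
set a := _ + _.
(* The coefficients of [e] in the four errors: [e1] for the bulk, [eS] for the other faces, [e3]
   with [h5] for the remaining cutoffs on slab [j], and [h4] for the slab limit. *)
apply: (@absr_le_eps _ _ (J B + (#|{: option 'I_n.+1}|)%:R + (J (fun y : 'cV[R]_n => B (face_chart j y)) + 1) + 1)).
  by rewrite !addr_ge0//; apply: J_ge0.
move=> e e0.
have s1 : small (fun d => forall m x, lam m x <= 3 * d -> `|D x| < e).
  apply: small_forall => m; apply: small_vanish => //; first exact: lam_continuous.
  by move=> x hx; apply: D0 => /(_ m); rewrite ltNge hx.
have s2 : small (fun d => forall l, l != j -> J (fun x => rho d (lam l x) * NZB l x) <= e).
  apply: small_forall => l; have [->|lj] := eqVneq l j; first by exists 1.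
  have [d0 d00 hd] := J_slab l (cNZB l) e0.
  exists d0 => // d dp dd _; have := hd d dp dd.
  rewrite [X in _ - X](_ : _ = 0); last first.
    rewrite -(@J0 R n); apply: J_ext => y.
    by rewrite /NZB /Z Z0// ?normr0 ?mul0r//; exact: lam_face_chart.
  by rewrite subr0; apply: le_trans; exact: ler_norm.
have s3 : small (fun d => forall m, m != j -> forall x, lam m x <= 3 * d -> `|ZB j x| < e).
  apply: small_forall => m; have [->|mj] := eqVneq m j; first by exists 1.
  have [d0 d00 hd] := @small_vanish R n.+1 (ZB j) (lam m) e (cZB j) (@lam_continuous R _ m)
    (fun x hx => ltac:(by rewrite /ZB /Z (Zj0 m) ?mul0r)) e0.
  by exists d0 => // d dp dd _; exact: hd.
have s4 : small (fun d => `|J (fun x => rho d (lam j x) * ZB j x) - J (fun y : 'cV[R]_n => ZB j (face_chart j y))| <= e).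
  exact: (J_slab j (cZB j) e0).
have s5 : small (fun d => `|J (fun x => rho d (lam j x) * B x) - J (fun y : 'cV[R]_n => B (face_chart j y))| <= 1).
  exact: (J_slab j cB ltr01).
have [d d0 [[[[h1 h2] h3] h4] h5]] := small_ex (small_and (small_and (small_and (small_and s1 s2) s3) s4) s5).
have id := cutoff_identity d0 cV dVi cdV cD DE.
pose T l x := rho d (lam l x) * cutoff' d l x * Z l x.
have T0 l x : ~ inT x -> T l x = 0.
  move=> /not_inT[m hm]; rewrite /T.
  by have [_ ->] := cutoff_out d0 (le_trans hm (ltW d0)); rewrite mul0r.
have cT l : Cc (T l).
  split; last first.
    exists 1 => x i hx; apply: T0 => /inT_box/(_ i); by rewrite leNgt hx.
  move=> x; apply: cont_atM; last exact: cZ.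
  by apply: cont_atM; [exact: rho_lam_continuous|exact: cutoff'_continuous].
have crho l (f : 'cV[R]_n.+1 -> R) : Cc f -> Cc (fun x => rho d (lam l x) * f x).
  by move=> cf; apply: CcM => //; exact: rho_lam_continuous.
have e1 : `|J D - J (fun x => cutoff d x * D x)| <= e * J B.
  have cwD : Cc (fun x => cutoff d x * D x) := CcM (@cutoff_continuous R _ d d0) cD.
  rewrite -JB// -JZ//; apply: J_norm_le; [exact: CcB|exact: CcZ|move=> x].
  have [Tx|nT] := pselect (inT x); last first.
    by rewrite D0// mulr0 subrr normr0 mulr_ge0// ltW.
  rewrite B1 ?mulr1; last exact: inT_box.
  have [hm|/existsNP[m /negP]] := pselect (forall m, 3 * d <= lam m x).
    by rewrite /cutoff big1 ?mul1r ?subrr ?normr0 ?(ltW e0)// => m _; rewrite chi_ge.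
  rewrite -ltNge => /ltW /h1 hD.
  rewrite -[X in X - _]mul1r -mulrBl normrM; apply: le_trans (_ : 1 * `|D x| <= _).
    apply: ler_wpM2r => //; have /andP[k1 k2] := cutoff_itv d x.
    by rewrite ger0_norm; lra.
  by rewrite mul1r ltW.
have e2 l : l != j -> `|J (T l)| <= e.
  move=> lj; apply: le_trans (h2 l lj); apply: J_norm_le => //; first exact: crho.
  move=> x; have [Tx|nT] := pselect (inT x); last first.
    by rewrite T0// normr0 mulr_ge0 ?rho_ge0// mulr_ge0.
  rewrite /NZB B1 ?mulr1; last exact: inT_box.
  rewrite /T normrM normrM (ger0_norm (rho_ge0 (lam l x) d0)); apply: ler_wpM2r => //.
  have /andP[k1 k2] := cutoff'_itv d l x.
  by rewrite ger0_norm// ler_piMr// rho_ge0.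
(* Replacing [cutoff' d j] by 1 costs something only close to a face [m != j], and there [h3] makes
   the flux through [j] smaller than [e]. *)
have e3 : `|J (T j) - J (fun x => rho d (lam j x) * ZB j x)| <= e * J (fun x => rho d (lam j x) * B x).
  rewrite -JB//; last exact: crho.
  rewrite -JZ//; last exact: crho.
  apply: J_norm_le; [by apply: CcB => //; exact: crho|by apply: CcZ; exact: crho|move=> x].
  have [lj|lj] := leP (lam j x) 0.
    rewrite /T rho_le ?mul0r ?subrr ?normr0 ?mulr0//; exact: le_trans lj (ltW d0).
  have [Tx|nT] := pselect (inT x); last first.
    have [m hm] := not_inT nT.
    have mj : m != j by apply: contraTneq lj => <-; rewrite -leNgt.
    rewrite T0// /ZB /Z (Zj0 m)// mul0r mulr0 subrr normr0.
    by rewrite mulr_ge0// ?(ltW e0)// mulr_ge0// rho_ge0.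
  rewrite /T /ZB B1 ?mulr1; last exact: inT_box.
  rewrite -mulrA -mulrBr normrM (ger0_norm (rho_ge0 _ d0)) [leRHS]mulrC.
  apply: ler_wpM2l; first exact: rho_ge0.
  have [hm|/existsNP[m hm]] := pselect (forall m, m != j -> 3 * d <= lam m x).
    rewrite /cutoff' big1 ?mul1r ?subrr ?normr0 ?(ltW e0)// => m mj; rewrite chi_ge//; exact: hm.
  have [mj {}hm] := proj1 (not_implyP _ _) hm.
  have := h3 m mj x; rewrite /ZB B1 ?mulr1; last exact: inT_box.
  move=> hZ; have /hZ {}hZ : lam m x <= 3 * d by move/negP: hm; rewrite -ltNge => /ltW.
  rewrite -[X in _ - X]mul1r -mulrBl normrM; apply: le_trans (_ : 1 * `|Z j x| <= _).
    apply: ler_wpM2r => //; have /andP[k1 k2] := cutoff'_itv d j x.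
    by rewrite ler0_norm; lra.
  by rewrite mul1r ltW.
pose S := \sum_(i | i != j) J (T i).
have {}id : J (fun x => cutoff d x * D x) + (J (T j) + S) = 0.
  by rewrite -[RHS]id; congr (_ + _); rewrite [RHS](bigD1 j).
have eS : `|S| <= e * (#|{: option 'I_n.+1}|)%:R.
  apply: le_trans (ler_norm_sum _ _ _) _.
  apply: le_trans (_ : \sum_(i | i != j) e <= _); first exact: ler_sum.
  rewrite sumr_const mulr_natr ler_wpMn2l ?(ltW e0)//; exact: max_card.
set Jw := J (fun x => cutoff d x * D x) in id e1.
rewrite /a; set Jr := J (fun x => rho d (lam j x) * ZB j x) in e3 h4.
set Jc := J (fun y : 'cV[R]_n => ZB j (face_chart j y)) in h4 *.
set JBr := J (fun x => rho d (lam j x) * B x) in e3 h5.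
set JBc := J (fun y : 'cV[R]_n => B (face_chart j y)) in h5 *.
have e3' : e * JBr <= e * (JBc + 1).
  apply: ler_wpM2l; first exact: ltW.
  by move: h5; rewrite ler_norml => /andP[]; lra.
move: e1 eS e3 h4; rewrite !ler_norml !mulrDr mulr1.
move=> /andP[k1 k2] /andP[k3 k4] /andP[k5 k6] /andP[k7 k8].
rewrite mulrDr mulr1 in e3'.
apply/andP; split; lra.
Qed.

(** * Geometry of the simplex: weights, interior, dilations and retraction *)

Lemma sum_option (V : nmodType) (I : finType) (f : option I -> V) :
  \sum_j f j = f None + \sum_i f (Some i).
Proof.
rewrite (bigD1 None)//=; congr (_ + _).
rewrite (reindex_omap (@Some I) id) /=; last by case.
by apply: eq_bigl => i; rewrite eqxx.
Qed.

(** The weights in a convex combination of the vertices are forced: they are the barycentric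
    coordinates of the point. *)
Lemma simplex_lam (R : realType) n (x : 'cV[R]_n) : @simplex R n x <-> forall j, 0 <= lam j x.
Proof.
split.
  move=> [w [w0 w1 ->]].
  have xE k : (\sum_j w j *: vertex j : 'cV[R]_n) k 0 = w (Some k).
    rewrite summxE sum_option/= !mxE mulr0 add0r (bigD1 k)//= !mxE !eqxx mulr1.
    by rewrite big1 ?addr0// => i ik; rewrite !mxE eq_sym (negbTE ik) mulr0.
  move=> [k|] /=; first by rewrite xE.
  rewrite (eq_bigr (fun i => w (Some i))); last by move=> i _; rewrite xE.
  by rewrite -w1 sum_option/= addrK.
move=> h; exists (fun j => lam j x); split => //.
  by rewrite sum_option /= subrK.
rewrite sum_option /= scaler0 add0r; apply: cV_ext => k.
rewrite summxE (bigD1 k)//= !mxE !eqxx mulr1 big1 ?addr0// => i ik.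
by rewrite !mxE eq_sym (negbTE ik) mulr0.
Qed.

Lemma simplex_box (R : realType) n (x : 'cV[R]_n) : @simplex R n x -> box 1 x.
Proof.
move=> /simplex_lam h i; rewrite ger0_norm; last exact: (h (Some i)).
have := h None; rewrite /= subr_ge0; apply: le_trans.
rewrite (bigD1 i)//= lerDl; apply: sumr_ge0 => k _; exact: (h (Some k)).
Qed.

Lemma interior_simplex (R : realType) n (x : 'cV[R]_n.+1) : (@simplex R n.+1)° x <-> inT x.
Proof.
split.
  move=> /nbhs_vclose[d d0 hd] j.
  (* A direction along which [lam j] decreases at unit rate. The step [d / 2] stays in the simplex,
     which forces [lam j x >= d / 2]. *)
  pose v : 'cV[R]_n.+1 := if j is Some k then - basis_vec k else basis_vec ord0.
  have v1 i : `|v i 0| <= 1.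
    by rewrite /v; case: (j) => [k|]; rewrite !mxE ?normrN; case: (_ && _); rewrite ?normr1 ?normr0.
  have lv : \sum_i glam j i * v i 0 = -1.
    rewrite /v; case: (j) => [k|]; last by rewrite glam_basis.
    rewrite (eq_bigr (fun i => - (glam (Some k) i * (basis_vec k : 'cV[R]_n.+1) i 0))); last first.
      by move=> i _; rewrite mxE mulrN.
    by rewrite sumrN glam_basis /= eqxx.
  have /simplex_lam/(_ j) : @simplex R n.+1 ((d / 2) *: v + x).
    apply: hd => i; rewrite !mxE opprD addrCA subrr addr0 normrN normrM ger0_norm ?divr_ge0 ?ltW//.
    have := v1 i; nra.
  by rewrite lam_lin lv; lra.
move=> h; apply/nbhs_vclose.
have [d d0 hd] : nearv x (fun y => forall j, - lam j y <= 0).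
  apply: nearv_forall => j; have /cvg_vclose/(_ _ (h j)) := @lam_continuous R n.+1 j x.
  move=> [e e0 he]; exists e => // y /he; rewrite ltr_distl => /andP[]; lra.
by exists d => // y /hd hy; apply/simplex_lam => j; have := hy j; rewrite oppr_le0.
Qed.

Lemma lam_vertex (R : realType) n (l j : option 'I_n) :
  lam l (vertex j : 'cV[R]_n) = (l == j)%:R.
Proof.
case: j => [k|] /=.
  have := lam_lin l 1 (basis_vec k) (0 : 'cV[R]_n).
  rewrite scale1r addr0 mul1r glam_basis => ->.
  case: l => [i|] /=; first by rewrite mxE add0r eq_sym.
  by rewrite big1 ?subr0 ?subrr// => i _; rewrite mxE.
case: l => [i|] /=; first by rewrite mxE.
by rewrite big1 ?subr0// => i _; rewrite mxE.
Qed.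

Definition dilate {R : realType} {n} (j : option 'I_n) (s : R) (x : 'cV[R]_n) : 'cV[R]_n :=
  s *: (x - vertex j) + vertex j.

Lemma lam_affine (R : realType) n (l : option 'I_n) (x y : 'cV[R]_n) (t : R) :
  lam l (t *: (y - x) + x) = t * lam l y + (1 - t) * lam l x.
Proof.
have h1 := lam_lin l 1 (y - x) x; rewrite scale1r subrK mul1r in h1.
by rewrite lam_lin h1; ring.
Qed.

Lemma lam_dilate (R : realType) n (l j : option 'I_n) (s : R) (x : 'cV[R]_n) :
  lam l (dilate j s x) = s * lam l x + (1 - s) * (l == j)%:R.
Proof. by rewrite /dilate lam_affine lam_vertex. Qed.

Lemma inT_dilate (R : realType) n (j : option 'I_n) (s : R) (x : 'cV[R]_n) :
  0 < s -> s <= 1 -> inT x -> inT (dilate j s x).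
Proof.
move=> s0 s1 h l; rewrite lam_dilate ltr_pwDl//; first by rewrite mulr_gt0// h.
by rewrite mulr_ge0// subr_ge0.
Qed.

Definition centroid {R : realType} {n} : 'cV[R]_n := const_mx (n.+1)%:R^-1.

Lemma inT_centroid (R : realType) n : inT (@centroid R n).
Proof.
move=> [k|] /=; first by rewrite mxE invr_gt0 ltr0Sn.
rewrite (eq_bigr (fun=> (n.+1)%:R^-1)); last by move=> i _; rewrite mxE.
rewrite sumr_const card_ord -[_ *+ n]mulr_natl subr_gt0 ltr_pdivrMr ?ltr0Sn// mul1r.
by rewrite ltr_nat.
Qed.

Definition toward {R : realType} {n} (t : R) (x : 'cV[R]_n) := t *: (centroid - x) + x.

Lemma inT_toward (R : realType) n (t : R) (x : 'cV[R]_n) : 0 < t -> t <= 1 ->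
  @simplex R n x -> inT (toward t x).
Proof.
move=> t0 t1 /simplex_lam h j; rewrite lam_affine ltr_pwDl//.
  by rewrite mulr_gt0// inT_centroid.
by rewrite mulr_ge0// subr_ge0.
Qed.

Lemma inT_simplex (R : realType) n (x : 'cV[R]_n) : inT x -> @simplex R n x.
Proof. by move=> h; apply/simplex_lam => j; exact: ltW. Qed.

Lemma vclose_toward (R : realType) n (e : R) (x : 'cV[R]_n) : 0 < e -> @simplex R n x ->
  small (fun t => vclose e x (toward t x)).
Proof.
move=> e0 Tx; exists (e / 2); first by rewrite divr_gt0.
move=> t t0 te i; rewrite !mxE opprD addrCA subrr addr0 normrN normrM gtr0_norm//.
have h1 := simplex_box Tx i.
have h2 := simplex_box (inT_simplex (@inT_centroid R n)) i; rewrite mxE in h2.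
have := ler_normB ((n.+1)%:R^-1) (x i 0); nra.
Qed.

(** A retraction of the whole space onto the simplex in closed form: clip negative coordinates, then
    rescale if the sum exceeds 1. Composition with it extends continuous functions off the closed
    simplex. *)
Definition retract {R : realType} {n} (x : 'cV[R]_n) : 'cV[R]_n :=
  \col_i (Num.max (x i 0) 0 / Num.max 1 (\sum_k Num.max (x k 0) 0)).

Lemma retract_simplex (R : realType) n (x : 'cV[R]_n) : @simplex R n (retract x).
Proof.
have m0 : 0 < Num.max 1 (\sum_k Num.max (x k 0) 0) by rewrite lt_max ltr01.
apply/simplex_lam => -[k|] /=.
  by rewrite mxE divr_ge0// ?(ltW m0)// le_max lexx orbT.
rewrite (eq_bigr (fun i => Num.max (x i 0) 0 / Num.max 1 (\sum_k Num.max (x k 0) 0))); last first.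
  by move=> i _; rewrite mxE.
by rewrite -mulr_suml subr_ge0 ler_pdivrMr// mul1r le_max lexx orbT.
Qed.

Lemma retract_id (R : realType) n (x : 'cV[R]_n) : @simplex R n x -> retract x = x.
Proof.
move=> /simplex_lam h; apply: cV_ext => i; rewrite mxE.
have hm k : Num.max (x k 0) 0 = x k 0 by apply/max_l/(h (Some k)).
rewrite hm (eq_bigr (fun i => x i 0)); last by move=> k _; rewrite hm.
by rewrite max_l ?divr1//; have := h None; rewrite /= subr_ge0.
Qed.

Lemma cont_at_max (R : realType) n (f g : 'cV[R]_n -> R) x :
  {for x, continuous f} -> {for x, continuous g} ->
  {for x, continuous (fun y => Num.max (f y) (g y))}.
Proof. move=> cf cg; exact: (@continuous_max R _ f g x cf cg). Qed.

Lemma retract_continuous (R : realType) n (f : 'cV[R]_n -> R) :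
  (forall x, @simplex R n x -> forall e : R, 0 < e -> exists2 d : R, 0 < d &
     forall y, @simplex R n y -> vclose d x y -> `|f x - f y| < e) ->
  continuous (fun x => f (retract x)).
Proof.
move=> h x; apply/cvg_vclose => e e0.
have [d d0 hd] := h _ (retract_simplex x) e e0.
have [d' d'0 hd'] : nearv x (fun y => forall i, `|retract x i 0 - retract y i 0| < d).
  apply: nearv_forall => i.
  suff /cvg_vclose/(_ d d0) : {for x, continuous (fun y : 'cV[R]_n => retract y i 0)} by [].
  have -> : (fun y : 'cV[R]_n => retract y i 0) =
    (fun y => Num.max (y i 0) 0 * (Num.max 1 (\sum_k Num.max (y k 0) 0))^-1).
    by apply/funext => y; rewrite mxE.
  apply: cont_atM.
    by apply: cont_at_max; [exact: vdist_continuous|exact: cont_at_cst].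
  apply: (@cont_at_comp1 _ _ (fun y : 'cV[R]_n => Num.max 1 (\sum_k Num.max (y k 0) 0)) (fun t => t^-1)).
    apply: cont_at_max; first exact: cont_at_cst.
    apply: cont_at_sum => k _; apply: cont_at_max; [exact: vdist_continuous|exact: cont_at_cst].
  by apply: inv_continuous; rewrite gt_eqF// lt_max ltr01.
exists d' => // y /hd' hy; apply: hd => //; exact: retract_simplex.
Qed.

Lemma nearv_inT (R : realType) n (x : 'cV[R]_n) : inT x -> nearv x inT.
Proof.
move=> h; apply: nearv_forall => j; have /cvg_vclose/(_ _ (h j)) := @lam_continuous R n j x.
move=> [e e0 he]; exists e => // y /he; rewrite ltr_distl => /andP[]; lra.
Qed.

Lemma is_derive_scale (R : realType) (V : normedModType R) (f : V -> R) (x v : V) (a l : R) :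
  is_derive x v f l -> is_derive x (a *: v) f (a * l).
Proof.
move=> /is_deriveP h; apply/is_deriveP => e e0.
have [->|a0] := eqVneq a 0.
  exists 1 => // t _ _; by rewrite scale0r scaler0 add0r subrr mulr0 mul0r subr0 normr0.
have na : 0 < `|a| by rewrite normr_gt0.
have [d d0 hd] := h (e / `|a|) (divr_gt0 e0 na).
exists (d / `|a|); first by rewrite divr_gt0.
move=> t t0 td; have := hd (t * a); rewrite mulf_neq0// normrM -ltr_pdivlMr// => /(_ isT td).
rewrite ltr_pdivlMr// -normrM scalerA; congr (`| _ | < _).
by field; rewrite t0.
Qed.

(** Continuous partial derivatives give every directional derivative: the direction is built up one
    coordinate at a time, and the mean value theorem controls each new coordinate step. *)
Lemma is_derive_dir (R : realType) n (F : 'cV[R]_n -> R) (G : 'I_n -> 'cV[R]_n -> R) :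
  (forall i, continuous (G i)) ->
  (forall i x, inT x -> is_derive x (basis_vec i) F (G i x)) ->
  forall v x, inT x -> is_derive x v F (\sum_i v i 0 * G i x).
Proof.
move=> cG dF v x Tx.
have -> : v = \sum_i v i 0 *: basis_vec i.
  apply: cV_ext => k; rewrite summxE (bigD1 k)//= !mxE !eqxx mulr1 big1 ?addr0// => i ik.
  by rewrite !mxE eq_sym (negbTE ik) mulr0.
rewrite (eq_bigr (fun i => v i 0 * G i x)); last first.
  move=> k _; congr (_ * _); rewrite summxE (bigD1 k)//= !mxE !eqxx mulr1 big1 ?addr0// => i ik.
  by rewrite !mxE eq_sym (negbTE ik) mulr0.
elim: (index_enum _) => [|i r IH].
  rewrite !big_nil; apply/is_deriveP => e e0; exists 1 => // t _ _.
  by rewrite scaler0 add0r subrr mulr0 subr0 normr0.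
rewrite !big_cons; set w := \sum_(j <- r) _ in IH *; set a := v i 0.
move: IH => /is_deriveP IH; apply/is_deriveP => e e0.
have e2 : 0 < e / 2 by rewrite divr_gt0.
have [d d0 hd] := IH _ e2.
have e3 : 0 < e / 2 / (`|a| + 1) by rewrite divr_gt0// ltr_wpDl.
have [d1 d10 hd1] : nearv x (fun y => inT y /\ `|G i x - G i y| < e / 2 / (`|a| + 1)).
  apply: nearv_and; first exact: nearv_inT.
  by have /cvg_vclose/(_ _ e3) := @cG i x.
pose M := 1 + \sum_k (`|a| + `|w k 0|).
have M0 : 0 < M by rewrite ltr_pwDl// sumr_ge0// => k _; rewrite addr_ge0.
exists (Num.min d (d1 / M)); first by rewrite lt_min d0 divr_gt0.
move=> t t0; rewrite lt_min => /andP[td td1].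
have cl s : 0 <= s <= 1 -> vclose d1 x (s *: ((t * a) *: basis_vec i) + (t *: w + x)).
  move=> /andP[s0 s1] k; rewrite !mxE.
  rewrite (_ : x k 0 - _ = - (t * (s * a * ((k == i) && true)%:R + w k 0))); last by ring.
  rewrite normrN normrM; apply: le_lt_trans (_ : `|t| * M < _); last by rewrite -ltr_pdivlMr.
  apply: ler_wpM2l => //; apply: le_trans (ler_normD _ _) _.
  apply: le_trans (_ : `|a| + `|w k 0| <= _).
    rewrite lerD2r !normrM (ger0_norm s0); case: (_ && _); rewrite ?normr1 ?normr0.
      by rewrite mulr1 ler_piMl.
    by rewrite mulr0.
  rewrite /M (bigD1 k)//= addrCA lerDl; apply: addr_ge0 => //.
  by apply: sumr_ge0 => l _; apply: addr_ge0.
have [|s hs hF] := @MVT_line R _ F (t *: w + x) ((t * a) *: basis_vec i)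
   (fun s => t * a * G i (s *: ((t * a) *: basis_vec i) + (t *: w + x))).
  move=> s hs; apply: is_derive_scale; apply: dF.
  by have [] := hd1 _ (cl s hs).
have [_] := hd1 _ (cl s hs); set z := s *: _ + _ => hz.
have := hd t t0 td.
rewrite scalerDr scalerA -addrA.
have -> : F ((t * a) *: basis_vec i + (t *: w + x)) = F (t *: w + x) + t * a * G i z.
  by rewrite -/z in hF; rewrite -hF [RHS]addrC subrK.
set S := \sum_(j <- r) _; set A := F (t *: w + x); set B := F x => hA.
rewrite (_ : t^-1 * _ - _ = (t^-1 * (A - B) - S) + a * (G i z - G i x)); last by field.
apply: le_lt_trans (ler_normD _ _) _.
rewrite [e]splitr; apply: ltr_leD => //.
rewrite normrM [`|G i z - _|]distrC.
apply: le_trans (_ : (`|a| + 1) * (e / 2 / (`|a| + 1)) <= _); last first.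
  by rewrite mulrC divfK// gt_eqF// ltr_wpDl.
apply: ler_pM => //; last exact: ltW.
by rewrite lerDl.
Qed.

Lemma segment_inT (R : realType) n (x v : 'cV[R]_n) (s : R) : 0 <= s <= 1 ->
  inT x -> inT (v + x) -> inT (s *: v + x).
Proof.
move=> /andP[s0 s1] Tx Tv j; have := Tv j; have := Tx j.
have := lam_lin j 1 v x; rewrite scale1r mul1r => ->; rewrite lam_lin.
set A := \sum_i _ => h1 h2.
rewrite (_ : _ + _ = (1 - s) * lam j x + s * (lam j x + A)); last by ring.
have [->|s1'] := eqVneq s 1; first by rewrite subrr mul0r add0r mul1r.
apply: ltr_pwDl; first by rewrite mulr_gt0// subr_gt0 lt_neqAle s1'.
by rewrite mulr_ge0// ltW.
Qed.

(** By the mean value theorem the increment is the differential at an intermediate point of the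
    segment; uniform continuity of [G] on the unit box makes the error uniform in [x]. *)
Lemma unif_diff_inT (R : realType) n (F : 'cV[R]_n -> R) (G : 'I_n -> 'cV[R]_n -> R) :
  (forall i, continuous (G i)) ->
  (forall i x, inT x -> is_derive x (basis_vec i) F (G i x)) ->
  forall e : R, 0 < e -> exists2 d : R, 0 < d & forall x v, inT x -> inT (v + x) ->
    (forall i, `|v i 0| < d) ->
    `|F (v + x) - F x - \sum_i v i 0 * G i x| <= e * \sum_i `|v i 0|.
Proof.
move=> cG dF e e0.
have [d d0 hd] : small (fun d => forall i x y, box 1 x -> box 1 y -> vclose d x y ->
    `|G i x - G i y| < e).
  apply: small_forall => i; have [d d0 hd] := box_unif_cont 1 (@cG i) e0.
  by exists d => // d' d'0 dd x y bx by' xy; apply: hd => //; apply: vclose_le xy; exact: ltW.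
exists (d / 2); first by rewrite divr_gt0.
move=> x v Tx Tv hv.
have [|s hs ->] := @MVT_line R _ F x v (fun s => \sum_i v i 0 * G i (s *: v + x)).
  by move=> s hs; apply: is_derive_dir => //; exact: segment_inT.
rewrite -sumrB mulr_sumr; apply: le_trans (ler_norm_sum _ _ _) _.
apply: ler_sum => i _; rewrite -mulrBr normrM mulrC; apply: ler_wpM2r => //.
apply/ltW/(hd (d / 2)).
- by rewrite divr_gt0.
- lra.
- exact/inT_box/segment_inT.
- exact: inT_box.
- move=> k; rewrite !mxE addrK normrM; move: hs => /andP[s0 s1].
  by rewrite (ger0_norm s0); apply: le_lt_trans (hv k); rewrite ler_piMl.
Qed.

Lemma continuous_path (R : realType) n (f : 'cV[R]_n -> R) (x v : 'cV[R]_n) :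
  continuous f -> continuous (fun t : R => f (t *: v + x)).
Proof.
move=> cf t; apply/(@cvgrPdist_lt R R _ (nbhs t) _ (fun t : R => f (t *: v + x)) _) => e e0.
have /cvg_vclose/(_ e e0)[d d0 hd] := cf (t *: v + x).
pose M := 1 + \sum_k `|v k 0|.
have M0 : 0 < M by rewrite ltr_pwDl// sumr_ge0.
apply/nbhs_ballP; exists (d / M); first by rewrite /= divr_gt0.
move=> s; rewrite /ball /= => ts; apply: hd => i; rewrite !mxE.
rewrite (_ : _ - _ = (t - s) * v i 0); last by ring.
rewrite normrM; apply: le_lt_trans (_ : `|t - s| * M < _); last by rewrite -ltr_pdivlMr.
by apply: ler_wpM2l => //; rewrite /M (bigD1 i)//= addrCA lerDl addr_ge0// sumr_ge0.
Qed.

Lemma ge0_limit (R : realType) (h : R -> R) : {for 0, continuous h} ->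
  (forall t, 0 < t -> t < 1 -> 0 <= h t) -> 0 <= h 0.
Proof.
move=> ch h0; rewrite leNgt; apply/negP => hn.
have /cvgrPdist_lt/(_ (- h 0)) : h t @[t --> (0 : R)] --> h 0 by exact: ch.
rewrite oppr_gt0 => /(_ hn) /nbhs_ballP[d /= d0 hd].
pose t := Num.min (d / 2) (1 / 2).
have t0 : 0 < t by rewrite lt_min !divr_gt0.
have td : t <= d / 2 by rewrite ge_min lexx.
have t1 : t <= 1 / 2 by rewrite ge_min lexx orbT.
have := hd t; rewrite /ball /= sub0r normrN gtr0_norm// => /(_ ltac:(lra)).
have := h0 t t0 ltac:(lra); rewrite ltr_distl => ht /andP[]; lra.
Qed.

(** Both endpoints are pulled towards the centroid by a ratio [t], where the interior estimate
    applies, and [t] tends to 0. This makes the first-order expansion valid at boundary points. *)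
Lemma unif_diff (R : realType) n (F : 'cV[R]_n -> R) (G : 'I_n -> 'cV[R]_n -> R) :
  continuous F -> (forall i, continuous (G i)) ->
  (forall i x, inT x -> is_derive x (basis_vec i) F (G i x)) ->
  forall e : R, 0 < e -> exists2 d : R, 0 < d & forall x v, @simplex R n x -> @simplex R n (v + x) ->
    (forall i, `|v i 0| < d) ->
    `|F (v + x) - F x - \sum_i v i 0 * G i x| <= e * \sum_i `|v i 0|.
Proof.
move=> cF cG dF e e0; have [d d0 hd] := unif_diff_inT cG dF e0; exists d => // x v Tx Tv hv.
pose xt (t : R) := t *: (centroid - x) + x.
pose yt (t : R) := t *: (centroid - (v + x)) + (v + x).
pose h (t : R) := e * (\sum_i `|v i 0|) * (1 - t) - `|F (yt t) - F (xt t) - (1 - t) * \sum_i v i 0 * G i (xt t)|.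
suff : 0 <= h 0.
  by rewrite /h /xt /yt !scale0r !add0r !subr0 mul1r mulr1 subr_ge0.
apply: ge0_limit; last first.
  move=> t t0 t1; rewrite subr_ge0.
  have -> : yt t = (1 - t) *: v + xt t.
    apply: cV_ext => i; rewrite !mxE; ring.
  have := hd (xt t) ((1 - t) *: v) (inT_toward t0 (ltW t1) Tx).
  have -> : (1 - t) *: v + xt t = yt t by apply: cV_ext => i; rewrite !mxE; ring.
  move=> /(_ (inT_toward t0 (ltW t1) Tv)) H.
  have /H : forall i, `|((1 - t) *: v) i 0| < d.
    move=> i; rewrite mxE normrM ger0_norm; last lra.
    by apply: le_lt_trans (hv i); apply: ler_piMl => //; lra.
  have -> : \sum_i ((1 - t) *: v) i 0 * G i (xt t) = (1 - t) * \sum_i v i 0 * G i (xt t).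
    by rewrite mulr_sumr; apply: eq_bigr => i _; rewrite mxE mulrA.
  have -> : \sum_i `|((1 - t) *: v) i 0| = (\sum_i `|v i 0|) * (1 - t).
    rewrite mulr_suml; apply: eq_bigr => i _; rewrite mxE normrM mulrC; congr (_ * _).
    by rewrite ger0_norm//; lra.
  by rewrite mulrA.
apply: cvgB.
  apply: cvgM; first exact: cvg_cst.
  by apply: cvgB; [exact: cvg_cst|exact: cvg_id].
apply: cvg_norm; apply: cvgB.
  by apply: cvgB; apply: continuous_path.
apply: cvgM; first by apply: cvgB; [exact: cvg_cst|exact: cvg_id].
have := @continuous_path R n (fun z => \sum_i v i 0 * G i z) x (centroid - x); apply.
move=> z; apply: cont_at_sum => i _; apply: cont_atM; [exact: cont_at_cst|exact: cG].
Qed.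

(** * Rellich identity by dilation *)

(* A real Dirichlet solution [F] of - sum Gam_ik d_i d_k F = F, extended by 0
   off the simplex, with its gradient [G] (extended continuously) and its
   second derivatives [H] (relevant in the open simplex only). *)
Record dirichlet_solution {R : realType} {n} (Gam : 'M[R]_n)
    (F : 'cV[R]_n -> R) (G : 'I_n -> 'cV[R]_n -> R)
    (H : 'I_n -> 'I_n -> 'cV[R]_n -> R) : Prop := DirichletSolution {
  sol_cont : continuous F;
  sol_out : forall x, ~ inT x -> F x = 0;
  sol_grad : forall i x, inT x -> is_derive x (basis_vec i) F (G i x);
  sol_cgrad : forall i, continuous (G i);
  sol_hess : forall i k x, inT x -> is_derive x (basis_vec i) (G k) (H i k x);
  sol_chess : forall i k x, inT x -> {for x, continuous (H i k)};
  sol_eq : forall x, inT x -> \sum_i \sum_k Gam i k * H i k x = - F x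
}.

Lemma is_derive_dilate (R : realType) n (j : option 'I_n) (s : R) (f : 'cV[R]_n -> R)
    (x v : 'cV[R]_n) (l : R) :
  is_derive (dilate j s x) v f l -> is_derive x v (fun y => f (dilate j s y)) (s * l).
Proof.
move=> /(is_derive_scale s)/is_deriveP h; apply/is_deriveP => e e0.
have [d d0 hd] := h e e0; exists d => // t t0 td; have := hd t t0 td.
congr (`| _ * (f _ - _) - _ | < _).
by apply: cV_ext => i; rewrite !mxE; ring.
Qed.

Lemma dilate_continuous_at (R : realType) n (j : option 'I_n) (s : R) (f : 'cV[R]_n -> R) x :
  {for dilate j s x, continuous f} -> {for x, continuous (fun y => f (dilate j s y))}.
Proof.
move=> cf; apply: (@cont_at_comp _ _ _ f (dilate j s)) => // i.
have -> : (fun y : 'cV[R]_n => dilate j s y i 0) = (fun y => s * (y i 0 - vertex j i 0) + vertex j i 0).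
  by apply/funext => y; rewrite !mxE.
apply: cont_atD; last exact: cont_at_cst.
apply: cont_atM; first exact: cont_at_cst.
apply: cont_atB; [exact: vdist_continuous|exact: cont_at_cst].
Qed.

Lemma is_derive_sum_fun (R : realType) (V : normedModType R) (I : Type) (r : seq I)
    (f : I -> V -> R) (df : I -> R) (x v : V) :
  (forall i, is_derive x v (f i) (df i)) ->
  is_derive x v (fun y => \sum_(i <- r) f i y) (\sum_(i <- r) df i).
Proof.
move=> h; elim: r => [|i r IH].
  rewrite big_nil (_ : (fun y => _) = cst 0); first exact: is_derive_cst.
  by apply/funext => y; rewrite big_nil.
have := is_deriveD (h i) IH.
rewrite (_ : (f i + _)%R = (fun y => \sum_(j <- i :: r) f j y)) ?big_cons//.
by apply/funext => y; rewrite big_cons.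
Qed.

Lemma is_derive_sub (R : realType) (V : normedModType R) (f g : V -> R) (x v : V) (a b : R) :
  is_derive x v f a -> is_derive x v g b -> is_derive x v (fun y => f y - g y) (a - b).
Proof. by move=> h1 h2; exact: (is_deriveB h1 h2). Qed.

Lemma is_derive_cmul (R : realType) (V : normedModType R) (c : R) (f : V -> R) (x v : V) (a : R) :
  is_derive x v f a -> is_derive x v (fun y => c * f y) (c * a).
Proof.
move=> h; have := is_derive_mul (is_derive_cst c x v) h.
by rewrite mul0r add0r.
Qed.


(* Green's second identity for [F] and its dilate about the vertex [j]; both
   vanish on the faces through that vertex. *)
Lemma green_dilate (R : realType) n (j : option 'I_n.+1) (Gam : 'M[R]_n.+1) F G H (s : R) :
  dirichlet_solution Gam F G H -> Gam^T = Gam -> 0 < s -> s <= 1 ->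
  (s ^+ 2 - 1) * J (fun x => F x * F (dilate j s x)) +
  J (fun y : 'cV[R]_n => F (dilate j s (face_chart j y)) *
       \sum_i \sum_k glam j i * Gam i k * G k (face_chart j y)) = 0.
Proof.
move=> [cF F0 dF cG dG cH eqF] symG s0 s1.
have GamE i k : Gam i k = Gam k i by rewrite -{1}symG mxE.
pose m := dilate j s.
pose GG i x := \sum_k Gam i k * G k x.
(* Only first derivatives enter [V], so it is continuous up to the boundary. In its divergence the
   two cross terms cancel by symmetry of [Gam], and the equation turns the second derivatives into
   [(s ^+ 2 - 1) * (F x * F (m x))], one power of [s] per derivative of the dilate. *)
pose V i x := F (m x) * GG i x - F x * (s * GG i (m x)).
pose dV i x := (s * G i (m x) * GG i x + F (m x) * \sum_k Gam i k * H i k x) -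
   (G i x * (s * GG i (m x)) + F x * (s * (s * \sum_k Gam i k * H i k (m x)))).
have Tm x : inT x -> inT (m x) by exact: inT_dilate.
have cGG i : continuous (GG i).
  by move=> x; apply: cont_at_sum => k _; apply: cont_atM; [exact: cont_at_cst|exact: cG].
have cFm : continuous (fun x => F (m x)) by move=> x; apply: dilate_continuous_at; exact: cF.
have cV i : continuous (V i).
  move=> x; apply: cont_atB; apply: cont_atM; [exact: cFm|exact: cGG|exact: cF|].
  apply: cont_atM; first exact: cont_at_cst.
  by apply: dilate_continuous_at; exact: cGG.
have dGG i x : inT x -> is_derive x (basis_vec i) (GG i) (\sum_k Gam i k * H i k x).
  move=> Tx; apply: is_derive_sum_fun => k; apply: is_derive_cmul; exact: dG.
have dVi i x : inT x -> is_derive x (basis_vec i) (V i) (dV i x).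
  move=> Tx; apply: is_derive_sub.
    apply: is_derive_mul; last exact: dGG.
    by apply: is_derive_dilate; apply: dF; exact: Tm.
  apply: is_derive_mul; first exact: dF.
  apply: is_derive_cmul; apply: is_derive_dilate; apply: dGG; exact: Tm.
have cdV i x : inT x -> {for x, continuous (dV i)}.
  move=> Tx; apply: cont_atB; apply: cont_atD.
  - apply: cont_atM; last exact: cGG.
    by apply: cont_atM; [exact: cont_at_cst|apply: dilate_continuous_at; exact: cG].
  - apply: cont_atM; first exact: cFm.
    by apply: cont_at_sum => k _; apply: cont_atM; [exact: cont_at_cst|exact: cH].
  - apply: cont_atM; first exact: cG.
    by apply: cont_atM; [exact: cont_at_cst|apply: dilate_continuous_at; exact: cGG].
  - apply: cont_atM; first exact: cF.
    apply: cont_atM; first exact: cont_at_cst.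
    apply: cont_atM; first exact: cont_at_cst.
    apply: (@dilate_continuous_at _ _ j s (fun y => \sum_k Gam i k * H i k y)).
    by apply: cont_at_sum => k _; apply: cont_atM; [exact: cont_at_cst|apply: cH; exact: Tm].
have cFC : Cc F.
  split; first exact: cF.
  by exists 1 => x i hx; apply: F0 => /inT_box/(_ i); rewrite leNgt hx.
have cFF : Cc (fun x => F x * F (m x)).
  by apply: (Cc_ext _ (CcM cFm cFC)) => x; rewrite mulrC.
have vanish l x : l != j -> lam l x <= 0 -> F x = 0 /\ F (m x) = 0.
  move=> lj hl; split; apply: F0 => /(_ l); apply/negP; rewrite -leNgt//.
  by rewrite lam_dilate (negbTE lj) mulr0 addr0 pmulr_rle0.
have V0 l x i : l != j -> lam l x <= 0 -> V i x = 0.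
  by move=> lj /(vanish _ _ lj)[h1 h2]; rewrite /V h1 h2 !mul0r subrr.
have := @divergence R n j V dV (fun x => (s ^+ 2 - 1) * (F x * F (m x))) cV dVi cdV (CcZ _ cFF).
rewrite JZ// => h; rewrite -[RHS]h; first congr (_ + _).
- apply: J_ext => y.
  have Fc : F (face_chart j y) = 0.
    by apply: F0 => /(_ j); rewrite lam_face_chart ltxx.
  rewrite /V Fc mulr_sumr; apply: eq_bigr => i _.
  rewrite mul0r subr0 /GG mulrCA; congr (_ * _).
  by rewrite mulr_sumr; apply: eq_bigr => k _; rewrite mulrA.
- move=> x Tx; rewrite /dV sumrB !big_split/=.
  have -> : \sum_i F (m x) * \sum_k Gam i k * H i k x = F (m x) * - F x.
    by rewrite -mulr_sumr eqF.
  have -> : \sum_i F x * (s * (s * \sum_k Gam i k * H i k (m x))) = F x * (s * (s * - F (m x))).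
    by rewrite -!mulr_sumr eqF//; exact: Tm.
  set A := \sum_i _; set B := \sum_i _.
  suff -> : A = B by rewrite /m; ring.
  rewrite /A /B /GG.
  rewrite (eq_bigr (fun i => \sum_k s * G i (m x) * (Gam i k * G k x))); last by move=> i _; rewrite mulr_sumr.
  rewrite exchange_big /=; apply: eq_bigr => i _; rewrite !mulr_sumr; apply: eq_bigr => k _.
  by rewrite GamE; ring.
- by move=> x Tx; rewrite F0// mul0r mulr0.
- by move=> l x lj l0; rewrite big1// => i _; rewrite (V0 l)// ?l0// mulr0.
- by move=> l x lj l0; rewrite big1// => i _; rewrite (V0 l)// mulr0.
Qed.

Definition radial {R : realType} {n} (j : option 'I_n) (G : 'I_n -> 'cV[R]_n -> R)
    (x : 'cV[R]_n) : R := \sum_i (x i 0 - vertex j i 0) * G i x.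

Lemma simplex_vertex (R : realType) n (j : option 'I_n) : simplex (vertex j : 'cV[R]_n).
Proof. by apply/simplex_lam => l; rewrite lam_vertex ler0n. Qed.

Lemma simplex_segment (R : realType) n (x z : 'cV[R]_n) (t : R) : 0 <= t -> t <= 1 ->
  simplex x -> simplex z -> simplex (t *: (z - x) + x).
Proof.
move=> t0 t1 /simplex_lam hx /simplex_lam hz; apply/simplex_lam => l.
by rewrite lam_affine addr_ge0// mulr_ge0// subr_ge0.
Qed.

(** [F] vanishes along the whole segment from [x] to [z]. The expansion of [unif_diff] at [x] with a
    short step [t] along it, divided by [t], bounds the tangential derivative by any multiple of
    [e]. *)
Lemma face_grad_tangent (R : realType) n (Gam : 'M[R]_n) F G H (l : option 'I_n) (x z : 'cV[R]_n) :
  dirichlet_solution Gam F G H -> simplex x -> simplex z -> lam l x = 0 -> lam l z = 0 ->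
  \sum_i (z i 0 - x i 0) * G i x = 0.
Proof.
move=> [cF F0 dF cG _ _ _] Tx Tz lx lz.
have out y : lam l y = 0 -> F y = 0 by move=> ly; apply: F0 => /(_ l); rewrite ly ltxx.
apply: (@absr_le_eps _ _ (\sum_i `|(z - x) i 0|)); first exact: sumr_ge0.
move=> e e0; have [d d0 hd] := unif_diff cF cG dF e0.
pose M := 1 + \sum_k `|(z - x) k 0|.
have M1 : 1 <= M by rewrite lerDl sumr_ge0.
have M0 : 0 < M by apply: lt_le_trans M1.
pose t := Num.min (d / M / 2) 1.
have t0 : 0 < t by rewrite lt_min !divr_gt0//=.
have t1 : t <= 1 by rewrite ge_min lexx orbT.
have td : t < d / M by apply: le_lt_trans (_ : d / M / 2 < _); [rewrite ge_min lexx|rewrite ltr_pdivrMr// ltr_pMr ?divr_gt0//; lra].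
have := hd x (t *: (z - x)) Tx (simplex_segment (ltW t0) t1 Tx Tz).
rewrite (out x)// (out (_ + _)); last by rewrite lam_affine lx lz !mulr0 addr0.
move=> hh; have /hh : forall i, `|(t *: (z - x)) i 0| < d.
  move=> i; rewrite mxE normrM gtr0_norm//; apply: le_lt_trans (_ : t * M < _); last by rewrite -ltr_pdivlMr.
  by rewrite ler_pM2l// /M (bigD1 i)//= addrCA lerDl addr_ge0// sumr_ge0.
rewrite subrr sub0r normrN.
have -> : \sum_i (t *: (z - x)) i 0 * G i x = t * \sum_i (z i 0 - x i 0) * G i x.
  by rewrite mulr_sumr; apply: eq_bigr => i _; rewrite !mxE mulrA.
have -> : \sum_i `|(t *: (z - x)) i 0| = t * \sum_i `|(z - x) i 0|.
  by rewrite mulr_sumr; apply: eq_bigr => i _; rewrite mxE normrM gtr0_norm.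
by rewrite normrM gtr0_norm// mulrCA ler_pM2l.
Qed.

(* On face [j] the gradient is normal; testing it against the edge from the
   opposite vertex gives its length. *)
Lemma face_grad (R : realType) n (Gam : 'M[R]_n) F G H (j : option 'I_n) (x : 'cV[R]_n) :
  dirichlet_solution Gam F G H -> simplex x -> lam j x = 0 ->
  forall i, G i x = - radial j G x * glam j i.
Proof.
move=> sol Tx lx.
have key l : l != j -> \sum_i (vertex l i 0 - x i 0) * G i x = 0.
  move=> lj; apply: (face_grad_tangent sol Tx (@simplex_vertex R n l) lx).
  by rewrite lam_vertex eq_sym (negbTE lj).
pose q := \sum_i x i 0 * G i x.
have sumE l : \sum_i (vertex l i 0 - x i 0) * G i x = \sum_i vertex l i 0 * G i x - q.
  by rewrite -sumrB; apply: eq_bigr => i _; rewrite mulrBl.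
have vE i : \sum_k (vertex (Some i) : 'cV[R]_n) k 0 * G k x = G i x.
  rewrite (bigD1 i)//= mxE !eqxx mul1r big1 ?addr0// => k ki.
  by rewrite mxE (negbTE ki) mul0r.
have v0 : \sum_k (vertex None : 'cV[R]_n) k 0 * G k x = 0.
  by rewrite big1// => k _; rewrite mxE mul0r.
have rE : radial j G x = q - \sum_i vertex j i 0 * G i x.
  by rewrite -sumrB; apply: eq_bigr => i _; rewrite mulrBl.
case: j lx key rE => [k|] lx key rE i.
  have q0 : q = 0.
    by have := key None isT; rewrite sumE v0 sub0r => /eqP; rewrite oppr_eq0 => /eqP.
  rewrite rE q0 vE sub0r opprK /=; have [->|ik] := eqVneq i k; first by rewrite mulr1.
  rewrite mulr0; have := key (Some i); rewrite (inj_eq Some_inj) sumE vE q0 subr0; exact.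
rewrite rE v0 subr0 /= mulrNN mulr1.
by have := key (Some i) isT; rewrite sumE vE => /eqP; rewrite subr_eq0 => /eqP.
Qed.

(** Off the simplex [G] is merely some continuous extension, so [radial] has no meaning there and is
    replaced by 0. Continuity across the edge of the face is the content of [face_radial_Cc]. *)
Definition face_radial {R : realType} {n} (j : option 'I_n.+1) (G : 'I_n.+1 -> 'cV[R]_n.+1 -> R)
    (y : 'cV[R]_n) : R :=
  if `[< simplex (face_chart j y) >] then radial j G (face_chart j y) else 0.

(** [F] vanishes on the face and the dilation moves a face point [x] by [- d] times [x - vertex j],
    so this is [unif_diff] along that step. Off the face both terms are 0: a negative [lam l] with
    [l != j] is only rescaled, hence the dilated point is still outside. *)
Lemma face_radial_approx (R : realType) n (Gam : 'M[R]_n.+1) F G H (j : option 'I_n.+1) (e : R) :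
  dirichlet_solution Gam F G H -> 0 < e ->
  small (fun d => forall y : 'cV[R]_n,
    `|F (dilate j (1 - d) (face_chart j y)) - (- d) * face_radial j G y| <= d * e).
Proof.
move=> [cF F0 dF cG _ _ _] e0.
have N0 : 0 < (2 * n.+1%:R : R) by rewrite mulr_gt0// ltr0Sn.
(* The displacement has [n.+1] coordinates, each at most twice the step, whence the divisor
   [2 * n.+1]. *)
have [d d0 hd] := unif_diff cF cG dF (divr_gt0 e0 N0).
exists (Num.min (d / 2) 1); first by rewrite lt_min divr_gt0//=.
move=> t t0; rewrite lt_min => /andP[td t1] y; rewrite /face_radial.
set x := face_chart j y; have lx : lam j x = 0 by exact: lam_face_chart.
case: asboolP => [Tx|nT]; last first.
  have [l hl] : exists l, lam l x < 0.
    by apply: contra_notP nT => /forallNP h; apply/simplex_lam => l; rewrite leNgt; apply/negP; exact: h.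
  have lj : l != j by apply: contraTneq hl => ->; rewrite lx ltxx.
  rewrite F0 ?mulr0 ?subrr ?normr0 ?mulr_ge0// ?ltW// => /(_ l); apply/negP.
  by rewrite -leNgt lam_dilate (negbTE lj) mulr0 addr0 mulr_ge0_le0// ?ltW// subr_gt0.
pose v := (- t) *: (x - vertex j).
have mE : dilate j (1 - t) x = v + x by apply: cV_ext => i; rewrite !mxE; ring.
have vb i : `|v i 0| <= t * 2.
  have -> : v i 0 = - (t * (x i 0 - vertex j i 0)) by rewrite !mxE mulNr.
  rewrite normrN normrM gtr0_norm//; apply: ler_wpM2l; first exact: ltW.
  apply: le_trans (ler_normB _ _) _.
  have := simplex_box Tx i; have := simplex_box (@simplex_vertex R n.+1 j) i; lra.
have Tm : simplex (v + x).
  rewrite -mE /dilate; apply: simplex_segment => //; [lra|lra|exact: simplex_vertex].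
have := hd x v Tx Tm; rewrite (F0 x) ?subr0; last by move=> /(_ j); rewrite lx ltxx.
move=> hh; have /hh : forall i, `|v i 0| < d.
  by move=> i; apply: le_lt_trans (vb i) _; move: td; rewrite ltr_pdivlMr.
have -> : \sum_i v i 0 * G i x = - t * radial j G x.
  by rewrite mulr_sumr; apply: eq_bigr => i _; rewrite !mxE mulrA.
rewrite mE => hv; apply: le_trans hv _.
apply: le_trans (_ : e / (2 * n.+1%:R) * (\sum_(i < n.+1) t * 2) <= _).
  by apply: ler_wpM2l; [exact/ltW/divr_gt0|apply: ler_sum].
rewrite sumr_const card_ord (_ : t * 2 *+ n.+1 = t * (2 * n.+1%:R)); last first.
  by rewrite mulrA [RHS]mulr_natr.
by rewrite [leLHS]mulrCA divfK// gt_eqF.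
Qed.

Lemma uniform_limit_continuous (R : realType) n (f : 'cV[R]_n -> R) :
  (forall e : R, 0 < e -> exists2 g, continuous g & forall x, `|g x - f x| <= e) ->
  continuous f.
Proof.
move=> h x; apply/cvg_vclose => e e0.
have e3 : 0 < e / 3 by rewrite divr_gt0.
have [g cg hg] := h _ e3; have /cvg_vclose/(_ _ e3)[d d0 hd] := cg x.
exists d => // y /hd; have := hg x; have := hg y; rewrite !ler_norml !ltr_norml.
by move=> /andP[h1 h2] /andP[h3 h4] /andP[h5 h6]; apply/andP; split; lra.
Qed.

(** A uniform limit of the continuous quotients [F (dilate j (1 - d) x) / (- d)] on the chart; this
    spares a study of the gradient at the edges of the face. *)
Lemma face_radial_Cc (R : realType) n (Gam : 'M[R]_n.+1) F G H (j : option 'I_n.+1) :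
  dirichlet_solution Gam F G H -> Cc (@face_radial R n j G).
Proof.
move=> sol; have [cF _ _ _ _ _ _] := sol; split.
  apply: uniform_limit_continuous => e e0.
  have [d d0 hd] := small_ex (face_radial_approx j sol e0).
  exists (fun y => (- d^-1) * F (dilate j (1 - d) (face_chart j y))).
    move=> y; apply: cont_atM; first exact: cont_at_cst.
    apply: (@face_chart_continuous _ _ j (fun x => F (dilate j (1 - d) x))) => x.
    by apply: dilate_continuous_at; exact: cF.
  move=> y; rewrite -(ler_pM2l d0).
  rewrite -[X in X * `|_|](gtr0_norm d0) -normrM.
  rewrite (_ : d * _ = - (F (dilate j (1 - d) (face_chart j y)) - - d * face_radial j G y)); last first.
    by field; rewrite gt_eqF.
  by rewrite normrN; exact: hd.
exists 1 => y i hy; rewrite /face_radial; case: asboolP => // /simplex_box/(_ (lift (chart_axis j) i)).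
by rewrite face_chart_lift leNgt hy.
Qed.

Definition quad {R : realType} {n} (Gam : 'M[R]_n) (j : option 'I_n) : R :=
  \sum_i \sum_k glam j i * Gam i k * glam j k.

(** Green's identity divided by [d = 1 - s], as [d] tends to 0. The bulk factor tends to 2. In the
    boundary term the dilate contributes the radial derivative and the gradient equals
    [- radial * glam], so two radial factors and [quad Gam j] come out. *)
Lemma rellich_aux (R : realType) n (Gam : 'M[R]_n.+1) F G H (j : option 'I_n.+1) :
  dirichlet_solution Gam F G H -> Gam^T = Gam ->
  2 * J (fun x => F x ^+ 2) = quad Gam j * J (fun y : 'cV[R]_n => face_radial j G y ^+ 2).
Proof.
move=> sol symG; have [cF F0 dF cG _ _ _] := sol.
have cFC : Cc F.
  split; first exact: cF.
  by exists 1 => x i hx; apply: F0 => /inT_box/(_ i); rewrite leNgt hx.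
have cL := @face_radial_Cc R n Gam F G H j sol.
pose L : 'cV[R]_n -> R := face_radial j G.
pose K (y : 'cV[R]_n) := \sum_i \sum_k glam j i * Gam i k * G k (face_chart j y).
have cK : continuous K.
  move=> y; apply: cont_at_sum => i _; apply: cont_at_sum => k _.
  apply: cont_atM; first exact: cont_at_cst.
  by apply: (@face_chart_continuous R n j (G k)); exact: cG.
have -> : quad Gam j * J (fun y : 'cV[R]_n => face_radial j G y ^+ 2) = - J (fun y => K y * L y).
  rewrite -JZ; last by apply: (Cc_ext _ (CcM cL.1 cL)) => y; rewrite expr2.
  rewrite -mulN1r -JZ; last exact: CcM.
  apply: J_ext => y; rewrite /L /K /face_radial; case: asboolP => [Ty|_]; last by rewrite expr0n !mulr0.
  have hG := face_grad sol Ty (lam_face_chart j y).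
  set r := radial j G _ in hG *.
  rewrite /quad (_ : \sum_i \sum_k glam j i * Gam i k * G k _ =
     - r * \sum_i \sum_k glam j i * Gam i k * glam j k); first by ring.
  rewrite mulr_sumr; apply: eq_bigr => i _; rewrite mulr_sumr; apply: eq_bigr => k _.
  by rewrite hG; ring.
apply/eqP; rewrite -subr_eq0 opprK; apply/eqP.
pose B : 'cV[R]_n -> R := bump 1.
have cKB : Cc (fun y => `|K y| * B y).
  by apply: CcM; [move=> y; apply: cont_at_norm; exact: cK|exact: bump_Cc].
have cNF := Cc_norm cFC.
have cF2 : Cc (fun x => F x ^+ 2) by apply: (Cc_ext _ (CcM cF cFC)) => x; rewrite expr2.
have cLK : Cc (fun y => K y * L y) by exact: CcM.
have JN0 : 0 <= J (fun x => `|F x|) by exact: J_ge0.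
have JKB0 : 0 <= J (fun y => `|K y| * B y).
  by apply: J_ge0 => // y; rewrite mulr_ge0//; have /andP[] := bump_itv 1 y.
have JF20 : 0 <= J (fun x => F x ^+ 2) by apply: J_ge0 => // x; exact: sqr_ge0.
apply: (@absr_le_eps _ _ (2 * J (fun x => `|F x|) + J (fun x => F x ^+ 2) + J (fun y => `|K y| * B y))).
  by rewrite !addr_ge0// mulr_ge0.
move=> e e0.
have [d1 d10 uc] := Cc_unif_cont cFC e0.
(* [d < 1] keeps the dilation ratio positive, [d < e] absorbs the defect [d * A0] of the factor 2,
   and [2 * d < d1] holds the dilated point within the modulus, coordinates moving by at most
   [2 * d]. *)
have s1 : small (fun d : R => d < 1 /\ d < e /\ 2 * d < d1).
  exists (Num.min (Num.min 1 e) (d1 / 2)); first by rewrite !lt_min ltr01 e0 divr_gt0.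
  by move=> d d0; rewrite !lt_min => /andP[/andP[h1 h2]]; rewrite ltr_pdivlMr// mulrC.
have [d d0 [[d1' [de dd]] hd]] := small_ex (small_and s1 (face_radial_approx j sol e0)).
have s0 : 0 < 1 - d by rewrite subr_gt0.
have s1' : 1 - d <= 1 by rewrite gerBl ltW.
have green := green_dilate j sol symG s0 s1'.
pose Fm (x : 'cV[R]_n.+1) := F (dilate j (1 - d) x).
have cFm : continuous Fm by move=> x; apply: dilate_continuous_at; exact: cF.
pose P (y : 'cV[R]_n) := Fm (face_chart j y).
have P0 y : ~ simplex (face_chart j y) -> P y = 0.
  move=> nT; apply: F0 => hT; apply: nT; apply/simplex_lam => l.
  have [->|lj] := eqVneq l j; first by rewrite lam_face_chart.
  by have := hT l; rewrite lam_dilate (negbTE lj) mulr0 addr0 pmulr_rgt0// => /ltW.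
have sb y : simplex (face_chart j y) -> box 1 y.
  by move=> /simplex_box h i; have := h (lift (chart_axis j) i); rewrite face_chart_lift.
have cP : Cc P.
  split; first exact: (@face_chart_continuous R n j Fm).
  exists 1 => y i hy; apply: P0 => /sb/(_ i); by rewrite leNgt hy.
have cPK : Cc (fun y => K y * P y) by exact: CcM.
have cFF : Cc (fun x => F x * Fm x) by apply: (Cc_ext _ (CcM cFm cFC)) => x; rewrite mulrC.
have e1 : `|J (fun x => F x * Fm x) - J (fun x => F x ^+ 2)| <= e * J (fun x => `|F x|).
  rewrite -JB// -JZ//; apply: J_norm_le; [exact: CcB|exact: CcZ|move=> x].
  have [Tx|nT] := pselect (inT x); last first.
    by rewrite F0// mul0r expr0n subrr normr0 mulr0.
  rewrite expr2 -mulrBr normrM mulrC; apply: ler_wpM2r => //.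
  rewrite distrC; apply/ltW/uc => i; apply: le_lt_trans dd.
  rewrite (_ : _ - _ = d * (x i 0 - vertex j i 0)); last by rewrite !mxE; ring.
  rewrite normrM gtr0_norm// mulrC; apply: ler_wpM2r; first exact: ltW.
  apply: le_trans (ler_normB _ _) _.
  have := inT_box Tx i; have := simplex_box (@simplex_vertex R n.+1 j) i; lra.
have e2 : `|J (fun y => K y * P y) - (- d) * J (fun y => K y * L y)| <= d * e * J (fun y => `|K y| * B y).
  rewrite -JZ// -JB//; last exact: CcZ.
  rewrite -JZ//; apply: J_norm_le; [by apply: CcB => //; exact: CcZ|exact: CcZ|move=> y].
  rewrite mulrCA -mulrBr normrM.
  have [Ty|nT] := pselect (simplex (face_chart j y)).
    rewrite /B bump1 ?mulr1; last exact: sb.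
    by rewrite mulrC; apply: ler_wpM2r => //; exact: hd.
  rewrite P0// /L /face_radial asboolF// mulr0 subrr normr0 mulr0.
  rewrite mulr_ge0//; first by rewrite mulr_ge0// ltW.
  by rewrite mulr_ge0//; have /andP[] := bump_itv 1 y.
have green' : ((1 - d) ^+ 2 - 1) * J (fun x => F x * Fm x) + J (fun y => K y * P y) = 0.
  by rewrite -[RHS]green; congr (_ + _); apply: J_ext => y; rewrite mulrC.
set A := J (fun x => F x * Fm x) in e1 green'; set A0 := J (fun x => F x ^+ 2) in e1 JF20 *.
set C := J (fun y => K y * P y) in e2 green'; set C0 := J (fun y => K y * L y) in e2 *.
set NF := J (fun x => `|F x|) in e1 JN0 *; set NK := J _ in e2 JKB0 *.
have dC : C = d * ((2 - d) * A) by move: green'; set s := (1 - d); rewrite (_ : s ^+ 2 - 1 = - (d * (2 - d))); [lra|rewrite /s; ring].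
have e3 : `|(2 - d) * A + C0| <= e * NK.
  rewrite -(ler_pM2l d0) -[X in X * `|_|](gtr0_norm d0) -normrM mulrDr -dC.
  by move: e2; rewrite mulNr opprK mulrA.
rewrite (_ : 2 * A0 + C0 = ((2 - d) * A + C0) - (2 - d) * (A - A0) + d * A0); last by ring.
apply: le_trans (ler_normD _ _) _.
apply: le_trans (lerD (ler_normB _ _) (lexx _)) _.
rewrite (normrM d) (gtr0_norm d0) (ger0_norm JF20).
rewrite (normrM (2 - d)) (@ger0_norm _ (2 - d)); last lra.
have h1 : (2 - d) * `|A - A0| <= 2 * (e * NF) by apply: ler_pM => //; lra.
have h2 : d * A0 <= e * A0 by apply: ler_wpM2r => //; exact: ltW.
rewrite !mulrDr (_ : e * (2 * NF) = 2 * (e * NF)); last by ring.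
lra.
Qed.

(** * Boundary traces of eigenfunctions *)

Lemma within_lim (R : realType) n (A : set 'cV[R]_n) (x : 'cV[R]_n) (g : 'cV[R]_n -> R) (l : R) :
  g y @[y --> within A (nbhs x)] --> l <->
  forall e : R, 0 < e -> exists2 d : R, 0 < d & forall y, A y -> vclose d x y -> `|l - g y| < e.
Proof.
have Ff : Filter (within A (nbhs x)) by exact: within_filter.
split.
  move=> h e e0; have := proj1 (@cvgrPdist_lt R R _ (within A (nbhs x)) Ff g l) h e e0.
  by move=> /nbhs_vclose[d d0 hd]; exists d => // y Ay xy; exact: hd.
move=> h; apply: (proj2 (@cvgrPdist_lt R R _ (within A (nbhs x)) Ff g l)) => e e0.
have [d d0 hd] := h e e0.
by apply/nbhs_vclose; exists d => // y xy Ay; exact: hd.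
Qed.

Lemma near_inT (R : realType) n (x : 'cV[R]_n) (d : R) : 0 < d -> simplex x ->
  exists2 y, inT y & vclose d x y.
Proof.
move=> d0 Tx; have [e e0 he] := vclose_toward d0 Tx.
pose t := Num.min (e / 2) 1.
have t0 : 0 < t by rewrite lt_min divr_gt0//=.
have te : t < e by apply: (@le_lt_trans _ _ (e / 2)); [rewrite ge_min lexx|lra].
exists (toward t x); last exact: he.
by apply: inT_toward => //; rewrite ge_min lexx orbT.
Qed.

Lemma within_interior_proper (R : realType) n (x : 'cV[R]_n.+1) : simplex x ->
  ProperFilter (within (@simplex R n.+1)° (nbhs x)).
Proof.
move=> Tx; apply: within_nbhs_proper => B /nbhs_vclose[d d0 hd].
have [y Ty xy] := near_inT d0 Tx.
by exists y; split; [apply/interior_simplex|exact: hd].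
Qed.

Lemma interior_lim (R : realType) n (x : 'cV[R]_n.+1) (g : 'cV[R]_n.+1 -> R) (l : R) :
  simplex x -> g y @[y --> within (@simplex R n.+1)° (nbhs x)] --> l ->
  lim (g y @[y --> within (@simplex R n.+1)° (nbhs x)]) = l.
Proof.
move=> Tx h; have pf := within_interior_proper Tx.
exact: (@cvg_lim R (@Rhausdorff R) _ _ pf).
Qed.

(** The trace is taken at [retract x], so that one function serves as gradient inside, as boundary
    value, and as the global continuous extension required by [sol_cgrad]. *)
Definition trace_ext {R : realType} {n} (g : 'cV[R]_n -> R) (x : 'cV[R]_n) : R :=
  lim (g y @[y --> within (@simplex R n)° (nbhs (retract x))]).

Lemma trace_extP (R : realType) n (g : 'cV[R]_n.+1 -> R) :
  (forall x, simplex x -> cvg (g y @[y --> within (@simplex R n.+1)° (nbhs x)])) ->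
  [/\ continuous (trace_ext g), forall x, inT x -> trace_ext g x = g x &
      forall x, simplex x -> g y @[y --> within (@simplex R n.+1)° (nbhs x)] --> trace_ext g x].
Proof.
move=> h; pose L (x : 'cV[R]_n.+1) := lim (g y @[y --> within (@simplex R n.+1)° (nbhs x)]).
have hL x : simplex x -> forall e : R, 0 < e -> exists2 d : R, 0 < d &
    forall y, inT y -> vclose d x y -> `|L x - g y| < e.
  move=> Tx e e0; have := proj1 (within_lim _ _ _ _) (h x Tx) e e0.
  by move=> [d d0 hd]; exists d => // y /interior_simplex; exact: hd.
have LE x : simplex x -> trace_ext g x = L x by move=> Tx; rewrite /trace_ext retract_id.
split.
- apply: (@retract_continuous R n.+1 L) => x Tx e e0.
  have e2 : 0 < e / 2 by rewrite divr_gt0.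
  have [d d0 hd] := hL x Tx _ e2.
  exists (d / 2); first by rewrite divr_gt0.
  move=> x' Tx' xx'; have [d' d'0 hd'] := hL x' Tx' _ e2.
  have d20 : 0 < Num.min (d / 2) d' by rewrite lt_min divr_gt0.
  (* The limits at two nearby points of the closed simplex are compared through one interior point
     close to both. *)
  have [y Ty xy] := near_inT d20 Tx'.
  have h1 : vclose d x y.
    move=> i; have := xx' i; have := xy i; rewrite lt_min => /andP[k1 _] k2.
    by have := ler_distD (x' i 0) (x i 0) (y i 0); lra.
  have h2 : vclose d' x' y by apply: vclose_le xy; rewrite ge_min lexx orbT.
  have := hd y Ty h1; have := hd' y Ty h2; have := ler_distD (g y) (L x) (L x').
  by rewrite (distrC (g y)); lra.
- move=> x Tx; rewrite LE; last exact: inT_simplex.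
  apply/eqP; rewrite -subr_eq0; apply/eqP; apply: (@absr_le_eps _ _ 1) => // e e0.
  have [d d0 hd] := hL x (inT_simplex Tx) e e0.
  by rewrite mulr1; apply/ltW/hd => //; exact: vclose_refl.
- move=> x Tx; rewrite LE//; apply/within_lim => e e0.
  have [d d0 hd] := hL x Tx e e0.
  by exists d => // y /interior_simplex; exact: hd.
Qed.

(** Clipping leaves a zero coordinate and rescaling leaves the sum equal to 1, so points off the
    simplex retract to its boundary. Hence [zero_ext f] is unchanged by composition with
    [retract]. *)
Lemma inT_retract (R : realType) n (x : 'cV[R]_n) : inT (retract x) -> simplex x.
Proof.
move=> h; pose m := Num.max 1 (\sum_k Num.max (x k 0) 0).
have m0 : 0 < m by rewrite lt_max ltr01.
have xp i : 0 < x i 0.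
  by have := h (Some i); rewrite /= mxE pmulr_lgt0 ?invr_gt0// lt_max ltxx orbF.
apply/simplex_lam => -[k|] /=; first exact: ltW.
have := h None; rewrite /= (eq_bigr (fun i => Num.max (x i 0) 0 / m)); last by move=> i _; rewrite mxE.
rewrite -mulr_suml subr_gt0 ltr_pdivrMr// mul1r /m lt_max ltxx orbF => S1.
rewrite subr_ge0 ltW// (le_lt_trans _ S1)//.
by apply: ler_sum => i _; rewrite le_max lexx.
Qed.

Definition zero_ext {R : realType} {n} (f : 'cV[R]_n -> R) (x : 'cV[R]_n) : R :=
  if `[< inT x >] then f x else 0.

Lemma zero_ext_continuous (R : realType) n (f : 'cV[R]_n -> R) :
  {within (@simplex R n), continuous f} -> (forall x, simplex x -> ~ inT x -> f x = 0) ->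
  continuous (zero_ext f).
Proof.
move=> cf f0.
have fE x : simplex x -> zero_ext f x = f x.
  by move=> Tx; rewrite /zero_ext; case: asboolP => // nT; rewrite f0.
have -> : zero_ext f = (fun x => zero_ext f (retract x)).
  apply/funext => x; have [Tx|nT] := pselect (simplex x); first by rewrite retract_id.
  rewrite /zero_ext asboolF; last by move=> /inT_simplex.
  by rewrite asboolF// => /inT_retract.
apply: retract_continuous => x Tx e e0.
have /within_lim/(_ e e0)[d d0 hd] := proj1 (subspace_continuousP _ _) cf x Tx.
by exists d => // y Ty xy; rewrite !fE//; exact: hd.
Qed.

Lemma regular_dirichlet (R : realType) n (Gam : 'M[R]_n.+1) (f : 'cV[R]_n.+1 -> R) :
  regular f -> (forall x, simplex x -> ~ inT x -> f x = 0) ->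
  (forall x, inT x -> \sum_i \sum_k Gam i k * 'D_(basis_vec i) ('D_(basis_vec k) f) x = - f x) ->
  dirichlet_solution Gam (zero_ext f) (fun i => trace_ext ('D_(basis_vec i) f))
    (fun i k => 'D_(basis_vec i) ('D_(basis_vec k) f)).
Proof.
move=> [cf df ddf lf] f0 eqf.
have ext i := trace_extP (lf i).
split.
- exact: zero_ext_continuous.
- by move=> x nT; rewrite /zero_ext asboolF.
- move=> i x Tx; apply: (@is_derive_near _ _ f).
    by apply: nearvS (nearv_inT Tx) => y Ty; rewrite /zero_ext asboolT.
  have [_ gE _] := ext i; rewrite gE//; apply: DeriveDef => //.
  by have [] := df i x (proj2 (interior_simplex x) Tx).
- by move=> i; have [] := ext i.
- move=> i k x Tx; apply: (@is_derive_near _ _ ('D_(basis_vec k) f)).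
    by apply: nearvS (nearv_inT Tx) => y Ty; have [_ gE _] := ext k; rewrite gE.
  apply: DeriveDef => //.
  by have [] := ddf k i x (proj2 (interior_simplex x) Tx).
- by move=> i k x Tx; have [_] := ddf k i x (proj2 (interior_simplex x) Tx).
- by move=> x Tx; rewrite eqf// /zero_ext asboolT.
Qed.

Lemma Re_sum (R : rcfType) (I : Type) (r : seq I) (f : I -> R[i]) :
  complex.Re (\sum_(i <- r) f i) = \sum_(i <- r) complex.Re (f i).
Proof. by elim/big_rec2: _ => // i y z _ <-; case: (f i) z => [a b] []. Qed.

Lemma Im_sum (R : rcfType) (I : Type) (r : seq I) (f : I -> R[i]) :
  complex.Im (\sum_(i <- r) f i) = \sum_(i <- r) complex.Im (f i).
Proof. by elim/big_rec2: _ => // i y z _ <-; case: (f i) z => [a b] []. Qed.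

Lemma Re_semiclassical_op (R : realType) n (h : R) (Gam : 'M[R]_n) (u : 'cV[R]_n -> R[i]) x :
  complex.Re (semiclassical_op h Gam u x) = - \sum_i \sum_k
    Gam i k * (h * 'D_(basis_vec i) (fun y => h * 'D_(basis_vec k) (fun z => complex.Re (u z)) y) x).
Proof.
rewrite /semiclassical_op; set S := \sum_i _; transitivity (- complex.Re S); first by case: S.
rewrite Re_sum; congr (- _); apply: eq_bigr => i _; rewrite Re_sum; apply: eq_bigr => k _ /=.
by rewrite mul0r subr0.
Qed.

Lemma Im_semiclassical_op (R : realType) n (h : R) (Gam : 'M[R]_n) (u : 'cV[R]_n -> R[i]) x :
  complex.Im (semiclassical_op h Gam u x) = - \sum_i \sum_k
    Gam i k * (h * 'D_(basis_vec i) (fun y => h * 'D_(basis_vec k) (fun z => complex.Im (u z)) y) x).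
Proof.
rewrite /semiclassical_op; set S := \sum_i _; transitivity (- complex.Im S); first by case: S.
rewrite Im_sum; congr (- _); apply: eq_bigr => i _; rewrite Im_sum; apply: eq_bigr => k _ /=.
by rewrite mul0r addr0.
Qed.

Lemma regular_scaled_hessian (R : realType) n (h : R) (Gam : 'M[R]_n.+1) (f : 'cV[R]_n.+1 -> R) x :
  regular f -> inT x ->
  \sum_i \sum_k Gam i k * (h * 'D_(basis_vec i) (fun y => h * 'D_(basis_vec k) f y) x) =
  \sum_i \sum_k (h ^+ 2 *: Gam) i k * 'D_(basis_vec i) ('D_(basis_vec k) f) x.
Proof.
move=> [_ _ ddf _] Tx; apply: eq_bigr => i _; apply: eq_bigr => k _.
have [dk _] := ddf k i x (proj2 (interior_simplex x) Tx).
have := is_derive_cmul h (DeriveDef dk erefl) => /(@derive_val _ _ _ _ _ _ _) ->.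
by rewrite mxE; ring.
Qed.

(** The coefficients are real, so real and imaginary parts solve the problem separately; the
    semiclassical parameter is absorbed into the matrix. *)
Lemma eigen_dirichlet (R : realType) n (h : R) (Gam : 'M[R]_n.+1) (u : 'cV[R]_n.+1 -> R[i]) :
  eigenfunction h Gam u ->
  (dirichlet_solution (h ^+ 2 *: Gam) (zero_ext (fun x => complex.Re (u x)))
    (fun i => trace_ext ('D_(basis_vec i) (fun x => complex.Re (u x))))
    (fun i k => 'D_(basis_vec i) ('D_(basis_vec k) (fun x => complex.Re (u x))))) *
  (dirichlet_solution (h ^+ 2 *: Gam) (zero_ext (fun x => complex.Im (u x)))
    (fun i => trace_ext ('D_(basis_vec i) (fun x => complex.Im (u x))))
    (fun i k => 'D_(basis_vec i) ('D_(basis_vec k) (fun x => complex.Im (u x))))).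
Proof.
move=> [rRe rIm eq bdry _]; split; apply: regular_dirichlet => //.
- by move=> x Tx nT; rewrite bdry//; split => // /interior_simplex.
- move=> x Tx; have := Re_semiclassical_op h Gam u x.
  rewrite (eq x (proj2 (interior_simplex x) Tx)) => ->; rewrite opprK.
  exact/esym/(regular_scaled_hessian h Gam rRe Tx).
- by move=> x Tx nT; rewrite bdry//; split => // /interior_simplex.
- move=> x Tx; have := Im_semiclassical_op h Gam u x.
  rewrite (eq x (proj2 (interior_simplex x) Tx)) => ->; rewrite opprK.
  exact/esym/(regular_scaled_hessian h Gam rIm Tx).
Qed.

(* [glam j] is the inward normal of length [sqrt (glam_sq j)]. *)
Definition glam_sq {R : realType} {n} (j : option 'I_n) : R := if j is Some _ then 1 else n%:R.

Lemma normal_glam (R : realType) n (j : option 'I_n.+1) (i : 'I_n.+1) :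
  (normal j : 'cV[R]_n.+1) i 0 = - (Num.sqrt (glam_sq j))^-1 * glam j i.
Proof.
case: j => [k|] /=; first by rewrite sqrtr1 invr1 !mxE andbT mulN1r.
by rewrite !mxE mulr1 mulrNN mulr1.
Qed.

Lemma glam_sqE (R : realType) n (j : option 'I_n) : \sum_i (glam j i : R) ^+ 2 = glam_sq j.
Proof.
case: j => [k|] /=.
  rewrite (bigD1 k)//= eqxx expr1n big1 ?addr0// => i ik.
  by rewrite (negbTE ik) expr0n.
by rewrite (eq_bigr (fun=> 1)) ?sumr_const ?card_ord// => i _; rewrite sqrrN expr1n.
Qed.

Lemma glam_sq_gt0 (R : realType) n (j : option 'I_n.+1) : 0 < (glam_sq j : R).
Proof. by case: j => [k|] /=; rewrite ?ltr01// ltr0Sn. Qed.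

(** On the face the gradient is [- radial * glam] and the unit outward normal is [glam] divided by
    [- Num.sqrt (glam_sq j)]; their product is [Num.sqrt (glam_sq j)] times the radial
    derivative. *)
Lemma neumann_radial (R : realType) n (Gam : 'M[R]_n.+1) (h : R) (f : 'cV[R]_n.+1 -> R) H
    (j : option 'I_n.+1) (x : 'cV[R]_n.+1) :
  dirichlet_solution Gam (zero_ext f) (fun i => trace_ext ('D_(basis_vec i) f)) H ->
  simplex x -> lam j x = 0 ->
  lim (h * 'D_(normal j) f y @[y --> within (@simplex R n.+1)° (nbhs x)]) ^+ 2 =
  h ^+ 2 * glam_sq j * radial j (fun i => trace_ext ('D_(basis_vec i) f)) x ^+ 2.
Proof.
move=> sol Tx lx; set G := (fun i => _) in sol *.
have [_ _ dF cG _ _ _] := sol.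
pose S y := h * \sum_i (normal j : 'cV[R]_n.+1) i 0 * G i y.
have -> : lim (h * 'D_(normal j) f y @[y --> within (@simplex R n.+1)° (nbhs x)]) = S x.
  apply: interior_lim => //; apply/within_lim => e e0.
  have cS : {for x, continuous S}.
    apply: cont_atM; first exact: cont_at_cst.
    by apply: cont_at_sum => i _; apply: cont_atM; [exact: cont_at_cst|exact: cG].
  have [d d0 hd] := proj1 (cvg_vclose S x) cS e e0.
  exists d => // y /interior_simplex Ty /hd; congr (`| _ - _ | < _); rewrite /S; congr (_ * _).
  have dFy := is_derive_dir cG dF (normal j) Ty.
  have dfy : is_derive y (normal j) f (\sum_i (normal j : 'cV[R]_n.+1) i 0 * G i y).
    apply: is_derive_near dFy.
    by apply: nearvS (nearv_inT Ty) => z Tz; rewrite /zero_ext asboolT.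
  by rewrite (@derive_val _ _ _ _ _ _ _ dfy).
have hG := face_grad sol Tx lx.
have -> : S x = h * ((Num.sqrt (glam_sq j))^-1 * radial j G x * \sum_i glam j i ^+ 2).
  rewrite /S; congr (_ * _); rewrite mulr_sumr; apply: eq_bigr => i _.
  by rewrite normal_glam hG; ring.
rewrite glam_sqE !exprMn exprVn sqr_sqrtr ?ltW ?glam_sq_gt0//.
by field; rewrite gt_eqF ?glam_sq_gt0.
Qed.

Lemma face_chartP (R : realType) n (j : option 'I_n.+1) (y : 'cV[R]_n) :
  face j (face_chart j y) <-> simplex (face_chart j y).
Proof.
have := lam_face_chart j y; case: j => [k|] /=; split => [[]//|Ts]; split => //.
by move: H => /eqP; rewrite subr_eq0 => /eqP /esym.
Qed.

Lemma sqnorm_quad (R : realType) n (B : 'M[R]_n.+1) (j : option 'I_n.+1) :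
  quad (B *m B^T) j = glam_sq j * sqnorm (B^T *m normal j).
Proof.
pose q := Num.sqrt (glam_sq j : R).
have q0 : q != 0 by rewrite gt_eqF// sqrtr_gt0 glam_sq_gt0.
have q2 : q ^+ 2 = glam_sq j by rewrite sqr_sqrtr// ltW// glam_sq_gt0.
pose w l := \sum_i B i l * glam j i.
have sE l : (B^T *m normal j) l 0 = - q^-1 * w l.
  rewrite mxE /w mulr_sumr; apply: eq_bigr => i _; rewrite normal_glam mxE -/q; ring.
transitivity (\sum_l w l ^+ 2); last first.
  rewrite /sqnorm mulr_sumr; apply: eq_bigr => l _; rewrite sE exprMn sqrrN exprVn -q2.
  by rewrite mulrA divff ?mul1r// expf_neq0.
rewrite /quad.
transitivity (\sum_i \sum_k \sum_l (B i l * glam j i) * (B k l * glam j k)).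
  apply: eq_bigr => i _; apply: eq_bigr => k _; rewrite mxE mulr_sumr mulr_suml.
  by apply: eq_bigr => l _; rewrite mxE; ring.
rewrite (eq_bigr (fun i => \sum_l (B i l * glam j i) * w l)); last first.
  by move=> i _; rewrite exchange_big; apply: eq_bigr => l _; rewrite mulr_sumr.
by rewrite exchange_big; apply: eq_bigr => l _; rewrite -mulr_suml expr2.
Qed.

Lemma solution_sq_Cc (R : realType) n (Gam : 'M[R]_n) F G H :
  dirichlet_solution Gam F G H -> Cc (fun x => F x ^+ 2).
Proof.
move=> [cF F0 _ _ _ _ _]; split; first by move=> x; apply: cont_atM; exact: cF.
by exists 1 => x i hx; rewrite F0 ?expr0n// => /inT_box/(_ i); rewrite leNgt hx.
Qed.

Lemma face_radial_sq_Cc (R : realType) n (Gam : 'M[R]_n.+1) F G H (j : option 'I_n.+1) :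
  dirichlet_solution Gam F G H -> Cc (fun y : 'cV[R]_n => face_radial j G y ^+ 2).
Proof.
move=> /(@face_radial_Cc R n Gam F G H j) cL.
by apply: (Cc_ext _ (CcM cL.1 cL)) => y; rewrite expr2.
Qed.

Lemma rellich_pair (R : realType) n (Gam : 'M[R]_n.+1) F1 G1 H1 F2 G2 H2 (j : option 'I_n.+1) :
  dirichlet_solution Gam F1 G1 H1 -> dirichlet_solution Gam F2 G2 H2 -> Gam^T = Gam ->
  J (fun x => F1 x ^+ 2 + F2 x ^+ 2) = 1 ->
  quad Gam j * J (fun y : 'cV[R]_n => face_radial j G1 y ^+ 2 + face_radial j G2 y ^+ 2) = 2.
Proof.
move=> s1 s2 symG; have e1 := rellich_aux j s1 symG; have e2 := rellich_aux j s2 symG.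
rewrite JD; [|exact: solution_sq_Cc s1|exact: solution_sq_Cc s2].
rewrite JD; [|exact: face_radial_sq_Cc s1|exact: face_radial_sq_Cc s2].
by rewrite mulrDr -e1 -e2 -mulrDr => ->; rewrite mulr1.
Qed.

(** [h ^+ 2] enters once through the scaled matrix in the Rellich identity and once through the
    semiclassical derivative, and cancels, as does [glam_sq j]. The value therefore depends on
    neither [h] nor the choice of eigenfunction. *)
Theorem neumann_sqnormE (R : realType) n (h : R) (B : 'M[R]_n.+1) (u : 'cV[R]_n.+1 -> R[i])
    (j : option 'I_n.+1) :
  eigenfunction h (B *m B^T) u ->
  sqnorm (B^T *m normal j) != 0 /\
  neumann_sqnorm h u j = (2 * face_density j / sqnorm (B^T *m normal j))%:E.
Proof.
move=> eig; have [sRe sIm] := eigen_dirichlet eig.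
set GR := (fun i => trace_ext _) in sRe; set GI := (fun i => trace_ext _) in sIm.
set FR := zero_ext _ in sRe; set FI := zero_ext _ in sIm.
have symG : (h ^+ 2 *: (B *m B^T))^T = h ^+ 2 *: (B *m B^T).
  by rewrite linearZ /= trmx_mul trmxK.
have norm1 : J (fun x => FR x ^+ 2 + FI x ^+ 2) = 1.
  have := eigen_norm eig; rewrite /set_integral.
  rewrite (_ : (fun x => _) = (fun x => (FR x ^+ 2 + FI x ^+ 2)%:E)); last first.
    apply/funext => x; congr (_%:E); rewrite /FR /FI /zero_ext indicE.
    have [Tx|nT] := pselect (inT x).
      by rewrite !asboolT// mem_set ?mul1r//; exact: inT_simplex.
    rewrite !asboolF// !expr0n addr0.
    have [Sx|nS] := pselect (simplex x); last by rewrite memNset// mul0r.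
    rewrite (eigen_bdry eig) /sqmod /= ?expr0n ?addr0 ?mulr0//.
    by split => // /interior_simplex.
  rewrite J_EFin; first by move=> [].
  exact: (CcD (solution_sq_Cc sRe) (solution_sq_Cc sIm)).
have := rellich_pair j sRe sIm symG norm1.
set m := J _; set S := sqnorm _.
have -> : quad (h ^+ 2 *: (B *m B^T)) j = h ^+ 2 * (glam_sq j * S).
  rewrite -sqnorm_quad /quad mulr_sumr; apply: eq_bigr => i _; rewrite mulr_sumr.
  by apply: eq_bigr => k _; rewrite mxE; ring.
move=> main.
(* If [S] were 0, the identity [main] would read [0 = 2]. *)
have S0 : S != 0.
  by apply/eqP => S0; move: main; rewrite S0 !mulr0 mul0r => /eqP; rewrite eq_sym pnatr_eq0.
split => //; rewrite /neumann_sqnorm /face_integral.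
pose c := h ^+ 2 * glam_sq j * face_density j.
rewrite (_ : (fun y => _) =
    (fun y : 'cV[R]_n => (c * (face_radial j GR y ^+ 2 + face_radial j GI y ^+ 2))%:E)); last first.
  apply/funext => y; congr (_%:E); rewrite /face_radial indicE.
  have [Tx|nT] := pselect (simplex (face_chart j y)); last first.
    rewrite !asboolF// memNset; last by move=> /face_chartP.
    by rewrite !mul0r expr0n addr0 mulr0.
  rewrite !asboolT// mem_set; last exact/face_chartP.
  rewrite mul1r /sqmod /neumann_data /interior_trace /hderiv /=.
  have l0 := lam_face_chart j y.
  rewrite (neumann_radial h sRe Tx l0) (neumann_radial h sIm Tx l0) /c -/GR -/GI.
  by move: (radial j GR _) (radial j GI _) => r1 r2; ring.
have cS := CcD (face_radial_sq_Cc j sRe) (face_radial_sq_Cc j sIm).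
rewrite (J_EFin (CcZ c cS)) (JZ c cS) -/m; congr (_%:E).
rewrite /c; move: main; clear -S0; move: m => m main.
have hg : h ^+ 2 * glam_sq j * m = 2 / S by rewrite -main; field.
by rewrite mulrAC hg mulrAC.
Qed.

(** * Explicit eigenfunctions on alcoves *)

(* Chebyshev polynomials of the second kind. *)
Fixpoint cheb2 {R : realType} (k : nat) : {poly R} * {poly R} :=
  if k is k'.+1 then let: (p, q) := cheb2 k' in (q, 2 *: 'X * q - p) else (1, 2 *: 'X).

Definition cheb {R : realType} (k : nat) : {poly R} := (cheb2 k).1.

Lemma cheb0 (R : realType) : cheb 0 = 1 :> {poly R}. Proof. by []. Qed.

Lemma cheb1 (R : realType) : cheb 1 = 2 *: 'X :> {poly R}. Proof. by []. Qed.

Lemma chebS (R : realType) k : cheb k.+2 = 2 *: 'X * cheb k.+1 - cheb k :> {poly R}.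
Proof. by rewrite /cheb /=; case: (cheb2 k). Qed.

Lemma pair_ind (P : nat -> Prop) : P 0 -> P 1%N -> (forall k, P k -> P k.+1 -> P k.+2) ->
  forall k, P k.
Proof.
move=> h0 h1 hS k; suff [] : P k /\ P k.+1 by [].
by elim: k => [|k [h h']]; split=> //; exact: hS.
Qed.

Lemma cheb_size (R : realType) k : size (cheb k : {poly R}) = k.+1.
Proof.
have n2 : (2 : R) != 0 by rewrite pnatr_eq0.
elim/pair_ind: k => [||k h1 h2]; first by rewrite cheb0 size_poly1.
  by rewrite cheb1 size_scale// size_polyX.
have s2 : size (2 *: 'X * cheb k.+1 : {poly R}) = k.+3.
  by rewrite -scalerAl size_scale// mulrC size_mulX ?h2// -size_poly_eq0 h2.
by rewrite chebS size_polyDl s2// size_polyN h1.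
Qed.

Lemma cheb_sin (R : realType) k (t : R) : sin (k.+1%:R * t) = sin t * (cheb k).[cos t].
Proof.
elim/pair_ind: k => [||k h1 h2].
- by rewrite cheb0 hornerC mulr1 mul1r.
- rewrite cheb1 hornerZ hornerX mulr_natl mulr2n sinD; ring.
- rewrite chebS hornerD hornerN -scalerAl hornerZ hornerM hornerX.
  rewrite mulrBr -h1 (_ : sin t * _ = 2 * cos t * (sin t * (cheb k.+1).[cos t])); last by ring.
  rewrite -h2 -[in LHS]natr1 mulrDl mul1r sinD.
  have -> : k.+1%:R * t = k.+2%:R * t - t by rewrite -[in RHS]natr1; ring.
  by rewrite sinB; ring.
Qed.

(** Since [sin ((j + 1) t)] is [sin t] times a polynomial of degree [j] in [cos t], the matrix
    factors into a diagonal matrix of sines, a transposed Vandermonde matrix in the cosines and a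
    triangular matrix of Chebyshev coefficients. All three are nonsingular: the sine is positive and
    the cosine injective on the open interval up to [pi], and the leading coefficients are
    nonzero. *)
Lemma det_sin_neq0 (R : realType) n (th : 'I_n -> R) :
  (forall k, 0 < th k < pi) -> injective th ->
  \det (\matrix_(k < n, j < n) sin (j.+1%:R * th k)) != 0.
Proof.
move=> th0 inj.
pose c : 'rV[R]_n := \row_k cos (th k).
pose C : 'M[R]_n := \matrix_(j, i) (cheb j)`_i.
have -> : \matrix_(k < n, j < n) sin (j.+1%:R * th k) =
   diag_mx (\row_k sin (th k)) *m (Vandermonde n c)^T *m C^T.
  apply/matrixP => k j; rewrite mxE cheb_sin mul_diag_mx !mxE.
  rewrite (horner_coef_wide _ (_ : size (cheb j) <= n)%N); last by rewrite cheb_size.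
  by rewrite mulr_sumr; apply: eq_bigr => i _; rewrite !mxE; ring.
rewrite !det_mulmx !det_tr det_diag det_Vandermonde det_trig; last first.
  apply/is_trig_mxP => i j ij; rewrite mxE nth_default// cheb_size//.
rewrite !mulf_neq0//.
- apply/prodf_neq0 => k _; rewrite mxE gt_eqF// sin_gt0_pi//.
- apply/prodf_neq0 => i _; apply/prodf_neq0 => j ij; rewrite !mxE subr_eq0.
  apply/eqP => h; have : th j = th i.
    apply: cos_inj => //; rewrite in_itv /=.
      by have /andP[h1 h2] := th0 j; rewrite !ltW.
    by have /andP[h1 h2] := th0 i; rewrite !ltW.
  by move=> /inj ji; move: ij; rewrite ji ltnn.
- apply/prodf_neq0 => i _; rewrite mxE.
  by have := cheb_size R i; rewrite -[X in _`_X]/(i.+1.-1) => <-; rewrite lead_coef_eq0 -size_poly_eq0 cheb_size.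
Qed.

(** * Sine waves in the partial-sum coordinates *)

Definition partial_sum {R : realType} {n} (s : 'S_n) (k : 'I_n) (x : 'cV[R]_n) : R :=
  \sum_(i < n | (i <= k)%N) x (s i) 0.

Definition partial_mx {R : realType} {n} (s : 'S_n) : 'M[R]_n :=
  \matrix_(k, i) ((s^-1)%g i <= k)%N%:R.

Lemma partial_sumE (R : realType) n (s : 'S_n) (k : 'I_n) (x : 'cV[R]_n) :
  partial_sum s k x = \sum_i partial_mx s k i * x i 0.
Proof.
rewrite [RHS](reindex_inj (@perm_inj _ s)) /partial_sum big_mkcond /=.
by apply: eq_bigr => i _; rewrite mxE permK; case: ifP => _; rewrite ?mul1r ?mul0r.
Qed.

(** The entries of the inverse of the lower triangular matrix of ones, that is, of the backward
    difference. *)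
Definition bidiag {R : realType} (i l : nat) : R := (i == l)%:R - (i == l.+1)%:R.

(* In the coordinates [partial_sum s k] the operator with symbol
   [alcove_mx s *m (alcove_mx s)^T] is the Laplacian. *)
Definition alcove_mx {R : realType} {n} (s : 'S_n) : 'M[R]_n :=
  \matrix_(i, l) bidiag ((s^-1)%g i) l.

Lemma sum_eq_ord (R : realType) n (P : pred nat) (l : nat) :
  \sum_(i < n | P i) ((i : nat) == l)%:R = ((l < n)%N && P l)%:R :> R.
Proof.
have [ln|ln] := ltnP l n.
  rewrite big_mkcond (bigD1 (Ordinal ln))//= eqxx big1 ?addr0; first by case: (P l).
  by move=> i il; rewrite (_ : (i : nat) == l = false) ?if_same//; apply/negbTE; rewrite -(inj_eq val_inj) in il.
rewrite big1// => i _; rewrite (_ : (i : nat) == l = false)//; apply/eqP => il.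
by have := ltn_ord i; rewrite il ltnNge ln.
Qed.

Lemma partial_alcove (R : realType) n (s : 'S_n) : partial_mx s *m alcove_mx s = 1%:M :> 'M[R]_n.
Proof.
apply/matrixP => k l; rewrite !mxE (reindex_inj (@perm_inj _ s)) /=.
rewrite (eq_bigr (fun i : 'I_n => if (i <= k)%N then bidiag i l else 0)); last first.
  by move=> i _; rewrite !mxE !permK; case: (i <= k)%N; rewrite ?mul1r ?mul0r.
rewrite -big_mkcond sumrB /= (sum_eq_ord R n (fun i => i <= k)%N l) (sum_eq_ord R n (fun i => i <= k)%N l.+1).
rewrite ltn_ord /=; have kn := ltn_ord k.
(* In the last column [l.+1] is out of range, but then [l < k] fails as well. *)
rewrite (_ : (l.+1 < n)%N && (l < k)%N = (l < k)%N); last first.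
  by case lk: (l < k)%N; rewrite ?andbF// andbT (leq_ltn_trans lk kn).
by rewrite -(inj_eq val_inj) /=; case: (ltngtP l k) => _; rewrite ?subrr ?subr0.
Qed.

Lemma alcove_unit (R : realType) n (s : 'S_n) : alcove_mx s \in @unitmx R n.
Proof. by have /mulmx1_unit[] := @partial_alcove R n s. Qed.

(** A product of sines in the partial sums with [al k] derivatives already taken in the [k]-th one.
    A derivative multiplies by the frequency and shifts the phase by [pi / 2], so the family is
    closed under differentiation. *)
Definition wave {R : realType} {n} (s : 'S_n) (m : 'I_n -> R) (al : 'I_n -> nat)
    (x : 'cV[R]_n) : R :=
  \prod_k (m k ^+ al k * sin (m k * partial_sum s k x + (al k)%:R * (pi / 2))).

Lemma is_derive_linear_form (R : realType) (V : normedModType R) (l : V -> R) (g : R -> R)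
    (x v : V) (b g' : R) : (forall t : R, l (t *: v + x) = t * b + l x) ->
  is_derive (l x) (1 : R) g g' -> is_derive x v (fun y => g (l y)) (b * g').
Proof.
move=> hl /(is_derive_scale b)/is_deriveP h; apply/is_deriveP => e e0.
have [d d0 hd] := h e e0; exists d => // t t0 td; have := hd t t0 td.
by rewrite hl [b *: 1]mulr1.
Qed.

Lemma partial_sum_lin (R : realType) n (s : 'S_n) (k i : 'I_n) (t : R) (x : 'cV[R]_n) :
  partial_sum s k (t *: basis_vec i + x) = t * partial_mx s k i + partial_sum s k x.
Proof.
rewrite !partial_sumE (eq_bigr (fun j => t * (partial_mx s k j * (basis_vec i : 'cV[R]_n) j 0) + partial_mx s k j * x j 0)); last first.
  by move=> j _; rewrite !mxE; ring.
rewrite big_split /= -mulr_sumr; congr (_ * _ + _).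
rewrite (bigD1 i)//= [basis_vec i i 0]mxE !eqxx mulr1 big1 ?addr0// => j ji.
by rewrite [basis_vec i j 0]mxE (negbTE ji) mulr0.
Qed.

Lemma sin_wave_derive (R : realType) (m : R) (a : nat) (y : R) :
  is_derive y (1 : R) (fun y => m ^+ a * sin (m * y + a%:R * (pi / 2)))
    (m ^+ a.+1 * sin (m * y + a.+1%:R * (pi / 2))).
Proof.
rewrite (_ : m * y + a.+1%:R * (pi / 2) = m * y + a%:R * (pi / 2) + pi / 2); last first.
  by rewrite -natr1; ring.
rewrite sinDpihalf exprSr -mulrA.
apply: is_derive_cmul.
apply: (@is_derive_linear_form R R (fun y : R => m * y + a%:R * (pi / 2)) (@sin R) y 1 m).
  by move=> t; rewrite [t *: 1]mulr1 mulrDr addrA mulrC.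
Qed.

Lemma wave_derive (R : realType) n (s : 'S_n) (m : 'I_n -> R) (al : 'I_n -> nat) (i : 'I_n)
    (x : 'cV[R]_n) :
  is_derive x (basis_vec i) (wave s m al)
    (\sum_l partial_mx s l i * wave s m (fun k => (al k + (k == l))%N) x).
Proof.
pose f k (y : 'cV[R]_n) := m k ^+ al k * sin (m k * partial_sum s k y + (al k)%:R * (pi / 2)).
pose f' k := m k ^+ (al k).+1 * sin (m k * partial_sum s k x + (al k).+1%:R * (pi / 2)).
have df k : is_derive x (basis_vec i) (f k) (partial_mx s k i * f' k).
  apply: (@is_derive_linear_form R _ (partial_sum s k)
    (fun y => m k ^+ al k * sin (m k * y + (al k)%:R * (pi / 2)))).
    by move=> t; rewrite partial_sum_lin.
  exact: sin_wave_derive.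
have := is_derive_prod df.
rewrite (_ : \sum_k _ = \sum_l partial_mx s l i * wave s m (fun k => (al k + (k == l))%N) x)//.
apply: eq_bigr => l _; rewrite -mulrA; congr (_ * _); rewrite /wave [in RHS](bigD1 l)//= eqxx addn1.
congr (_ * _); apply: eq_bigr => k kl; by rewrite (negbTE kl) addn0.
Qed.

Lemma wave_continuous (R : realType) n (s : 'S_n) (m : 'I_n -> R) (al : 'I_n -> nat) :
  continuous (wave s m al).
Proof.
move=> x; apply: cont_at_prod => k _; apply: cont_atM; first exact: cont_at_cst.
apply: (@cont_at_comp1 _ _ (fun y => m k * partial_sum s k y + (al k)%:R * (pi / 2)) sin); last exact: continuous_sin.
apply: cont_atD; last exact: cont_at_cst.
apply: cont_atM; first exact: cont_at_cst.
by apply: cont_at_sum => l _; exact: vdist_continuous.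
Qed.

Lemma wave2 (R : realType) n (s : 'S_n) (m : 'I_n -> R) (l : 'I_n) (x : 'cV[R]_n) :
  wave s m (fun k => (0 + (k == l) + (k == l))%N) x = - m l ^+ 2 * wave s m (fun=> 0%N) x.
Proof.
rewrite /wave (bigD1 l)//= [in RHS](bigD1 l)//= eqxx [RHS]mulrA; congr (_ * _).
  rewrite (_ : (0 + true + true)%:R * (pi / 2) = pi); last by rewrite -[LHS]/(2 * (pi / 2)); field.
  by rewrite sinDpi expr0 mul1r mul0r addr0 mulrN mulNr.
by apply: eq_bigr => k kl; rewrite (negbTE kl).
Qed.

Lemma wave_eigen (R : realType) n (s : 'S_n) (m : 'I_n -> R) (x : 'cV[R]_n) :
  \sum_i \sum_j (alcove_mx s *m (alcove_mx s)^T) i j *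
    (\sum_l partial_mx s l j * \sum_r partial_mx s r i * wave s m (fun k => (0 + (k == l) + (k == r))%N) x)
  = - (\sum_l m l ^+ 2) * wave s m (fun=> 0%N) x.
Proof.
set B := alcove_mx s; set T := partial_mx s.
have TB : T *m B = 1%:M by exact: partial_alcove.
(* In the partial-sum coordinates the symbol is the identity, so only the terms with [l = r]
   survive, and each gives [- m l ^+ 2] by [wave2]. *)
have TGT : T *m (B *m B^T) *m T^T = 1%:M :> 'M[R]_n.
  by rewrite mulmxA TB mul1mx -trmx_mul TB trmx1.
pose w l r := wave s m (fun k => (0 + (k == l) + (k == r))%N) x.
transitivity (\sum_l \sum_r (T *m (B *m B^T) *m T^T) r l * w l r).
  transitivity (\sum_i \sum_j \sum_l \sum_r T r i * (B *m B^T) i j * T l j * w l r).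
    apply: eq_bigr => i _; apply: eq_bigr => j _; rewrite mulr_sumr; apply: eq_bigr => l _.
    by rewrite !mulr_sumr; apply: eq_bigr => r _; rewrite /w; ring.
  transitivity (\sum_l \sum_r \sum_j \sum_i T r i * (B *m B^T) i j * T l j * w l r).
    rewrite (eq_bigr (fun i => \sum_l \sum_j \sum_r T r i * (B *m B^T) i j * T l j * w l r)); last first.
      by move=> i _; rewrite exchange_big.
    rewrite exchange_big; apply: eq_bigr => l _.
    rewrite (eq_bigr (fun i => \sum_r \sum_j T r i * (B *m B^T) i j * T l j * w l r)); last first.
      by move=> i _; rewrite exchange_big.
    by rewrite exchange_big; apply: eq_bigr => r _; rewrite exchange_big.
  apply: eq_bigr => l _; apply: eq_bigr => r _; rewrite mxE mulr_suml; apply: eq_bigr => j _.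
  by rewrite [(T *m (B *m B^T)) r j]mxE [T^T j l]mxE mulr_suml mulr_suml.
rewrite TGT mulNr mulr_suml -sumrN; apply: eq_bigr => l _.
rewrite (bigD1 l)//= big1 ?addr0; last by move=> r rl; rewrite mxE (negbTE rl) mul0r.
by rewrite mxE eqxx mul1r /w wave2 mulNr.
Qed.

Definition alcove_det {R : realType} {n} (s : 'S_n) (x : 'cV[R]_n) : R :=
  \det (\matrix_(k < n, j < n) sin (j.+1%:R * (pi * partial_sum s k x))).

Definition freq {R : realType} {n} (t : 'S_n) (k : 'I_n) : R := pi * (t k).+1%:R.

Lemma alcove_det_wave (R : realType) n (s : 'S_n) (x : 'cV[R]_n) :
  alcove_det s x = \sum_(t : 'S_n) (-1) ^+ t * wave s (freq t) (fun=> 0%N) x.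
Proof.
rewrite /alcove_det /determinant; apply: eq_bigr => t _; congr (_ * _).
apply: eq_bigr => k _; rewrite mxE expr0 mul1r mul0r addr0 /freq; congr sin; ring.
Qed.

(** The [0 +] reproduces literally what [wave_derive] returns for the constant multi-index 0. *)
Definition alcove_grad {R : realType} {n} (s : 'S_n) (i : 'I_n) (x : 'cV[R]_n) : R :=
  \sum_(t : 'S_n) (-1) ^+ t * \sum_l partial_mx s l i * wave s (freq t) (fun k => (0 + (k == l))%N) x.

Definition alcove_hess {R : realType} {n} (s : 'S_n) (i j : 'I_n) (x : 'cV[R]_n) : R :=
  \sum_(t : 'S_n) (-1) ^+ t * \sum_l partial_mx s l j * \sum_r partial_mx s r i *
     wave s (freq t) (fun k => (0 + (k == l) + (k == r))%N) x.

Lemma alcove_det_derive (R : realType) n (s : 'S_n) (i : 'I_n) (x : 'cV[R]_n) :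
  is_derive x (basis_vec i) (alcove_det s) (alcove_grad s i x).
Proof.
rewrite (_ : alcove_det s = fun y => \sum_(t : 'S_n) (-1) ^+ t * wave s (freq t) (fun=> 0%N) y); last first.
  by apply/funext => y; rewrite alcove_det_wave.
apply: is_derive_sum_fun => t; apply: is_derive_cmul; exact: wave_derive.
Qed.

Lemma alcove_grad_derive (R : realType) n (s : 'S_n) (i j : 'I_n) (x : 'cV[R]_n) :
  is_derive x (basis_vec i) (alcove_grad s j) (alcove_hess s i j x).
Proof.
apply: is_derive_sum_fun => t; apply: is_derive_cmul.
apply: is_derive_sum_fun => l; apply: is_derive_cmul; exact: wave_derive.
Qed.

Lemma alcove_det_continuous (R : realType) n (s : 'S_n) : continuous (@alcove_det R n s).
Proof.
rewrite (_ : alcove_det s = fun y => \sum_(t : 'S_n) (-1) ^+ t * wave s (freq t) (fun=> 0%N) y); last first.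
  by apply/funext => y; rewrite alcove_det_wave.
move=> x; apply: cont_at_sum => t _; apply: cont_atM; first exact: cont_at_cst.
exact: wave_continuous.
Qed.

Lemma alcove_grad_continuous (R : realType) n (s : 'S_n) i : continuous (@alcove_grad R n s i).
Proof.
move=> x; apply: cont_at_sum => t _; apply: cont_atM; first exact: cont_at_cst.
apply: cont_at_sum => l _; apply: cont_atM; first exact: cont_at_cst.
exact: wave_continuous.
Qed.

Lemma alcove_hess_continuous (R : realType) n (s : 'S_n) i j : continuous (@alcove_hess R n s i j).
Proof.
move=> x; apply: cont_at_sum => t _; apply: cont_atM; first exact: cont_at_cst.
apply: cont_at_sum => l _; apply: cont_atM; first exact: cont_at_cst.
apply: cont_at_sum => r _; apply: cont_atM; first exact: cont_at_cst.
exact: wave_continuous.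
Qed.

Definition alcove_eigenvalue {R : realType} (n : nat) : R := \sum_(j < n) (pi * j.+1%:R) ^+ 2.

(** Every term of the Leibniz expansion carries the frequencies [pi * 1, ..., pi * n] in some order,
    so all terms share one eigenvalue. *)
Lemma alcove_hess_eigen (R : realType) n (s : 'S_n) (x : 'cV[R]_n) :
  \sum_i \sum_j (alcove_mx s *m (alcove_mx s)^T) i j * alcove_hess s i j x =
  - alcove_eigenvalue n * alcove_det s x.
Proof.
rewrite alcove_det_wave mulr_sumr.
transitivity (\sum_(t : 'S_n) (-1) ^+ t * (\sum_i \sum_j (alcove_mx s *m (alcove_mx s)^T) i j *
    (\sum_l partial_mx s l j * \sum_r partial_mx s r i * wave s (freq t) (fun k => (0 + (k == l) + (k == r))%N) x))).
  rewrite (eq_bigr (fun i => \sum_(t : 'S_n) \sum_j (-1) ^+ t * ((alcove_mx s *m (alcove_mx s)^T) i j *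
    (\sum_l partial_mx s l j * \sum_r partial_mx s r i * wave s (freq t) (fun k => (0 + (k == l) + (k == r))%N) x)))); last first.
    move=> i _; rewrite exchange_big; apply: eq_bigr => j _; rewrite /alcove_hess mulr_sumr.
    by apply: eq_bigr => t _; rewrite mulrCA.
  rewrite exchange_big; apply: eq_bigr => t _; rewrite mulr_sumr; apply: eq_bigr => i _.
  by rewrite mulr_sumr.
apply: eq_bigr => t _; rewrite wave_eigen mulrCA; congr (- _ * _).
by rewrite /alcove_eigenvalue [RHS](reindex_inj (@perm_inj _ t)).
Qed.

Lemma partial_sum_full (R : realType) n (s : 'S_n.+1) (x : 'cV[R]_n.+1) :
  partial_sum s ord_max x = \sum_i x i 0.
Proof.
rewrite [RHS](reindex_inj (@perm_inj _ s)) /partial_sum; apply: eq_bigl => i.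
by rewrite leq_ord.
Qed.

Lemma partial_sum_step (R : realType) n (s : 'S_n.+1) (i : 'I_n.+1) (x : 'cV[R]_n.+1) :
  partial_sum s i x = (if i == ord0 then 0 else partial_sum s (inord i.-1) x) + x (s i) 0.
Proof.
rewrite /partial_sum (bigD1 i)//= addrC; congr (_ + _).
case: eqVneq => [->|i0].
  by rewrite big1// => k; rewrite leqn0 => /andP[k0 /negP]; case; rewrite -val_eqE.
have ip : (0 < i)%N by rewrite lt0n; move: i0; rewrite -val_eqE.
apply: eq_bigl => k; rewrite inordK; last by rewrite (leq_ltn_trans (leq_pred _)).
by rewrite -[RHS]ltnS prednK// -val_eqE /= [RHS]ltn_neqAle andbC.
Qed.

Lemma sin_pi_nat (R : realType) (k : nat) : sin (k%:R * pi : R) = 0.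
Proof.
elim: k => [|k IH]; first by rewrite mul0r sin0.
by rewrite -natr1 mulrDl mul1r sinDpi IH oppr0.
Qed.

Lemma det_row0 (R : comNzRingType) n (A : 'M[R]_n) (k : 'I_n) : (forall j, A k j = 0) -> \det A = 0.
Proof.
by move=> h; rewrite (expand_det_row A k) big1// => j _; rewrite h mul0r.
Qed.

(** On a coordinate face either two consecutive partial sums agree, giving two equal rows, or the
    first one is 0, giving a zero row. On the slanted face the last partial sum is 1 and its row
    consists of sines of multiples of [pi]. *)
Lemma alcove_det_boundary (R : realType) n (s : 'S_n.+1) (x : 'cV[R]_n.+1) :
  simplex x -> ~ inT x -> alcove_det s x = 0.
Proof.
move=> /simplex_lam Tx /not_inT[j hj].
have {hj} : lam j x = 0 by apply/eqP; rewrite eq_le hj Tx.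
case: j => [k|] /=.
  pose i := ((s^-1)%g k); have -> : k = s i by rewrite permKV.
  move=> hk; have := partial_sum_step s i x; rewrite hk addr0.
  case: eqVneq => [-> h|i0 h].
    by apply: (@det_row0 _ _ _ ord0) => j; rewrite mxE h !mulr0 sin0.
  apply: (@determinant_alternate _ _ _ i (inord i.-1)).
    apply/eqP => /(congr1 val) /=; rewrite inordK; last by rewrite (leq_ltn_trans (leq_pred _)).
    have ip : (0 < i)%N by rewrite lt0n; move: i0; rewrite -val_eqE.
    by move: ip; case: (nat_of_ord i) => // m _ /= /esym/n_Sn.
  by move=> j; rewrite !mxE h.
move=> /eqP; rewrite subr_eq0 eq_sym => /eqP h.
apply: (@det_row0 _ _ _ ord_max) => j; rewrite mxE partial_sum_full h mulr1.
exact: sin_pi_nat.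
Qed.

(** The partial sums at the centroid are [(k + 1) / (n + 1)], distinct and strictly between 0 and 1.
    One such point makes the [L^2] norm positive, so that the function can be normalised. *)
Lemma alcove_det_centroid (R : realType) n (s : 'S_n) : alcove_det s (@centroid R n) != 0.
Proof.
have tE k : partial_sum s k (@centroid R n) = k.+1%:R / n.+1%:R.
  rewrite /partial_sum (eq_bigr (fun=> n.+1%:R^-1)); last by move=> i _; rewrite mxE.
  transitivity (\sum_(i < k.+1) (n.+1%:R^-1 : R)); last by rewrite sumr_const card_ord -[_ *+ _]mulr_natl.
  by rewrite (big_ord_widen n (fun=> n.+1%:R^-1 : R) (ltn_ord k)); apply: eq_bigl.
apply: (@det_sin_neq0 _ _ (fun k => pi * partial_sum s k centroid)).
  move=> k; rewrite tE mulr_gt0 ?pi_gt0 ?divr_gt0 ?ltr0Sn//=.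
  by rewrite gtr_pMr ?pi_gt0// ltr_pdivrMr ?ltr0Sn// mul1r ltr_nat ltnS.
move=> k l /(mulfI (lt0r_neq0 (pi_gt0 R))); rewrite !tE => /(divIf _).
rewrite pnatr_eq0 => /(_ isT) /eqP; rewrite eqr_nat eqSS => /eqP h; exact: val_inj.
Qed.

Lemma smooth_regular (R : realType) n (f : 'cV[R]_n -> R) g H :
  continuous f -> (forall i, continuous (g i)) -> (forall i k, continuous (H i k)) ->
  (forall i x, is_derive x (basis_vec i) f (g i x)) ->
  (forall i k x, is_derive x (basis_vec k) (g i) (H k i x)) -> regular f.
Proof.
move=> cf cg cH df dg.
have dE i : 'D_(basis_vec i) f = g i by apply/funext => x; exact: (@derive_val _ _ _ _ _ _ _ (df i x)).
have ddE i k : 'D_(basis_vec k) (g i) = H k i.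
  by apply/funext => x; exact: (@derive_val _ _ _ _ _ _ _ (dg i k x)).
split.
- exact: continuous_subspaceT.
- by move=> i x _; split; [exact: (@ex_derive _ _ _ _ _ _ _ (df i x))|rewrite dE; exact: cg].
- move=> i k x _; rewrite dE; split; [exact: (@ex_derive _ _ _ _ _ _ _ (dg i k x))|rewrite ddE; exact: cH].
- move=> i x _; rewrite dE; apply/cvg_ex; exists (g i x); apply: cvg_within_filter; exact: cg.
Qed.

Lemma regular0 (R : realType) n : regular (fun _ : 'cV[R]_n => (0 : R)).
Proof.
apply: (@smooth_regular _ _ _ (fun _ _ => 0) (fun _ _ _ => 0)) => *; try exact: is_derive_cst; exact: cst_continuous.
Qed.

(** The parameter [h] for which [h ^+ 2] times the eigenvalue is 1, as [P u = u] demands. *)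
Definition alcove_semiclassical {R : realType} (n : nat) : R := (Num.sqrt (alcove_eigenvalue n))^-1.

Lemma alcove_eigenvalue_gt0 (R : realType) n : 0 < alcove_eigenvalue n.+1 :> R.
Proof.
rewrite /alcove_eigenvalue big_ord_recl ltr_wpDr//; first by apply: sumr_ge0 => i _; exact: sqr_ge0.
by rewrite exprn_gt0// mulr1 pi_gt0.
Qed.

Lemma zero_ext_sq_Cc (R : realType) n (f : 'cV[R]_n.+1 -> R) :
  continuous f -> (forall x, simplex x -> ~ inT x -> f x = 0) -> Cc (fun x => zero_ext f x ^+ 2).
Proof.
move=> cf f0; split.
  have cF : continuous (zero_ext f) by apply: zero_ext_continuous => //; exact: continuous_subspaceT.
  by move=> x; apply: cont_atM; exact: cF.
exists 1 => x i hx; rewrite /zero_ext asboolF ?expr0n//.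
by move=> /inT_box/(_ i); rewrite leNgt hx.
Qed.

Lemma alcove_eigenfunction (R : realType) n (s : 'S_n.+1) :
  exists u, eigenfunction (@alcove_semiclassical R n.+1) (alcove_mx s *m (alcove_mx s)^T) u.
Proof.
pose F := zero_ext (@alcove_det R n.+1 s).
have cF2 : Cc (fun x => F x ^+ 2).
  by apply: zero_ext_sq_Cc; [exact: alcove_det_continuous|move=> x; exact: alcove_det_boundary].
pose A := J (fun x => F x ^+ 2).
have A0 : 0 < A.
  apply: (@J_gt0 _ _ _ (@centroid R n.+1) cF2); first by move=> x; exact: sqr_ge0.
  rewrite lt_def sqr_ge0 andbT expf_neq0// /F /zero_ext asboolT ?alcove_det_centroid//; exact: inT_centroid.
pose c := (Num.sqrt A)^-1.
have c2 : c ^+ 2 * A = 1 by rewrite exprVn sqr_sqrtr ?ltW// mulVf// gt_eqF.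
pose u x : R[i] := Complex (c * alcove_det s x) 0.
have du i x : is_derive x (basis_vec i) (fun y => c * alcove_det s y) (c * alcove_grad s i x).
  by apply: is_derive_cmul; exact: alcove_det_derive.
have ddu i k x : is_derive x (basis_vec k) (fun y => c * alcove_grad s i y) (c * alcove_hess s k i x).
  by apply: is_derive_cmul; exact: alcove_grad_derive.
exists u; split.
- apply: (@smooth_regular _ _ _ (fun i x => c * alcove_grad s i x) (fun i k x => c * alcove_hess s i k x)) => //.
  + move=> x; apply: cont_atM; [exact: cont_at_cst|exact: alcove_det_continuous].
  + move=> i x; apply: cont_atM; [exact: cont_at_cst|exact: alcove_grad_continuous].
  + move=> i k x; apply: cont_atM; [exact: cont_at_cst|exact: alcove_hess_continuous].
- exact: regular0.
- move=> x _; set h := alcove_semiclassical _.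
  have h2 : h ^+ 2 * alcove_eigenvalue n.+1 = 1.
    by rewrite exprVn sqr_sqrtr ?ltW ?alcove_eigenvalue_gt0// mulVf// gt_eqF// alcove_eigenvalue_gt0.
  apply/eqP; rewrite eq_complex Re_semiclassical_op Im_semiclassical_op /=; apply/andP; split; apply/eqP.
    transitivity (- (h ^+ 2 * c * \sum_i \sum_k (alcove_mx s *m (alcove_mx s)^T) i k * alcove_hess s i k x)).
      congr (- _); rewrite mulr_sumr; apply: eq_bigr => i _; rewrite mulr_sumr; apply: eq_bigr => k _.
      rewrite (_ : (fun y => _) = fun y => h * (c * alcove_grad s k y)); last first.
        by apply/funext => y; rewrite (@derive_val _ _ _ _ _ _ _ (du k y)).
      rewrite (@derive_val _ _ _ _ _ _ _ (is_derive_cmul h (ddu k i x))); ring.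
    rewrite alcove_hess_eigen; move: (alcove_det s x) h2 => a; move: (alcove_eigenvalue _) => L h2.
    by transitivity (h ^+ 2 * L * (c * a)); [ring|rewrite h2 mul1r].
  rewrite big1 ?oppr0// => i _; rewrite big1// => k _.
  rewrite (_ : (fun y => _) = fun=> 0); last first.
    by apply/funext => y; rewrite (@derive_val _ _ _ _ _ _ _ (is_derive_cst 0 y (basis_vec k))) mulr0.
  by rewrite (@derive_val _ _ _ _ _ _ _ (is_derive_cst 0 x (basis_vec i))) !mulr0.
- move=> x [Tx nT]; rewrite /u (@alcove_det_boundary R n s x Tx) ?mulr0// => Ti; apply: nT; exact/interior_simplex.
- rewrite /set_integral (_ : (fun x => _) = (fun x => (c ^+ 2 * F x ^+ 2)%:E)); last first.
    apply/funext => x; congr (_%:E); rewrite /sqmod /= expr0n addr0 /F /zero_ext indicE.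
    have [Tx|nT] := pselect (inT x).
      by rewrite !asboolT// mem_set ?mul1r ?exprMn//; exact: inT_simplex.
    rewrite !asboolF// expr0n mulr0.
    have [Sx|nS] := pselect (simplex x); last by rewrite memNset// mul0r.
    by rewrite (@alcove_det_boundary R n s x Sx nT) mulr0 expr0n mulr0.
  by rewrite (J_EFin (CcZ (c ^+ 2) cF2)) (JZ (c ^+ 2) cF2) -/A c2.
Qed.

(** * Neumann norms and the quadratic form *)

Lemma quad_Some (R : realType) n (Gam : 'M[R]_n) (k : 'I_n) : quad Gam (Some k) = Gam k k.
Proof.
rewrite /quad (bigD1 k)//= [X in _ + X]big1 ?addr0; last first.
  by move=> i ik; rewrite big1// => l _; rewrite (negbTE ik) !mul0r.
rewrite (bigD1 k)//= big1 ?addr0; first by rewrite eqxx mul1r mulr1.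
by move=> i ik; rewrite (negbTE ik) mulr0.
Qed.

Lemma quad_None (R : realType) n (Gam : 'M[R]_n) : quad Gam None = \sum_i \sum_k Gam i k.
Proof. by apply: eq_bigr => i _; apply: eq_bigr => k _ /=; rewrite mulN1r mulrN1 opprK. Qed.

Lemma sqnorm_normal_eq (R : realType) n (B B' : 'M[R]_n.+1) :
  (forall j, sqnorm (B^T *m normal j) = sqnorm (B'^T *m normal j)) <->
  (forall j, quad (B *m B^T) j = quad (B' *m B'^T) j).
Proof.
split=> h j; first by rewrite !sqnorm_quad h.
by apply: (mulfI (lt0r_neq0 (glam_sq_gt0 R j))); rewrite -!sqnorm_quad h.
Qed.

Lemma sqnorm_eq_agree (R : realType) n (B B' : 'M[R]_n.+1) :
  (forall j, sqnorm (B^T *m normal j) = sqnorm (B'^T *m normal j)) -> neumann_norms_agree B B'.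
Proof.
move=> h t t' u u' _ _ /neumann_sqnormE e /neumann_sqnormE e' j.
by rewrite (e j).2 (e' j).2 h.
Qed.

Lemma neumann_eq_sqnorm (R : realType) n (h h' : R) (B B' : 'M[R]_n.+1) u u' :
  eigenfunction h (B *m B^T) u -> eigenfunction h' (B' *m B'^T) u' ->
  (forall j, neumann_sqnorm h u j = neumann_sqnorm h' u' j) ->
  forall j, sqnorm (B^T *m normal j) = sqnorm (B'^T *m normal j).
Proof.
move=> /neumann_sqnormE e /neumann_sqnormE e' h0 j; have := h0 j.
have [s1 ->] := e j; have [s2 ->] := e' j => -[].
have fd : 2 * face_density j != 0 :> R.
  by rewrite mulf_neq0 ?pnatr_eq0//; case: j {s1 s2} => [k|] /=; rewrite ?oner_eq0// gt_eqF// sqrtr_gt0 ltr0Sn.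
by move=> /(mulfI fd)/invr_inj.
Qed.

Lemma neumann_norms_determine2 (R : realType) (h h' : R) : neumann_norms_determine 1 h h'.
Proof.
move=> B B' u u' _ _ e e' he.
have := proj1 (sqnorm_normal_eq B B') (neumann_eq_sqnorm e e' he).
have s1 : (B *m B^T)^T = B *m B^T by rewrite trmx_mul trmxK.
have s2 : (B' *m B'^T)^T = B' *m B'^T by rewrite trmx_mul trmxK.
move: s1 s2; clear; move: (B *m B^T) (B' *m B'^T) => G G' sG sG' h.
have d k : G k k = G' k k by rewrite -!quad_Some h.
have off : G 0 1 = G' 0 1.
  have := h None; rewrite !quad_None !big_ord_recl !big_ord0 /= !addr0.
  rewrite (_ : lift 0 0 = 1); last exact: val_inj.
  have g : G 1 0 = G 0 1 by rewrite -[in LHS]sG mxE.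
  have g' : G' 1 0 = G' 0 1 by rewrite -[in LHS]sG' mxE.
  rewrite g g'; have := d 0; have := d 1; lra.
apply/matrixP => i k.
have o2 (a : 'I_2) : a = 0 \/ a = 1.
  by case: a => -[|[|//]] p; [left|right]; exact: val_inj.
have [->|->] := o2 i; have [->|->] := o2 k; rewrite ?d ?off//.
by rewrite -[in LHS]sG -[in RHS]sG' !mxE.
Qed.

Lemma alcove_gramE (R : realType) n (s : 'S_n) (i k : 'I_n) :
  (alcove_mx s *m (alcove_mx s)^T) i k =
  \sum_(l < n) (bidiag ((s^-1)%g i) l * bidiag ((s^-1)%g k) l : R).
Proof. by rewrite mxE; apply: eq_bigr => l _; rewrite !mxE. Qed.

(** Row [a] has the entries 1 at [a] and -1 at [a.-1]. Row 0 has only the first of these, hence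
    squared norm 1; this is why [0 < a] is assumed. *)
Lemma bidiag_sq (R : realType) n (a : nat) : (0 < a < n)%N ->
  \sum_(l < n) (bidiag a l * bidiag a l : R) = 2.
Proof.
move=> /andP[a0 an].
rewrite (eq_bigr (fun l : 'I_n => ((l : nat) == a)%:R + ((l : nat) == a.-1)%:R)); last first.
  move=> l _; rewrite /bidiag -[in a == l.+1](prednK a0) eqSS ![_ == nat_of_ord l]eq_sym.
  have [la|la] := eqVneq (l : nat) a; have [lb|lb] := eqVneq (l : nat) a.-1; rewrite /= ?mulr1n ?mulr0n; try by ring.
  by move: a0; rewrite -[in X in (_ < X)%N -> _]la lb; case: a la lb {an} => //= m -> /esym/n_Sn.
rewrite big_split /= (sum_eq_ord R n predT) (sum_eq_ord R n predT) an (leq_ltn_trans (leq_pred a) an).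
by [].
Qed.

Lemma alcove_quad_None (R : realType) n (s : 'S_n) :
  quad (alcove_mx s *m (alcove_mx s)^T) None = \sum_(i < n) \sum_(k < n) \sum_(l < n) (bidiag i l * bidiag k l : R).
Proof.
rewrite quad_None [RHS](reindex_inj (@perm_inj _ s^-1%g)); apply: eq_bigr => i _ /=.
rewrite [RHS](reindex_inj (@perm_inj _ s^-1%g)); apply: eq_bigr => k _; exact: alcove_gramE.
Qed.

(** The permutation only permutes the entries of the Gram matrix, so their sum is unchanged. The
    unpermuted diagonal is [1, 2, ..., 2], so a permutation fixing index 0 leaves the diagonal
    unchanged too. *)
Lemma alcove_quad_eq (R : realType) n (s t : 'S_n.+1) : s ord0 = ord0 -> t ord0 = ord0 ->
  forall j, quad (alcove_mx s *m (alcove_mx s)^T) j = quad (alcove_mx t *m (alcove_mx t)^T) j :> R.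
Proof.
move=> s0 t0 [k|]; last by rewrite !alcove_quad_None.
have inv0 (r : 'S_n.+1) : r ord0 = ord0 -> (r^-1)%g ord0 = ord0 by move=> h; rewrite -{1}h permK.
rewrite !quad_Some !alcove_gramE; have [->|k0] := eqVneq k ord0; first by rewrite !inv0.
have b (r : 'S_n.+1) : r ord0 = ord0 -> (0 < (r^-1)%g k < n.+1)%N.
  move=> h; rewrite ltn_ord andbT lt0n; apply: contra k0 => /eqP r0.
  by apply/eqP; rewrite -(permKV r k) -[RHS]h; congr (r _); exact: val_inj.
by rewrite !bidiag_sq// b.
Qed.

Lemma alcove_gram0 (R : realType) n (s : 'S_n.+1) (k : 'I_n.+1) : s ord0 = ord0 ->
  (alcove_mx s *m (alcove_mx s)^T) ord0 k = bidiag ((s^-1)%g k) 0 :> R.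
Proof.
move=> s0; rewrite alcove_gramE (_ : (s^-1)%g ord0 = ord0); last by rewrite -{1}s0 permK.
rewrite big_ord_recl big1 ?addr0 => [|i _]; rewrite [bidiag ord0 _]/bidiag /=; first by rewrite subr0 mul1r.
by rewrite subrr mul0r.
Qed.

(** Exchanging the indices 1 and 2 fixes 0, so all face norms agree with those of the unpermuted
    alcove. Index 0 is coupled only to its neighbour, so the Gram entry at [(0, 1)] is -1 without
    the exchange and 0 with it. Three coordinates are needed for this. *)
Lemma not_neumann_norms_determine (R : realType) n : (2 <= n)%N ->
  ~ @neumann_norms_determine R n (alcove_semiclassical n.+1) (alcove_semiclassical n.+1).
Proof.
move=> n2; pose s : 'S_n.+1 := tperm (inord 1) (inord 2).
have e1 : (inord 1 : 'I_n.+1) = 1%N :> nat by rewrite inordK// ltnS (leq_trans _ n2).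
have e2 : (inord 2 : 'I_n.+1) = 2%N :> nat by rewrite inordK.
have s0 : s ord0 = ord0.
  by rewrite tpermD// -val_eqE /= ?e1 ?e2.
have t0 : (1%g : 'S_n.+1) ord0 = ord0 by rewrite perm1.
have [u eu] := alcove_eigenfunction R s; have [u' eu'] := @alcove_eigenfunction R n 1%g.
move=> /(_ _ _ _ _ (alcove_unit R s) (alcove_unit R 1%g) eu eu').
have ag := sqnorm_eq_agree (proj2 (sqnorm_normal_eq (alcove_mx s) (alcove_mx 1%g)) (@alcove_quad_eq R n s 1%g s0 t0)).
have h0 : 0 < alcove_semiclassical n.+1 :> R by rewrite invr_gt0 sqrtr_gt0 alcove_eigenvalue_gt0.
move=> /(_ (ag _ _ _ _ h0 h0 eu eu')) /matrixP /(_ ord0 (inord 1)).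
rewrite !alcove_gram0// invg1 perm1 tpermV tpermL /bidiag e1 e2 /= subrr sub0r.
by move=> /eqP; rewrite eq_sym oppr_eq0 oner_eq0.
Qed.

(** * Small perturbations of the identity in every dimension at least 3 *)

Definition shear_row {R : realType} (t : R) (l : nat) : R :=
  (Num.sqrt (1 - 2 * t ^+ 2) - 1) * (l == 0%N)%:R + t * (l == 1%N)%:R - t * (l == 2%N)%:R.

(** The identity with row 0 replaced by [(a, t, - t, 0, ...)], where
    [a = Num.sqrt (1 - 2 * t ^+ 2)]. When [2 * t ^+ 2 <= 1] this row is a unit vector, so the Gram
    matrix has diagonal 1; its only other nonzero entries are [t] and [- t] in row and column 0, and
    they cancel in the sum of all entries. *)
Definition shear_mx {R : realType} n (t : R) : 'M[R]_n :=
  \matrix_(i, l) ((i == l)%:R + ((i : nat) == 0%N)%:R * shear_row t l).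

Lemma shear_row_sum (R : realType) n (t : R) : (3 <= n)%N ->
  \sum_(l < n) shear_row t l = Num.sqrt (1 - 2 * t ^+ 2) - 1.
Proof.
move=> n3; rewrite /shear_row sumrB big_split /= -!mulr_sumr.
rewrite (sum_eq_ord R n predT 0) (sum_eq_ord R n predT 1) (sum_eq_ord R n predT 2) n3.
by rewrite (leq_trans _ n3)// (leq_trans _ n3)//= !mulr1 addrK.
Qed.

Lemma shear_row_sq (R : realType) n (t : R) : (3 <= n)%N -> 2 * t ^+ 2 <= 1 ->
  \sum_(l < n) shear_row t l ^+ 2 = - 2 * (Num.sqrt (1 - 2 * t ^+ 2) - 1).
Proof.
move=> n3 t1; set a := Num.sqrt _; have a2 : a ^+ 2 = 1 - 2 * t ^+ 2 by rewrite sqr_sqrtr// subr_ge0.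
rewrite (eq_bigr (fun l : 'I_n => (a - 1) ^+ 2 * ((l : nat) == 0%N)%:R + t ^+ 2 * ((l : nat) == 1%N)%:R
  + t ^+ 2 * ((l : nat) == 2%N)%:R)); last first.
  by move=> [[|[|[|l]]] ln] _; rewrite /shear_row -/a /= ?mulr1n ?mulr0n; ring.
rewrite !big_split /= -!mulr_sumr.
rewrite (sum_eq_ord R n predT 0) (sum_eq_ord R n predT 1) (sum_eq_ord R n predT 2) n3.
rewrite (leq_trans _ n3)// (leq_trans _ n3)//= !mulr1.
have -> : (a - 1) ^+ 2 + t ^+ 2 + t ^+ 2 = a ^+ 2 + 2 * t ^+ 2 - 2 * a + 1 by ring.
rewrite a2; ring.
Qed.

Lemma sum_delta (R : realType) n (f : 'I_n -> R) (k : 'I_n) : \sum_l (k == l)%:R * f l = f k.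
Proof.
rewrite (bigD1 k)//= eqxx mul1r big1 ?addr0// => l lk.
by rewrite eq_sym (negbTE lk) mul0r.
Qed.

Lemma shear_gram (R : realType) n (t : R) (i k : 'I_n) : (3 <= n)%N -> 2 * t ^+ 2 <= 1 ->
  (shear_mx n t *m (shear_mx n t)^T) i k = (i == k)%:R + ((k : nat) == 0%N)%:R * shear_row t i
    + ((i : nat) == 0%N)%:R * shear_row t k
    - 2 * (((i : nat) == 0%N)%:R * ((k : nat) == 0%N)%:R * (Num.sqrt (1 - 2 * t ^+ 2) - 1)).
Proof.
move=> n3 t1; rewrite mxE.
transitivity (\sum_l (i == l)%:R * ((k == l)%:R : R) + ((k : nat) == 0%N)%:R * \sum_(l < n) (i == l)%:R * shear_row t l
  + ((i : nat) == 0%N)%:R * \sum_(l < n) (k == l)%:R * shear_row t l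
  + ((i : nat) == 0%N)%:R * ((k : nat) == 0%N)%:R * \sum_(l < n) shear_row t l ^+ 2).
  rewrite !mulr_sumr -!big_split; apply: eq_bigr => l _; rewrite !mxE /=.
  by move: (shear_row t l) => r; ring.
rewrite shear_row_sq// !sum_delta [k == i]eq_sym; ring.
Qed.

Lemma shear_quad (R : realType) n (t : R) : (3 <= n)%N -> 2 * t ^+ 2 <= 1 ->
  forall j, quad (shear_mx n t *m (shear_mx n t)^T) j = quad (1%:M : 'M[R]_n) j.
Proof.
move=> n3 t1 [k|].
  rewrite !quad_Some shear_gram// [in RHS]mxE eqxx.
  by case: k => -[|k] kn; rewrite /shear_row /= ?mulr1n ?mulr0n; ring.
have n0 : (0 < n)%N by rewrite (leq_trans _ n3).
rewrite !quad_None; pose a := Num.sqrt (1 - 2 * t ^+ 2).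
have s0 (c : R) : \sum_(i < n) ((i : nat) == 0%N)%:R * c = c.
  by rewrite -mulr_suml (sum_eq_ord R n predT 0) n0 mul1r.
transitivity (\sum_(i < n) (\sum_k ((1%:M : 'M[R]_n) i k) + shear_row t i
   + ((i : nat) == 0%N)%:R * (a - 1) - 2 * (((i : nat) == 0%N)%:R * (a - 1)))).
  apply: eq_bigr => i _; rewrite (eq_bigr (fun k : 'I_n => (1%:M : 'M[R]_n) i k + ((k : nat) == 0%N)%:R * shear_row t i
    + ((i : nat) == 0%N)%:R * shear_row t k - 2 * (((k : nat) == 0%N)%:R * (((i : nat) == 0%N)%:R * (a - 1))))); last first.
    by move=> k _; rewrite shear_gram// mxE -/a; ring.
  by rewrite sumrB !big_split /= -!mulr_sumr !s0 shear_row_sum.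
rewrite sumrB 2!big_split /= -mulr_sumr !s0 (shear_row_sum t n3) -/a.
by move: (\sum_i _) => S; ring.
Qed.

Lemma mx_norm_lt (R : realType) m n (M : 'M[R]_(m, n)) (d : R) : 0 < d ->
  (forall i k, `|M i k| < d) -> `|M| < d.
Proof.
by move=> d0 h; rewrite [`|M|]mx_normrE; apply/bigmax_ltP; split => // -[i k] _; exact: h.
Qed.

Lemma sqrt_near1 (R : realType) (x : R) : 0 <= x <= 1 ->
  0 <= 1 - Num.sqrt (1 - x) <= x.
Proof.
move=> /andP[x0 x1]; set q := Num.sqrt _; have q0 : 0 <= q by exact: sqrtr_ge0.
have q2 : q ^+ 2 = 1 - x by rewrite sqr_sqrtr// subr_ge0.
have q1 : q <= 1 by rewrite -(@ler_pXn2r _ 2)// ?nnegrE// q2 expr1n; lra.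
apply/andP; split; first by lra.
have : 0 <= (1 - q) * q by rewrite mulr_ge0//; lra.
rewrite mulrBl mul1r -expr2 q2; lra.
Qed.

Lemma shear_perturbation (R : realType) n (delta : R) : (3 <= n.+1)%N -> 0 < delta ->
  exists B : 'M[R]_n.+1,
    [/\ B \in unitmx, `|B - 1%:M| < delta, B *m B^T <> 1%:M &
        forall j, sqnorm (B^T *m normal j) = sqnorm ((1%:M : 'M[R]_n.+1)^T *m normal j)].
Proof.
move=> n3 d0; pose t := Num.min 2^-1 (delta / 2).
have t0 : 0 < t by rewrite lt_min invr_gt0 ltr0n divr_gt0.
have th : t <= 2^-1 by rewrite ge_min lexx.
have td : t < delta.
  by apply: (@le_lt_trans _ _ (delta / 2)); [rewrite ge_min lexx orbT|lra].
have tt : 2 * t ^+ 2 <= t by rewrite expr2; nra.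
have t1 : 2 * t ^+ 2 <= 1 by lra.
have /sqrt_near1 : 0 <= 2 * t ^+ 2 <= 1 by rewrite t1 andbT mulr_ge0// sqr_ge0.
set a := Num.sqrt _ => /andP[a1 a2].
exists (shear_mx n.+1 t); split.
- rewrite -unitmx_tr unitmxE det_trig; last first.
    apply/is_trig_mxP => i l il; rewrite !mxE -val_eqE /= [(l : nat) == i]eq_sym (ltn_eqF il).
    by rewrite (_ : (l : nat) == 0%N = false) ?mul0r ?addr0//; case: (nat_of_ord l) il.
  rewrite unitfE; apply/prodf_neq0 => -[[|i] ni] _; rewrite !mxE eqxx /shear_row /= ?mulr0n ?mulr1n; last first.
    by rewrite mul0r addr0 oner_neq0.
  by rewrite -/a !mul1r !mulr0 !subr0 !addr0 mulr1 addrC subrK gt_eqF//; lra.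
- apply: mx_norm_lt => // i [[|[|[|l]]] ln]; rewrite !mxE -/a addrC addKr /shear_row /= ?mulr0n ?mulr1n -/a;
    case: (_ == 0%N); rewrite /= ?mulr0n ?mulr1n ?mul0r ?normr0// !mul1r ?mulr0 ?mulr1 ?addr0 ?add0r ?subr0 ?normrN ?subrr ?normr0//.
    + by rewrite distrC ger0_norm//; lra.
    + by rewrite gtr0_norm.
    + by rewrite gtr0_norm.
- move=> /matrixP /(_ ord0 (inord 1)); rewrite shear_gram// !mxE -val_eqE /= inordK; last exact: ltn_trans n3.
  rewrite /shear_row /= ?mulr0n ?mulr1n => h; have : t = 0 by move: h; lra.
  by move=> tz; move: t0; rewrite tz ltxx.
- by apply: (proj2 (sqnorm_normal_eq (shear_mx n.+1 t) 1%:M)) => j; rewrite shear_quad// mul1mx trmx1.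
Qed.

(** * The family ex_B *)

Lemma ex_sqrt (R : realType) (e : R) : 0 < e < 1 ->
  let q := Num.sqrt (1 - e ^+ 2) in [/\ q ^+ 2 = 1 - e ^+ 2, 0 < q & ex_d e * (q + e) = - 3 * e * q - e ^+ 2].
Proof.
move=> /andP[e0 e1] q.
have p : 0 < 1 - e ^+ 2 by rewrite subr_gt0 expr_lt1// ltW.
have q0 : 0 < q by rewrite sqrtr_gt0.
split=> //; first by rewrite sqr_sqrtr// ltW.
by rewrite /ex_d -/q divfK// gt_eqF// addr_gt0.
Qed.

Lemma ex_BTE (R : realType) (e : R) (v : 'cV[R]_3) :
  sqnorm (ex_BT e *m v) = (ex_a e * v 0 0) ^+ 2
    + (ex_d e * v 0 0 + Num.sqrt (1 - e ^+ 2) * v 1 0 + e * v 2%:R 0) ^+ 2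
    + (e * v 0 0 + e * v 1 0 + Num.sqrt (1 - e ^+ 2) * v 2%:R 0) ^+ 2.
Proof.
rewrite /sqnorm !big_ord_recl big_ord0 !mxE !big_ord_recl !big_ord0 !mxE /=.
rewrite (_ : lift ord0 (lift ord0 ord0) = 2%:R); last exact: val_inj.
rewrite (_ : lift ord0 ord0 = 1); last exact: val_inj.
rewrite !mul0r !addr0 !addrA; reflexivity.
Qed.

Lemma sqnorm_mul_normal (R : realType) n (A : 'M[R]_n) (j : option 'I_n) :
  sqnorm (A *m normal j) = if j is Some k then sqnorm (A *m basis_vec k)
    else (Num.sqrt n%:R)^-1 ^+ 2 * sqnorm (A *m const_mx 1).
Proof.
case: j => [k|] /=.
  by apply: eq_bigr => i _; rewrite mulmxN mxE sqrrN.
by rewrite /sqnorm mulr_sumr; apply: eq_bigr => i _; rewrite -scalemxAr mxE exprMn.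
Qed.

Lemma ex_B_sqnorm (R : realType) (e : R) : 0 < e < 1 -> 0 <= ex_a_sq e ->
  (forall i : 'I_3, sqnorm ((ex_B e)^T *m basis_vec i) = 1) /\
  sqnorm ((ex_B e)^T *m const_mx 1) = 3.
Proof.
move=> e01 a0; have [] := ex_sqrt e01; set q := Num.sqrt _ => q2 q0 dE.
have a2 : ex_a e ^+ 2 = 1 - ex_d e ^+ 2 - e ^+ 2 by rewrite sqr_sqrtr.
rewrite /ex_B trmxK; split; last first.
  rewrite ex_BTE !mxE !mulr1 -/q.
  transitivity (ex_a e ^+ 2 + ex_d e ^+ 2 + 2 * (ex_d e * (q + e)) + 2 * q ^+ 2 + 6 * e * q + 5 * e ^+ 2).
    by move: (ex_a e) (ex_d e) => a d; ring.
  by rewrite a2 dE q2; move: (ex_d e) => d; ring.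
move=> i; rewrite ex_BTE -/q.
have i3 : [\/ i = 0, i = 1 | i = 2%:R].
  by case: i => -[|[|[|//]]] p; [apply: Or31|apply: Or32|apply: Or33]; exact: val_inj.
case: i3 => ->; rewrite !mxE /= ?mulr0n ?mulr1n ?mulr0 ?mulr1 ?addr0 ?add0r.
- rewrite a2; move: (ex_d e) => d; ring.
- by rewrite expr0n add0r q2 subrK.
- by rewrite expr0n add0r q2 addrC subrK.
Qed.

Lemma ex_B_sqnorm_normal (R : realType) (e : R) : 0 < e < 1 -> 0 <= ex_a_sq e ->
  forall j, sqnorm ((ex_B e)^T *m normal j) = sqnorm ((1%:M : 'M[R]_3)^T *m normal j).
Proof.
move=> e01 a0 j; have [h1 h2] := ex_B_sqnorm e01 a0.
rewrite !sqnorm_mul_normal trmx1; case: j => [k|]; rewrite mul1mx.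
  rewrite h1 /sqnorm (bigD1 k)//= mxE !eqxx expr1n big1 ?addr0// => i ik.
  by rewrite mxE (negbTE ik) expr0n.
rewrite h2; congr (_ * _); rewrite /sqnorm (eq_bigr (fun=> 1)) ?sumr_const ?card_ord//.
by move=> i _; rewrite mxE expr1n.
Qed.

Lemma ex_B_gram_neq1 (R : realType) (e : R) : 0 < e < 1 -> ex_B e *m (ex_B e)^T <> 1%:M.
Proof.
move=> e01; have [] := ex_sqrt e01; set q := Num.sqrt _ => q2 q0 dE.
move=> /matrixP /(_ 1 2%:R); rewrite mxE !big_ord_recl big_ord0 !mxE /= -/q.
rewrite !mul0r add0r addr0 [e * q]mulrC => h.
have : q * e = 0 by move: h; rewrite /= ?mulr0n; lra.
by move/eqP; rewrite mulf_eq0 !gt_eqF//; case/andP: e01.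
Qed.

Lemma ex_B_det (R : realType) (e : R) :
  \det (ex_B e) = ex_a e * (Num.sqrt (1 - e ^+ 2) ^+ 2 - e ^+ 2).
Proof.
rewrite /ex_B det_tr (expand_det_row _ 0) !big_ord_recl big_ord0 !mxE /= !mul0r !addr0.
congr (_ * _); rewrite /cofactor (expand_det_row _ 0) !big_ord_recl big_ord0 /cofactor !det_mx11 !mxE /=.
rewrite ?expr0 ?expr1; ring.
Qed.

Lemma ex_bounds (R : realType) (e : R) : 0 < e < 10^-1 ->
  [/\ `|ex_d e| <= 4 * e, 0 < ex_a_sq e, `|ex_a e - 1| <= 17 * e &
      `|Num.sqrt (1 - e ^+ 2) - 1| <= e].
Proof.
move=> /andP[e0 e1]; have e01 : 0 < e < 1 by apply/andP; split => //; lra.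
have [] := ex_sqrt e01; set q := Num.sqrt _ => q2 q0 dE.
have ee : 0 <= e ^+ 2 <= 1 by rewrite sqr_ge0 expr_le1//; lra.
have /andP[q1 q3] := sqrt_near1 ee; rewrite -/q in q1 q3.
have e2 : e ^+ 2 <= e / 10 by rewrite expr2 ler_wpM2l ?ltW.
have qe : 1 <= q + e by lra.
have d0 : `|ex_d e| <= 4 * e.
  have : `|ex_d e| * (q + e) <= 4 * e.
    rewrite -[X in _ * X](@ger0_norm _ (q + e)); last by lra.
    rewrite -normrM dE (_ : _ - _ = - (3 * e * q + e ^+ 2)); last by ring.
    have eq0 : 0 <= e * q by rewrite mulr_ge0// ltW.
    have : e * q <= e by rewrite ler_piMr//; lra.
    rewrite normrN ger0_norm; last by rewrite addr_ge0 ?sqr_ge0// -mulrA mulr_ge0.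
    rewrite -mulrA; lra.
  by apply: le_trans; rewrite ler_peMr.
have dd : ex_d e ^+ 2 <= 16 * e ^+ 2.
  rewrite -(real_normK (num_real (ex_d e))) (_ : 16 * e ^+ 2 = (4 * e) ^+ 2); last by ring.
  by rewrite ler_pXn2r// nnegrE//; lra.
have x01 : 0 <= ex_d e ^+ 2 + e ^+ 2 <= 1.
  by rewrite addr_ge0 ?sqr_ge0//=; lra.
have asq : ex_a_sq e = 1 - (ex_d e ^+ 2 + e ^+ 2) by rewrite /ex_a_sq; ring.
have /andP[a1 a2] := sqrt_near1 x01; rewrite -asq -/(ex_a e) in a1 a2.
split => //.
- by rewrite asq; lra.
- by rewrite distrC ger0_norm//; lra.
- by rewrite distrC ger0_norm//; lra.
Qed.

Lemma ex_B_bigO (R : realType) :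
  (fun e : R => ex_B e - 1%:M) =O_ ((0 : R)^'+) (fun e : R => e : R^o).
Proof.
apply/eqO_exP; exists 18 => //; near=> e.
have e0 : 0 < e by near: e; exact: nbhs_right_gt.
have e01 : 0 < e < 10^-1 by rewrite e0 /=; near: e; exact: nbhs_right_lt.
have [b1 _ b2 b3] := ex_bounds e01.
apply/ltW/mx_norm_lt => [|i k]; rewrite (@gtr0_norm _ (e : R))//; first by rewrite mulr_gt0.
rewrite !mxE.
case: i => -[|[|[|//]]] i3; case: k => -[|[|[|//]]] k3; rewrite /= ?mulr0n ?mulr1n ?subrr ?subr0 ?normr0;
  rewrite ?(gtr0_norm e0); lra.
Unshelve. all: by end_near.
Qed.

Lemma ex_B_near0 (R : realType) :
  \forall e \near (0 : R)^'+, 0 < ex_a_sq e /\ ex_B e \in unitmx.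
Proof.
near=> e.
have e0 : 0 < e by near: e; exact: nbhs_right_gt.
have e01 : 0 < e < 10^-1 by rewrite e0 /=; near: e; exact: nbhs_right_lt.
have [_ a0 _ _] := ex_bounds e01; split => //.
have /andP[_ e1] := e01; have e2 : e ^+ 2 <= e / 10 by rewrite expr2 ler_wpM2l ?ltW.
rewrite unitmxE ex_B_det unitfE mulf_neq0// gt_eqF//; first by rewrite sqrtr_gt0.
by rewrite sqr_sqrtr; lra.
Unshelve. all: by end_near.
Qed.

Theorem mainTheorem4 (R : realType) :
  (* dimension 2 *)
  (forall h h' : R, 0 < h -> 0 < h' -> neumann_norms_determine 1 h h') /\
  (* every dimension n.+1 >= 3 *)
  (forall n : nat, (3 <= n.+1)%N ->
     (exists2 h : R, 0 < h & ~ neumann_norms_determine n h h) /\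
     (* failure for arbitrarily small perturbations of the identity *)
     (forall delta : R, 0 < delta ->
        exists B : 'M[R]_n.+1,
          [/\ B \in unitmx, `|B - 1%:M| < delta, B *m B^T <> 1%:M,
              forall j, sqnorm (B^T *m normal j) =
                        sqnorm ((1%:M : 'M[R]_n.+1)^T *m normal j) &
              neumann_norms_agree B 1%:M])) /\
  (* the example in dimension 3 *)
  [/\ (fun e : R => ex_B e - 1%:M) =O_ ((0 : R)^'+) (fun e : R => e : R^o),
      \forall e \near (0 : R)^'+, 0 < ex_a_sq e /\ ex_B e \in unitmx &
      forall e : R, 0 < e < 1 -> 0 <= ex_a_sq e ->
        [/\ forall i : 'I_3, sqnorm ((ex_B e)^T *m basis_vec i) = 1,
            sqnorm ((ex_B e)^T *m const_mx 1) = 3,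
            forall j, sqnorm ((ex_B e)^T *m normal j) =
                      sqnorm ((1%:M : 'M[R]_3)^T *m normal j),
            ex_B e *m (ex_B e)^T <> 1%:M &
            ex_B e \in unitmx -> neumann_norms_agree (ex_B e) 1%:M]].
Proof.
split; first by move=> h h' _ _; exact: neumann_norms_determine2.
split.
  move=> n n3; split.
    exists (alcove_semiclassical n.+1); last exact: not_neumann_norms_determine.
    by rewrite invr_gt0 sqrtr_gt0 alcove_eigenvalue_gt0.
  move=> delta d0; have [B [uB nB gB sB]] := shear_perturbation n3 d0.
  exists B; split; [exact: uB|exact: nB|exact: gB|exact: sB|].
  exact: (@sqnorm_eq_agree R n B 1%:M sB).
split; [exact: ex_B_bigO|exact: ex_B_near0|].
move=> e e01 a0; have [h1 h2] := ex_B_sqnorm e01 a0.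
have h3 := ex_B_sqnorm_normal e01 a0.
split; [exact: h1|exact: h2|exact: h3|exact: ex_B_gram_neq1|move=> _].
exact: (@sqnorm_eq_agree R 2 (ex_B e) 1%:M h3).
Qed.
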